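(* Let $N$ be a positive integer, $0<\alpha<1$, $a>0$, and let $Q\in L^{2}_{N\times N}(0,\pi)$ be a real symmetric $N\times N$ matrix-valued function. Let $\lambda_0(Q)\le\lambda_1(Q)\le\cdots$ and $\lambda_0(0)\le\lambda_1(0)\le\cdots$ be the eigenvalues (counted with multiplicity, in ascending order) of the vector-impulsive Sturm-Liouville problems $L(Q)$ and $L(0)$, respectively, where $L(0)$ is the problem with zero potential and the same $N,\alpha,a$. If $\lambda_{n}(Q)=\lambda_{n}(0)$ for all $n=0,1,2,\ldots$, then $Q(x)=0$ for a.e. $x\in(0,\pi)$.
   Context: Fix a positive integer $N$ and real numbers $0<\alpha<1$ and $a>0$. Let $\rho(x)=1$ for $0<x<\frac{\pi}{2}$ and $\rho(x)=\alpha^{2}$ for $\frac{\pi}{2}<x<\pi$. $Q\in L^{2}_{N\times N}(0,\pi)$ means that $Q$ is an $N\times N$ matrix-valued function each of whose entries belongs to $L^{2}(0,\pi)$; $Q$ is assumed real symmetric. The problem $L(Q)$ is $$-Y''+Q(x)Y=\lambda\rho(x)Y,\quad x\in\left(0,\tfrac{\pi}{2}\right)\cup\left(\tfrac{\pi}{2},\pi\right),$$ with jump conditions $$Y\left(\tfrac{\pi}{2}+0\right)=aY\left(\tfrac{\pi}{2}-0\right),\qquad Y'\left(\tfrac{\pi}{2}+0\right)=a^{-1}Y'\left(\tfrac{\pi}{2}-0\right),$$ and Neumann conditions $Y'(0)=Y'(\pi)=0$, where $Y$ is a column vector-valued function with $N$ components and $\lambda$ is a complex parameter. Solutions $Y$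 belong to $L^2_N(0,\pi)=\oplus_{i=1}^N L^2(0,\pi)$ with $Y'$ locally absolutely continuous on $\left(0,\frac{\pi}{2}\right)\cup\left(\frac{\pi}{2},\pi\right)$ and $-Y''+QY\in L^2_N(0,\pi)$; values at $0,\pi$ and $\frac{\pi}{2}\pm0$ are one-sided limits. An eigenvalue is a $\lambda$ for which a nonzero solution exists, and its multiplicity is the dimension of the solution space. $L(Q)$ is a self-adjoint eigenvalue problem, and its eigenvalues, counted with multiplicity, can be arranged as $\lambda_{0}(Q)\le\lambda_{1}(Q)\le\cdots\le\lambda_{n}(Q)\le\cdots\to+\infty$. *)

(* Defs.v *)
Set Warnings "-notation-overridden,-notation-incompatible-prefix,-ambiguous-paths".
From mathcomp Require Export all_boot all_order all_algebra.
From mathcomp Require Export all_classical all_reals all_analysis.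
From mathcomp.real_closed Require Export complex.

Set Implicit Arguments.
Unset Strict Implicit.
Unset Printing Implicit Defensive.
Import Order.TTheory GRing.Theory Num.Theory.
Import numFieldNormedType.Exports.

Local Open Scope classical_set_scope.
Local Open Scope ring_scope.

Definition cut_interval (R : realType) : set R :=
  `]0, pi / 2[ `|` `]pi / 2, pi[.

(* Library measurability is with respect to the Borel sets; [g] makes
   membership invariant under a.e. equality on (0, pi), so Lebesgue measurable
   functions are allowed.  Values outside (0, pi) are irrelevant. *)
Definition L2_0pi (R : realType) (f : R -> R) : Prop :=
  exists2 g : R -> R, g \in Lfun (@lebesgue_measure R) 2%:E &
    f = g %[ae (@lebesgue_measure R) in `]0, pi[%classic].

Definition abs_continuous_on (R : realType) (c d : R) (f : R -> R) : Prop :=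
  forall e : R, 0 < e -> exists2 delta : R, 0 < delta &
    forall s : seq (R * R),
      all (fun p => [&& c <= p.1, p.1 <= p.2 & p.2 <= d]) s ->
      pairwise (fun p q => (p.2 <= q.1) || (q.2 <= p.1)) s ->
      \sum_(p <- s) (p.2 - p.1) < delta ->
      \sum_(p <- s) `|f p.2 - f p.1| < e.

Definition locally_abs_continuous (R : realType) (D : set R) (f : R -> R) :=
  forall c d : R, `[c, d] `<=` D -> abs_continuous_on c d f.

(* Functions of a real variable with values in C^N are handled through the real
   and imaginary parts of their components. *)
Definition componentwise (R : realType) (N : nat) (P : (R -> R) -> Prop)
    (Y : R -> 'cV[R[i]]_N) : Prop :=
  forall j : 'I_N, P (fun x => complex.Re (Y x j 0)) /\
                   P (fun x => complex.Im (Y x j 0)).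

Definition vderive (R : realType) (N : nat) (Y : R -> 'cV[R[i]]_N) (x : R) :
    'cV[R[i]]_N :=
  \col_(j < N) (derive1 (fun t => complex.Re (Y t j 0)) x +i*
                derive1 (fun t => complex.Im (Y t j 0)) x)%C.

Definition vcvg (R : realType) (N : nat) (Y : R -> 'cV[R[i]]_N)
    (F : set_system R) (l : 'cV[R[i]]_N) : Prop :=
  forall j : 'I_N,
    (fun x => complex.Re (Y x j 0)) @ F --> complex.Re (l j 0) /\
    (fun x => complex.Im (Y x j 0)) @ F --> complex.Im (l j 0).

Definition rho (R : realType) (alpha x : R) : R :=
  if x < pi / 2 then 1 else alpha ^+ 2.

Definition SL_expr (R : realType) (N : nat) (Q : R -> 'M[R]_N)
    (Y : R -> 'cV[R[i]]_N) (x : R) : 'cV[R[i]]_N :=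
  - vderive (vderive Y) x + map_mx (real_complex R) (Q x) *m Y x.

Record SL_solution (R : realType) (N : nat) (alpha a : R) (Q : R -> 'M[R]_N)
    (lambda : R[i]) (Y : R -> 'cV[R[i]]_N) : Prop := {
  sol_L2 : componentwise (@L2_0pi R) Y;
  sol_derivable :
    componentwise (fun f => forall x, cut_interval x -> derivable f x 1) Y;
  sol_AC :
    componentwise (locally_abs_continuous (@cut_interval R)) (vderive Y);
  sol_expr_L2 : componentwise (@L2_0pi R) (SL_expr Q Y);
  sol_eqn : {ae @lebesgue_measure R, forall x, cut_interval x ->
    SL_expr Q Y x = (lambda * (rho alpha x)%:C%C) *: Y x};
  sol_jump : exists2 l : 'cV[R[i]]_N,
    vcvg Y (pi / 2)^'- l & vcvg Y (pi / 2)^'+ (a%:C%C *: l);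
  sol_jump' : exists2 l : 'cV[R[i]]_N,
    vcvg (vderive Y) (pi / 2)^'- l &
    vcvg (vderive Y) (pi / 2)^'+ ((a^-1)%:C%C *: l);
  sol_Neumann0 : vcvg (vderive Y) 0^'+ 0;
  sol_Neumannpi : vcvg (vderive Y) pi^'- 0
}.

(* Solutions are identified when they agree on [cut_interval]. *)
Definition SL_multiplicity (R : realType) (N : nat) (alpha a : R)
    (Q : R -> 'M[R]_N) (lambda : R[i]) (k : nat) : Prop :=
  exists b : 'I_k -> R -> 'cV[R[i]]_N,
    [/\ forall i, SL_solution alpha a Q lambda (b i),
        forall c : 'I_k -> R[i],
          (forall x, cut_interval x -> \sum_(i < k) c i *: b i x = 0) ->
          forall i, c i = 0
      & forall Y, SL_solution alpha a Q lambda Y ->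
          exists c : 'I_k -> R[i], forall x, cut_interval x ->
            Y x = \sum_(i < k) c i *: b i x].

(* Every complex number, eigenvalue or not, occurs in the sequence as many
   times as the dimension of its solution space. *)
Definition SL_eigenvalues (R : realType) (N : nat) (alpha a : R)
    (Q : R -> 'M[R]_N) (lam : nat -> R) : Prop :=
  [/\ forall m n : nat, (m <= n)%N -> lam m <= lam n,
      lam @ \oo --> +oo
    & forall mu : R[i], exists2 k : nat,
        SL_multiplicity alpha a Q mu k &
        ([set n : nat | (lam n)%:C%C = mu] #= `I_k)%card].

(* Main.v *)
(* Writing y = jump z, with jump equal to 1 on the left half and to a on the
   right half, and v = z' jump^2, the transmission conditions become continuity
   of z and v, and L(Q) becomes a first order linear system with integrable
   coefficients on the whole of [0, pi].  Equality of the spectra is used twice.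

   First, every eigenvalue of L(0) has multiplicity at least N, so at such an
   eigenvalue the space of Neumann solutions of L(Q) has dimension N too, and
   every initial value Y(0) is attained.  If phi is the scalar eigenfunction of
   L(0) with eigenvalue k^2, the solution starting at e_j is phi e_j + O(1/k),
   and Green's formula gives int phi^2 jump^2 Q_ij = O(1/k).  By Dirichlet's
   approximation theorem there are arbitrarily large such k for which phi^2 is
   close to (1 + cos 4mx)/2 on the left and to (1 + cos 4lx)/2 on the right,
   with large integers m and l.  The Riemann-Lebesgue lemma then yields
   int jump^2 Q_ij = 0.

   Second, L(0) has no negative eigenvalue, hence neither has L(Q), and its
   quadratic form is nonnegative.  By the first step the form vanishes at the
   constant vectors z = e_j, which are therefore minimizers; the Euler-Lagrange
   equation at these minimizers forces Q = 0 (an Ambarzumyan argument). *)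
From HB Require Import structures.
Require Import Defs.
From mathcomp Require Import ring lra measurable_realfun.
Import Order.TTheory GRing.Theory Num.Theory.
Import numFieldNormedType.Exports.
Local Open Scope classical_set_scope.
Local Open Scope ring_scope.
Set Implicit Arguments.
Unset Strict Implicit.
Unset Printing Implicit Defensive.


(** * Absolutely continuous functions are integrals *)

(** Nonnegativity of the quadratic form is obtained without spectral theory, by continuation in lam.
    Let s be the supremum of the lam for which the form of L(Q) - lam is nonnegative; such lam exist
    because the entries of the potential have mean zero. If s were negative it would not be an
    eigenvalue, so the inhomogeneous Neumann problem at s would be solvable, by inverting an N x N
    matrix, with a bound by the L^1 norm of the source. Testing the form on a combination of a given
    function and such a solution yields a positive gap, and s could be increased. The ratio alpha of
    the two halves may be irrational, so the eigenvalues of L(0) have no closed form. Those used for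
    the mean are located by the intermediate value theorem between a point resonant for the left
    half and a nearby one resonant for the right half. Solutions are defined through epsilon-delta
    absolute continuity, whereas all later calculus concerns Lebesgue primitives; Radon-Nikodym and
    the Jordan decomposition connect the two. *)

Lemma pairwise_enum (T : Type) (r : rel T) (f : nat -> T) (P : pred nat) n :
  (forall i j, P i -> P j -> i != j -> r (f i) (f j)) ->
  pairwise r [seq f i | i <- iota 0 n & P i].
Proof.
move=> rf; rewrite pairwise_map.
apply: (@sub_in_pairwise _ P [rel x y | x != y]); rewrite ?filter_all//.
by rewrite -uniq_pairwise filter_uniq// iota_uniq.
Qed.

Section AC_basic.
Variable R : realType.
Implicit Types (c d : R) (f g : R -> R).

Lemma AC_dist c d f : abs_continuous_on c d f ->
  forall e, 0 < e -> exists2 delta, 0 < delta & forall x y,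
    c <= x -> x <= y -> y <= d -> y - x < delta -> `|f y - f x| < e.
Proof.
move=> acf e e0; have [delta d0 H] := acf e e0; exists delta => // x y cx xy yd yx.
by have := H [:: (x, y)]; rewrite /= !big_seq1 cx xy yd; exact.
Qed.

Lemma AC_sub c d c' d' f : c <= c' -> d' <= d -> abs_continuous_on c d f ->
  abs_continuous_on c' d' f.
Proof.
move=> cc dd acf e e0; have [delta d0 H] := acf e e0; exists delta => // s sP.
apply: H; apply: sub_all sP => p /and3P[h1 h2 h3].
by rewrite (le_trans cc)// h2 (le_trans h3).
Qed.

Lemma AC_within_continuous c d f : abs_continuous_on c d f ->
  {within `[c, d], continuous f}.
Proof.
move=> acf; apply/subspace_continuousP => x /=; rewrite in_itv/= => /andP[cx xd].
apply/cvgrPdist_lt => e e0; have [dl d0 H] := AC_dist acf e0.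
rewrite near_withinE; near=> y => /=; rewrite in_itv/= => /andP[cy yd].
have : `|x - y| < dl by near: y; exact: cvgr_dist_lt.
have [xy|yx] := leP x y.
  by rewrite distrC ger0_norm ?subr_ge0// => xyd; rewrite distrC; exact: H.
by rewrite ger0_norm ?subr_ge0 ?ltW// => xyd; apply: H => //; exact: ltW.
Unshelve. all: by end_near. Qed.

(** Composing with [clamp] extends a function on [c, d] to the line by constants, as the
    construction of a Stieltjes measure requires. *)
Definition clamp c d x : R := Num.max c (Num.min x d).

Lemma clamp_homo c d : {homo clamp c d : x y / x <= y}.
Proof. by move=> x y xy; rewrite /clamp; rewrite ge_max le_max lexx/= le_max !le_min !ge_min xy lexx !orbT. Qed.

Lemma clamp_itv c d x : c <= d -> c <= clamp c d x <= d.
Proof. by move=> cd; rewrite /clamp le_max lexx/= ge_max cd ge_min lexx orbT. Qed.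

Lemma clamp_id c d x : c <= x <= d -> clamp c d x = x.
Proof. by move=> /andP[cx xd]; rewrite /clamp min_l// max_r. Qed.

Lemma clampB c d x y : x <= y -> clamp c d y - clamp c d x <= y - x.
Proof.
by move=> xy; rewrite /clamp !maxEle !minEle; do ?case: ifPn; rewrite -?ltNge => *; lra.
Qed.
End AC_basic.

(* A null set is covered by an open set of small measure, i.e. by disjoint
   intervals of small total length, on which [F] has small total increment. *)
Section monotone_AC.
Variables (R : realType) (c d : R) (G : R -> R).
Hypotheses (cd : c <= d) (Gac : abs_continuous_on c d G).
Hypothesis Gnd : forall x y, c <= x -> x <= y -> y <= d -> G x <= G y.
Local Notation mu := (@lebesgue_measure R).

Let F x := G (clamp c d x).

Let F_nd : nondecreasing F.
Proof.
move=> x y xy; apply: Gnd; last by case/andP: (clamp_itv y cd).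
  by case/andP: (clamp_itv x cd).
exact: clamp_homo.
Qed.

Let F_rc : right_continuous F.
Proof.
move=> x; apply/cvgrPdist_lt => e e0; have [dl d0 H] := AC_dist Gac e0.
near=> y; have xy : x <= y by near: y; exact: nbhs_right_ge.
rewrite distrC; apply: H; first by case/andP: (clamp_itv x cd).
- exact: clamp_homo.
- by case/andP: (clamp_itv y cd).
apply: le_lt_trans (clampB _ _ xy) _.
rewrite ltrBlDl; near: y; apply: nbhs_right_lt; rewrite ltrDl//.
Unshelve. all: by end_near. Qed.

#[local] HB.instance Definition _ := isCumulative.Build R _ R F F_nd F_rc.

Let nu := lebesgue_stieltjes_measure F.

Let nu_oc (x y : R) : x <= y -> nu `]x, y]%classic = (F y - F x)%:E.
Proof.
move=> xy; rewrite /nu /lebesgue_stieltjes_measure /measure_extension/=.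
by rewrite measurable_mu_extE/= ?wlength_itv_bnd//; exact: is_ocitv.
Qed.

(** The total mass is at most G d - G c. Finiteness is what the Radon-Nikodym theorem asks of
    [nu]. *)
Let nu_fin : fin_num_fun nu.
Proof.
apply: lty_fin_num_fun; pose B k : set R := `](- k%:R), k%:R]%classic.
have -> : [set: R] = \bigcup_k B k.
  apply/esym; rewrite -subTset => /= x _ /=.
  exists (Num.bound `|x|) => //=; have := archi_boundP (normr_ge0 x).
  by rewrite /B/= in_itv/= ltr_norml => /andP[-> /ltW->].
suff : (nu (\bigcup_k B k) <= (G d - G c)%:E)%E.
  by move=> /le_lt_trans; apply; exact: ltry.
have nd m n : (m <= n)%N -> B m `<=` B n.
  move=> mn x; rewrite /B/= !in_itv/= => /andP[h1 h2].
  by rewrite (le_lt_trans _ h1) ?lerN2 ?ler_nat// (le_trans h2) ?ler_nat.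
have mB k : measurable (B k) by exact: measurable_itv.
have /cvg_lim <-// : nu (B n) @[n --> \oo] --> nu (\bigcup_k B k).
  by apply: nondecreasing_cvg_mu => //; [exact: bigcupT_measurable|move=> m n /nd/subsetPset].
apply: lime_le.
  apply: ereal_nondecreasing_is_cvgn => m n mn; apply: le_measure; rewrite ?inE; [exact: mB|exact: mB|exact: nd].
near=> n; rewrite nu_oc ?lee_fin; last by rewrite (@le_trans _ _ 0)// oppr_le0.
have /andP[? ?] := clamp_itv (n%:R : R) cd; have /andP[? ?] := clamp_itv (- n%:R : R) cd.
by rewrite lerB// Gnd.
Unshelve. all: by end_near. Qed.

#[local] HB.instance Definition _ := Measure.on nu.
#[local] HB.instance Definition _ := @Measure_isFinite.Build _ _ _ nu nu_fin.

(** Finite measure excludes the unbounded intervals; a bounded one is recovered from its infimum and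
    supremum. *)
Let open_itvE (J : set R) : open J -> is_interval J -> (mu J < +oo)%E -> J !=set0 ->
  exists x y : R, x < y /\ J = `]x, y[%classic.
Proof.
move=> oJ iJ mJ [z Jz].
have [lJ uJ] : has_lbound J /\ has_ubound J.
  have := RhullK (mem_set iJ : J \in (@is_interval R : set (set R))).
  case: (Rhull J) => a b JE; move: mJ Jz; rewrite -JE.
  rewrite lebesgue_measure_itv/=.
  case: a b JE => [ba a|[]] [bb b|[]]//= JE; rewrite ?ltNyr ?ltry ?ltNyy//= => _; rewrite in_itv/= ?andbF//.
have JE : J = `]inf J, sup J[%classic.
  rewrite -{1}((@interior_id _ J).1 oJ) (interval_bounded_interior iJ lJ uJ).
  by apply/seteqP; split=> y /=; rewrite in_itv.
exists (inf J), (sup J); split => //.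
by move: Jz; rewrite {1}JE /= in_itv/= => /andP[/lt_trans h] /h.
Qed.

Let nu_oo (x y : R) : x <= y -> (nu `]x, y[%classic <= (F y - F x)%:E)%E.
Proof.
move=> xy; rewrite -nu_oc//; apply: le_measure; rewrite ?inE.
- exact: measurable_itv.
- exact: measurable_itv.
- by apply: subset_itvl; rewrite bnd_simp.
Qed.

Let nu_dominates : nu `<< (mu : set (measurableTypeR R) -> \bar R).
Proof.
apply/null_content_dominatesP => A mA A0; apply/eqP; rewrite eq_le measure_ge0 andbT.
apply/lee_addgt0Pr => e e0; rewrite add0e.
have [dl d0 H] := Gac e0.
have Afin : (mu A < +oo)%E by rewrite A0 ltry.
have [U [oU AU UA]] := lebesgue_regularity_outer mA Afin d0.
have mU : measurable U by exact: open_measurable.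
have muU : (mu U < dl%:E)%E.
  apply: le_lt_trans UA; have := measureDI mu mU mA.
  move=> ->; rewrite -[leRHS]adde0 leeD2l// -A0 le_measure ?inE//.
  exact: measurableI.
apply: (@le_trans _ _ (nu U)).
  by apply: le_measure; rewrite ?inE; [exact: mA|exact: mU|].
pose I := open_disjoint_itv oU.
have mI n : measurable (I n) by apply: open_measurable; exact: open_disjoint_itv_open.
have UE : U = \bigcup_n I n by exact: open_disjoint_itv_bigcup.
have IU n : I n `<=` U by move=> x Ix; rewrite UE; exists n.
have muI n : (mu (I n) < +oo)%E.
  apply: (@le_lt_trans _ _ (mu U)); last by rewrite (lt_trans muU)// ltry.
  by apply: le_measure; rewrite ?inE; [exact: mI|exact: mU|exact: IU].
(* Empty components receive the dummy pair (0, 0); the predicate [P] below filters them out. *)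
have /choice[pq pqP] n : exists pq : R * R, if pselect (I n !=set0) then
    pq.1 < pq.2 /\ I n = `]pq.1, pq.2[%classic else pq = (0, 0).
  case: pselect => [I0|]; last by exists (0, 0).
  have [||x [y xy]] := open_itvE _ _ (muI n) I0; last by exists (x, y).
  - exact: open_disjoint_itv_open.
  - exact: open_disjoint_itv_is_interval.
pose P n := `[< I n !=set0 >].
have PP n : P n -> (pq n).1 < (pq n).2 /\ I n = `](pq n).1, (pq n).2[%classic.
  by move=> /asboolP In0; have := pqP n; case: pselect.
have NP n : ~~ P n -> I n = set0.
  by move=> /asboolP In0; apply/eqP; apply: contra_notT In0 => /set0P.
have tI : trivIset setT I by exact: open_disjoint_itv_trivIset.
have mUI : measurable (\bigcup_n I n) by exact: bigcupT_measurable.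
rewrite UE measure_semi_bigcup//.
apply: lime_le; first exact: is_cvg_nneseries.
apply: nearW => n.
(* Absolute continuity speaks of finite families, so a partial sum of the measure is bounded.
   Clamping may shrink intervals to points, which the weak inequalities in the definition allow. *)
pose s := [seq (clamp c d (pq i).1, clamp c d (pq i).2) | i <- iota 0 n & P i].
have sE (h : R * R -> R) :
    \sum_(p <- s) h p = \sum_(0 <= i < n | P i) h (clamp c d (pq i).1, clamp c d (pq i).2).
  by rewrite big_map big_filter /index_iota subn0.
apply: (@le_trans _ _ (\sum_(0 <= i < n | P i) (F (pq i).2 - F (pq i).1)%:E)%E).
  rewrite [leRHS]big_mkcond/=; apply: lee_sum => i _.
  case: ifPn => [/PP[lpq ->]|/NP ->]; last by rewrite measure0.
  exact/nu_oo/ltW.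
rewrite sumEFin lee_fin; apply/ltW.
apply: (@le_lt_trans _ _ (\sum_(p <- s) `|G p.2 - G p.1|)).
  by rewrite sE; apply: ler_sum => i _; exact: ler_norm.
apply: H.
- apply/allP => _ /mapP[i + ->]/=; rewrite mem_filter => /andP[/PP[lpq _] _].
  have /andP[-> _] := clamp_itv (pq i).1 cd.
  have /andP[_ ->] := clamp_itv (pq i).2 cd; rewrite andbT /=.
  exact/clamp_homo/ltW.
- apply: pairwise_enum => i j /PP[li Ii] /PP[lj Ij] ij /=.
  have [qp|pq'] := leP (pq i).2 (pq j).1; first by rewrite clamp_homo.
  have [qp|qp'] := leP (pq j).2 (pq i).1; first by rewrite (clamp_homo _ _ qp) orbT.
  suff /eqP : i = j by rewrite (negbTE ij).
  apply: (tI) => //; rewrite Ii Ij.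
  pose x := Num.max (pq i).1 (pq j).1; pose y := Num.min (pq i).2 (pq j).2.
  have xy : x < y by rewrite gt_max !lt_min li lj pq' qp'.
  exists ((x + y) / 2); have xm : x < (x + y) / 2 by lra.
  have my : (x + y) / 2 < y by lra.
  move: xm my; rewrite {1}/x {2}/y gt_max lt_min => /andP[h1 h2] /andP[h3 h4].
  by split; rewrite /= in_itv/= ?h1 ?h2 ?h3 ?h4.
- rewrite sE -lte_fin; apply: le_lt_trans muU; rewrite UE measure_semi_bigcup//.
  apply: (@le_trans _ _ (\sum_(0 <= i < n) mu (I i))%E); last exact: nneseries_lim_ge.
  rewrite -sumEFin big_mkcond/=; apply: lee_sum => i _.
  case: ifPn => [/PP[lpq ->]|_]; last exact: measure_ge0.
  rewrite lebesgue_measure_itv/= lte_fin lpq -EFinB lee_fin; exact/clampB/ltW.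
Qed.

(** The integrand is the Radon-Nikodym density of the Stieltjes measure of G. *)
Lemma nondecreasing_AC_integral : exists2 g : R -> R,
  mu.-integrable `[c, d] (EFin \o g) &
  forall x, x \in `[c, d] -> G x = G c + \int[mu]_(t in `[c, x]) g t.
Proof.
have [h [h0 hfin hint hE]] := @radon_nikodym_sigma_finite _ _ _
  (mu : {sigma_finite_measure set (measurableTypeR R) -> \bar R}) nu nu_dominates.
have hg : h = EFin \o (fine \o h) by apply/funext => x /=; rewrite fineK.
exists (fine \o h).
  by rewrite -hg; apply: integrableS hint.
move=> x; rewrite in_itv/= => /andP[cx xd].
have : nu `]c, x]%classic = (F x - F c)%:E by exact: nu_oc.
rewrite hE; last exact: measurable_itv.
rewrite /F !clamp_id ?cx ?lexx ?cd// => H.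
have hi : mu.-integrable `]c, x] (EFin \o (fine \o h)).
  by rewrite -hg; apply: integrableS hint.
have : \int[mu]_(t in `[c, x]) (fine \o h) t = G x - G c.
  rewrite -Rintegral_itv_obnd_cbnd// -[RHS]/(fine (G x - G c)%:E) -H.
  by congr fine; apply: eq_integral => t _ /=; rewrite fineK.
by move=> ->; rewrite addrC subrK.
Qed.
End monotone_AC.

(** Differential equations are expressed below by this relation: [F] is a Lebesgue primitive of [f],
    so [f] matters only up to null sets and [F] only on [c, d]. *)
Definition prim (R : realType) (c d : R) (F f : R -> R) : Prop :=
  (@lebesgue_measure R).-integrable `[c, d] (EFin \o f) /\
  forall x, x \in `[c, d] -> F x = F c + \int[lebesgue_measure]_(t in `[c, x]) f t.

(** * Total variation and the Jordan decomposition *)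

Section AC_total_variation.
Variable R : realType.
Implicit Types (a b c d : R) (f : R -> R) (p q : R * R) (s : seq (R * R)).

Let nov p q := (p.2 <= q.1) || (q.2 <= p.1).
Let inside a b p := [&& a <= p.1, p.1 <= p.2 & p.2 <= b].

Let variation_pairs a b f l : itv_partition a b l ->
  exists s, [/\ all (inside a b) s, pairwise nov s,
    \sum_(p <- s) (p.2 - p.1) = b - a & \sum_(p <- s) `|f p.2 - f p.1| = variation a b f l].
Proof.
move=> [pl /eqP ll]; pose x := nth b (a :: l).
have xm i j : (i <= j)%N -> (j < (size l).+1)%N -> x i <= x j.
  move=> ij js; apply: (@sorted_leq_nth _ <=%R) => //=.
  - exact: le_trans.
  - by apply: sub_path pl => u v; exact: ltW.
  - by rewrite inE (leq_ltn_trans ij).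
have x0 : x 0 = a by [].
have xn : x (size l) = b by rewrite /x -ll -[size l]/(size (a :: l)).-1 nth_last.
exists [seq (x i, x i.+1) | i <- iota 0 (size l) & (i < size l)%N].
have fE : [seq i <- iota 0 (size l) | (i < size l)%N] = index_iota 0 (size l).
  by rewrite /index_iota subn0; apply/all_filterP/allP => i; rewrite mem_iota.
split.
- apply/allP => _ /mapP[i + ->]; rewrite mem_filter => /andP[il _].
  by rewrite /inside/= -{1}x0 -[b]xn !xm// ltnW.
- apply: pairwise_enum => i j il jl; rewrite /nov/= neq_ltn => /orP[ij|ij].
    by rewrite xm// ltnW.
  by rewrite [x j.+1 <= _]xm ?orbT// ltnW.
- by rewrite fE big_map telescope_sumr// x0 xn.
- by rewrite fE big_map.
Qed.

Let nov_flatten (phi : R * R -> seq (R * R)) s :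
  (forall p, p \in s -> all (inside p.1 p.2) (phi p) /\ pairwise nov (phi p)) ->
  pairwise nov s -> pairwise nov (flatten [seq phi p | p <- s]).
Proof.
elim: s => //= p s IH H /andP[ps /IH]{}IH.
rewrite pairwise_cat (H p _).2 ?mem_head// IH ?andbT/=; last first.
  by move=> q qs; apply: H; rewrite inE qs orbT.
apply/allrelP => u v up /flattenP[_ /mapP[q qs ->]] vq.
have /allP/(_ _ up)/and3P[h1 h2 h3] := (H p (mem_head _ _)).1.
have qs' : q \in p :: s by rewrite inE qs orbT.
have /allP/(_ _ vq)/and3P[k1 k2 k3] := (H q qs').1.
have /allP/(_ _ qs) := ps; rewrite /nov => /orP[h|h]; apply/orP; [left|right]; lra.
Qed.

(** The [delta] of [f] works unchanged: subdividing the intervals of a family keeps its total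
    length, and each total variation is a supremum over subdivisions. Passing to the supremum turns
    the strict bound into a weak one. *)
Lemma AC_sum_TV c d f : abs_continuous_on c d f ->
  forall e, 0 < e -> exists2 delta, 0 < delta &
    forall s, all (inside c d) s -> pairwise nov s ->
      \sum_(p <- s) (p.2 - p.1) < delta ->
      (\sum_(p <- s) total_variation p.1 p.2 f <= e%:E)%E.
Proof.
move=> acf e e0; have [dl d0 H] := acf e e0; exists dl => // s sI sN sd.
have key (phi : R * R -> seq R) : (forall p, p \in s -> itv_partition p.1 p.2 (phi p)) ->
    \sum_(p <- s) variation p.1 p.2 f (phi p) <= e.
  move=> phiP.
  have /choice[psi psiP] p : exists t, p \in s -> [/\ all (inside p.1 p.2) t, pairwise nov t,
    \sum_(q <- t) (q.2 - q.1) = p.2 - p.1 &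
    \sum_(q <- t) `|f q.2 - f q.1| = variation p.1 p.2 f (phi p)].
    have [ps|] := boolP (p \in s); last by exists [::].
    by have [t tP] := variation_pairs f (phiP _ ps); exists t.
  have inE' : all (inside c d) (flatten [seq psi p | p <- s]).
    apply/allP => u /flattenP[_ /mapP[p ps ->]] up.
    have [/allP/(_ _ up)/and3P[h1 h2 h3] _ _ _] := psiP p ps.
    have /allP/(_ _ ps)/and3P[k1 k2 k3] := sI.
    by rewrite /inside h2 (le_trans k1)//= (le_trans h3).
  have novE : pairwise nov (flatten [seq psi p | p <- s]).
    by apply: nov_flatten => // p ps; have [] := psiP p ps.
  have := H _ inE' novE.
  rewrite !big_flatten !big_map.
  have -> : \sum_(p <- s) \sum_(q <- psi p) (q.2 - q.1) = \sum_(p <- s) (p.2 - p.1).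
    by apply: eq_big_seq => p ps; have [] := psiP p ps.
  have -> : \sum_(p <- s) \sum_(q <- psi p) `|f q.2 - f q.1| =
            \sum_(p <- s) variation p.1 p.2 f (phi p).
    by apply: eq_big_seq => p ps; have [] := psiP p ps.
  by move=> Hs; exact/ltW/Hs.
(* The trivial partition, empty for a degenerate interval. It is used on all other intervals when a
   single one is refined to show that its variation is finite. *)
pose phi0 p : seq R := if p.1 < p.2 then [:: p.2] else [::].
have phi0P p : p \in s -> itv_partition p.1 p.2 (phi0 p).
  have /allP sI' := sI => /sI'/and3P[_ + _]; rewrite /phi0.
  by case: ltgtP => // [? _|-> _]; [exact: itv_partition1|split].
have le12 p : p \in s -> p.1 <= p.2 by have /allP sI' := sI => /sI'/and3P[].
have fin p : p \in s -> total_variation p.1 p.2 f \is a fin_num.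
  move=> ps; apply/bounded_variationP; first exact: le12.
  exists e => _ [l lP <-].
  have := key (fun q => if q == p then l else phi0 q).
  rewrite (big_rem p)//= eqxx => H1; apply: le_trans (H1 _).
    by rewrite lerDl sumr_ge0// => q _; exact: variation_ge0.
  by move=> q qs; case: eqP => [->//|_]; exact: phi0P.
rewrite (_ : (\sum_(p <- s) _)%E = \sum_(p <- s) (fine (total_variation p.1 p.2 f))%:E)%E; last first.
  by apply: eq_big_seq => p ps; rewrite fineK// fin.
rewrite sumEFin lee_fin; apply/ler_addgt0Pr => h h0.
pose n := size s.
(* Each interval gives away h / (n + 1), hence less than h altogether, even for an empty family. *)
have /choice[phi phiP] p : exists l, p \in s -> itv_partition p.1 p.2 l /\
    fine (total_variation p.1 p.2 f) - h / n.+1%:R <= variation p.1 p.2 f l.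
  have [ps|] := boolP (p \in s); last by exists [::].
  have hn : 0 < h / n.+1%:R by rewrite divr_gt0.
  have := ub_ereal_sup_adherent hn (fin _ ps).
  move=> [_ [_ [l lP <-] <-]] hl; exists l => _; split => //.
  by rewrite -lee_fin EFinB fineK ?fin//; exact: ltW.
apply: le_trans (lerD (key phi (fun p ps => (phiP p ps).1)) (lexx h)).
apply: (@le_trans _ _ (\sum_(p <- s) (variation p.1 p.2 f (phi p) + h / n.+1%:R))).
  rewrite big_seq [leRHS]big_seq; apply: ler_sum => p ps.
  by rewrite -lerBlDr (phiP p ps).2.
rewrite big_split/= lerD2l big_const_seq count_predT iter_addr_0 -/n.
by rewrite -[_ *+ n]mulr_natr mulrAC ler_pdivrMr// ler_pM2l// ler_nat.
Qed.

(** [c, d] is cut into steps of length delta / 2, on each of which the variation is at most 1. *)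
Lemma AC_bounded_variation c d f : c <= d -> abs_continuous_on c d f ->
  bounded_variation c d f.
Proof.
move=> cd acf; have [dl d0 H] := AC_sum_TV acf ltr01.
have small x y : c <= x -> x <= y -> y <= d -> y - x < dl ->
    (total_variation x y f < +oo)%E.
  move=> cx xy yd yx; apply: (@le_lt_trans _ _ 1%E); last exact: ltry.
  by have := H [:: (x, y)]; rewrite /= !big_seq1 /inside/= cx xy yd; apply.
pose x k := Num.min d (c + k%:R * (dl / 2)).
have cx k : c <= x k by rewrite le_min cd lerDl mulr_ge0// divr_ge0// ltW.
have xd k : x k <= d by rewrite ge_min lexx.
have d20 : 0 < dl / 2 by rewrite divr_gt0.
have xx k : x k <= x k.+1 by rewrite /x -(@natr1 _ k) mulrDl mul1r !minEle; do 2 case: ifPn; rewrite -?ltNge => *; lra.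
have fink k : (total_variation c (x k) f < +oo)%E.
  elim: k => [|k IH]; first by rewrite /x mul0r addr0 min_r// total_variationxx ltry.
  rewrite (total_variationD f (cx k) (xx k)) lte_add_pinfty//; apply: small => //.
  by rewrite /x -(@natr1 _ k) mulrDl mul1r !minEle; do 2 case: ifPn; rewrite -?ltNge => *; lra.
apply/bounded_variationP => //; rewrite ge0_fin_numE ?total_variation_ge0//.
pose k := Num.bound ((d - c) / (dl / 2)).
suff <- : x k = d by exact: fink.
apply/min_l; have : (d - c) / (dl / 2) < k%:R by apply: archi_boundP; rewrite divr_ge0// ?subr_ge0// ltW.
by rewrite ltr_pdivrMr// => ?; lra.
Qed.

(** Jordan decomposition f = T - (T - f), with T the variation on [c, x]: both parts are
    nondecreasing and absolutely continuous, hence integrals. *)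
Lemma AC_prim c d f : c <= d -> abs_continuous_on c d f -> exists g, prim c d f g.
Proof.
move=> cd acf; have bvf := AC_bounded_variation cd acf.
pose T x := fine (total_variation c x f).
have fin x y : c <= x -> x <= y -> y <= d -> total_variation x y f \is a fin_num.
  move=> cx xy yd; apply/bounded_variationP => //.
  exact/(bounded_variationl xy yd)/(bounded_variationr cx (le_trans xy yd)).
have TB x y : c <= x -> x <= y -> y <= d -> T y - T x = fine (total_variation x y f).
  move=> cx xy yd; rewrite /T (total_variationD f cx xy) fineD ?fin//; last exact: le_trans yd.
  by rewrite addrC addKr.
have fT x y : c <= x -> x <= y -> y <= d -> `|f y - f x| <= T y - T x.
  by move=> cx xy yd; rewrite TB// -lee_fin fineK ?fin// total_variation_ge.
have Tac : abs_continuous_on c d T.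
  move=> e e0; have e20 : 0 < e / 2 by rewrite divr_gt0.
  have [dl d0 H] := AC_sum_TV acf e20; exists dl => // s sI sN sd.
  have /allP sI' := sI.
  have := H _ sI sN sd.
  rewrite (_ : (\sum_(p <- s) _)%E = (\sum_(p <- s) `|T p.2 - T p.1|)%:E).
    by rewrite lee_fin => /le_lt_trans; apply; lra.
  rewrite -sumEFin; apply: eq_big_seq => p /sI' /and3P[h1 h2 h3].
  by rewrite TB// ger0_norm ?fineK ?fin// fine_ge0// total_variation_ge0.
have TfB x y : T y - f y - (T x - f x) = (T y - T x) - (f y - f x) by lra.
have Tfac : abs_continuous_on c d (fun x => T x - f x).
  move=> e e0; have e20 : 0 < e / 2 by rewrite divr_gt0.
  have [d1 d10 H1] := acf _ e20; have [d2 d20 H2] := Tac _ e20.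
  exists (Num.min d1 d2); first by rewrite lt_min d10.
  move=> s sI sN; rewrite lt_min => /andP[s1 s2].
  have := ltrD (H1 _ sI sN s1) (H2 _ sI sN s2); rewrite -splitr; apply: le_lt_trans.
  rewrite -big_split/=; apply: ler_sum => p _; rewrite TfB addrC.
  exact: ler_normB.
have Tnd x y : c <= x -> x <= y -> y <= d -> T x <= T y.
  by move=> cx xy yd; rewrite -subr_ge0 (le_trans _ (fT _ _ cx xy yd)).
have Tfnd x y : c <= x -> x <= y -> y <= d -> T x - f x <= T y - f y.
  move=> cx xy yd; rewrite -subr_ge0 TfB subr_ge0.
  by rewrite (le_trans _ (fT _ _ cx xy yd))// ler_norm.
have [g gi gE] := nondecreasing_AC_integral cd Tac Tnd.
have [h hi hE] := nondecreasing_AC_integral cd Tfac Tfnd.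
exists (fun x => g x - h x); split.
  by have := integrableB _ gi hi; exact.
move=> x xcd; have := hE x xcd; rewrite (gE x xcd).
move: xcd; rewrite in_itv/= => /andP[cx xd].
have sub : `[c, x] `<=` `[c, d] by apply: subset_itvl; rewrite bnd_simp.
move=> H; rewrite RintegralB//; first lra.
- by apply: integrableS gi.
- by apply: integrableS hi.
Qed.
End AC_total_variation.

(** * Calculus of integral primitives *)

Section ae_lebesgue.
Variable R : realType.
Local Notation mu := (@lebesgue_measure R).

Lemma aeW (P Q : R -> Prop) : (forall x, P x -> Q x) ->
  {ae mu, forall x, P x} -> {ae mu, forall x, Q x}.
Proof. by move=> PQ; apply: filterS PQ; exact: (ae_filter_ringOfSetsType mu). Qed.

Lemma aeW2 (P1 P2 Q : R -> Prop) : (forall x, P1 x -> P2 x -> Q x) ->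
  {ae mu, forall x, P1 x} -> {ae mu, forall x, P2 x} -> {ae mu, forall x, Q x}.
Proof. by move=> PQ; apply: filterS2 PQ; exact: (ae_filter_ringOfSetsType mu). Qed.

Lemma ae_neq (a : R) : {ae mu, forall x, x != a}.
Proof.
exists [set a]; split; [exact: measurable_set1|exact: lebesgue_measure_set1|].
by move=> x /= /negP; rewrite negbK => /eqP.
Qed.

Lemma ae_forall_fin (I : finType) (P : I -> R -> Prop) :
  (forall i, {ae mu, forall x, P i x}) -> {ae mu, forall x, forall i, P i x}.
Proof.
move=> H; suff : {ae mu, forall x, forall i, i \in enum I -> P i x}.
  by apply: aeW => x Hx i; apply: Hx; rewrite mem_enum.
elim: (enum I) => [|i s IH]; first by apply: aeW (ae_neq 0).
by apply: aeW2 (H i) IH => x Hi Hs j; rewrite inE => /orP[/eqP->|/Hs].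
Qed.

Lemma ae_RintegralE (D : set R) (f g : R -> R) : measurable D ->
  mu.-integrable D (EFin \o f) -> mu.-integrable D (EFin \o g) ->
  {ae mu, forall x, D x -> f x = g x} ->
  \int[mu]_(x in D) f x = \int[mu]_(x in D) g x.
Proof.
move=> mD fi gi fg; congr fine; apply: ae_eq_integral => //.
- exact: measurable_int fi.
- exact: measurable_int gi.
- by apply: aeW fg => x h Dx /=; rewrite h.
Qed.
End ae_lebesgue.

Section prim_basic.
Variable R : realType.
Local Notation mu := (@lebesgue_measure R).
Implicit Types (c d k : R) (F G f g : R -> R).

Definition intg c d f := mu.-integrable `[c, d] (EFin \o f).

Lemma intgD c d f g : intg c d f -> intg c d g -> intg c d (fun x => f x + g x).
Proof. by move=> fi gi; have := integrableD _ fi gi; exact. Qed.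

Lemma intgB c d f g : intg c d f -> intg c d g -> intg c d (fun x => f x - g x).
Proof. by move=> fi gi; have := integrableB _ fi gi; exact. Qed.

Lemma intgZ c d k f : intg c d f -> intg c d (fun x => k * f x).
Proof. by move=> fi; have := integrableZl _ k fi; exact. Qed.

Lemma intgN c d f : intg c d f -> intg c d (fun x => - f x).
Proof. by move=> fi; have := integrableN fi; exact. Qed.

Lemma intg_cst c d k : intg c d (fun=> k).
Proof.
apply: measurable_bounded_integrable => //.
- by rewrite /= lebesgue_measure_itv/=; case: ifP => _ //; rewrite -EFinB ltry.
- exact: bounded_cst.
Qed.

Lemma intg_sum c d (I : Type) (s : seq I) (P : pred I) (f : I -> R -> R) :
  (forall i, P i -> intg c d (f i)) -> intg c d (fun x => \sum_(i <- s | P i) f i x).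
Proof.
move=> fi; elim: s => [|i s IH].
  by under eq_fun do rewrite big_nil; exact: intg_cst.
have [Pi|Pi] := boolP (P i); last first.
  by under eq_fun do rewrite big_cons (negbTE Pi).
by under eq_fun do rewrite big_cons Pi; apply: intgD => //; exact: fi.
Qed.

Lemma intg_norm c d f : intg c d f -> intg c d (fun x => `|f x|).
Proof. by move=> fi; have := integrable_norm fi; exact. Qed.

Lemma intg_eq c d f g : (forall x, c <= x <= d -> f x = g x) -> intg c d f -> intg c d g.
Proof.
move=> fg; apply: eq_integrable => // x; rewrite inE/= in_itv/= => xcd.
by rewrite /= fg.
Qed.

Lemma intg_sub c d c' d' f : c <= c' -> d' <= d -> intg c d f -> intg c' d' f.
Proof. by move=> cc dd; apply: integrableS => //; apply: subset_itv; rewrite bnd_simp. Qed.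

Definition cont_on c d f := {within `[c, d], continuous f}.

Lemma cont_on_bounded c d f : cont_on c d f -> exists2 M, 0 <= M &
  forall x, c <= x <= d -> `|f x| <= M.
Proof.
move=> fc; have [cd|dc] := leP c d; last first.
  by exists 0 => // x /andP[cx xd]; have := lt_le_trans dc (le_trans cx xd); rewrite ltxx.
have [u _ Hu] := EVT_max cd fc.
have [v _ Hv] := EVT_min cd fc.
exists (`|f u| + `|f v|); first by rewrite addr_ge0.
move=> x xcd; have x1 : x \in `[c, d] by rewrite in_itv.
have := Hu x x1; have := Hv x x1; rewrite ler_norml.
have := ler_norm (f u); have := ler_norm (- f v); rewrite normrN.
have := normr_ge0 (f u); have := normr_ge0 (f v); lra.
Qed.

Lemma cont_on_measurable c d f : cont_on c d f -> measurable_fun `[c, d] f.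
Proof. by move=> fc; apply: subspace_continuous_measurable_fun. Qed.

Lemma intgM_bounded c d f g M : intg c d f -> measurable_fun `[c, d] g ->
  (forall x, c <= x <= d -> `|g x| <= M) -> intg c d (fun x => f x * g x).
Proof.
move=> fi mg gM; have := @integrableMl _ _ _ mu `[c, d]%classic _ _ g fi mg; apply => //.
exists M; split; first exact: num_real.
by move=> y My x; rewrite /= in_itv/= => /gM/le_trans; apply; exact: ltW.
Qed.

Lemma intgM_cont c d f g : intg c d f -> cont_on c d g -> intg c d (fun x => f x * g x).
Proof.
move=> fi gc; have [M _ gM] := cont_on_bounded gc.
exact: intgM_bounded fi (cont_on_measurable gc) gM.
Qed.

Lemma cont_on_intg c d f : cont_on c d f -> intg c d f.
Proof.
move=> fc; have := intgM_cont (intg_cst c d 1) fc.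
by apply: intg_eq => x _; rewrite mul1r.
Qed.

Lemma cont_on_eq c d f g : (forall x, c <= x <= d -> f x = g x) -> cont_on c d f -> cont_on c d g.
Proof.
move=> fg; apply: subspace_eq_continuous => x; rewrite inE/= in_itv/= => xcd.
exact: fg.
Qed.

Lemma cont_on_sub c d c' d' f : c <= c' -> d' <= d -> cont_on c d f -> cont_on c' d' f.
Proof.
by move=> cc dd; apply: continuous_subspaceW; apply: subset_itv; rewrite bnd_simp.
Qed.

Lemma cont_onD c d f g : cont_on c d f -> cont_on c d g -> cont_on c d (fun x => f x + g x).
Proof. by move=> fc gc x; apply: continuousD; [exact: fc|exact: gc]. Qed.

Lemma cont_onM c d f g : cont_on c d f -> cont_on c d g -> cont_on c d (fun x => f x * g x).
Proof. by move=> fc gc x; apply: continuousM; [exact: fc|exact: gc]. Qed.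

Lemma cont_on_cst c d k : cont_on c d (fun=> k).
Proof. by move=> x; exact: cst_continuous. Qed.

Lemma cont_on_continuous c d f : continuous f -> cont_on c d f.
Proof. exact: continuous_subspaceT. Qed.

Lemma cont_onN c d f : cont_on c d f -> cont_on c d (fun x => - f x).
Proof. by move=> fc x; apply: continuousN; exact: fc. Qed.

Lemma cont_on_comp c d f (h : R -> R) : cont_on c d f -> continuous h ->
  cont_on c d (fun x => h (f x)).
Proof. by move=> fc hc; apply: within_continuous_comp => // x _; exact: hc. Qed.

Lemma cont_on_sum c d (I : Type) (s : seq I) (P : pred I) (f : I -> R -> R) :
  (forall i, P i -> cont_on c d (f i)) -> cont_on c d (fun x => \sum_(i <- s | P i) f i x).
Proof.
move=> fi; elim: s => [|i s IH].
  by under eq_fun do rewrite big_nil; exact: cont_on_cst.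
have [Pi|Pi] := boolP (P i); last first.
  by under eq_fun do rewrite big_cons (negbTE Pi).
by under eq_fun do rewrite big_cons Pi; apply: cont_onD => //; exact: fi.
Qed.

Local Notation Int c d f := (\int[mu]_(t in `[c, d]) f t).

Lemma IntD c d f g : intg c d f -> intg c d g ->
  Int c d (fun x => f x + g x) = Int c d f + Int c d g.
Proof. by move=> fi gi; rewrite RintegralD. Qed.

Lemma IntB c d f g : intg c d f -> intg c d g ->
  Int c d (fun x => f x - g x) = Int c d f - Int c d g.
Proof. by move=> fi gi; rewrite RintegralB. Qed.

Lemma IntZ c d k f : intg c d f -> Int c d (fun x => k * f x) = k * Int c d f.
Proof. by move=> fi; rewrite RintegralZl. Qed.

Lemma Int_cst c d k : c <= d -> Int c d (fun=> k) = k * (d - c).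
Proof.
move=> cd; rewrite Rintegral_cst//= lebesgue_measure_itv/= lte_fin.
by case: ltgtP cd => // -> _; rewrite subrr.
Qed.

Lemma Int_sum c d (I : Type) (s : seq I) (P : pred I) (f : I -> R -> R) :
  (forall i, P i -> intg c d (f i)) ->
  Int c d (fun x => \sum_(i <- s | P i) f i x) = \sum_(i <- s | P i) Int c d (f i).
Proof.
move=> fi; elim: s => [|i s IH].
  by rewrite big_nil; under eq_Rintegral do rewrite big_nil; rewrite Rintegral_cst// mul0r.
rewrite big_cons; have [Pi|Pi] := boolP (P i); last first.
  by under eq_Rintegral do rewrite big_cons (negbTE Pi); exact: IH.
under eq_Rintegral do rewrite big_cons Pi.
by rewrite IntD ?IH//; [exact: fi|exact: intg_sum].
Qed.

Lemma le_Int c d f g : intg c d f -> intg c d g ->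
  (forall x, c <= x <= d -> f x <= g x) -> Int c d f <= Int c d g.
Proof.
by move=> fi gi fg; apply: le_Rintegral => // x; rewrite /= in_itv; exact: fg.
Qed.

Lemma Int_ge0 c d f : (forall x, c <= x <= d -> 0 <= f x) -> 0 <= Int c d f.
Proof. by move=> f0; apply: Rintegral_ge0 => x; rewrite /= in_itv; exact: f0. Qed.

Lemma eq_Int c d f g : (forall x, c <= x <= d -> f x = g x) -> Int c d f = Int c d g.
Proof. by move=> fg; apply: eq_Rintegral => x; rewrite inE/= in_itv; exact: fg. Qed.

Lemma norm_Int_le c d f : intg c d f -> `|Int c d f| <= Int c d (fun x => `|f x|).
Proof. by move=> fi; apply: le_normr_Rintegral. Qed.

Lemma Int_sub c d x y f : intg c d f -> c <= x -> x <= y -> y <= d ->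
  Int c y f - Int c x f = Int x y f.
Proof.
move=> fi cx xy yd; rewrite Rintegral_itvB//; last first.
  by apply: intg_sub fi.
rewrite Rintegral_itv_obnd_cbnd//; apply: integrableS fi => //.
by apply: subset_itv; rewrite bnd_simp.
Qed.
End prim_basic.

Notation Int c d f := (\int[lebesgue_measure]_(t in `[c, d]) f t).

Section prim_theory.
Variable R : realType.
Local Notation mu := (@lebesgue_measure R).
Implicit Types (c d k x y : R) (F G f g : R -> R).

Lemma primE c d F f x : prim c d F f -> c <= x <= d -> F x = F c + Int c x f.
Proof. by move=> [_ H] xcd; apply: H; rewrite in_itv. Qed.

Lemma prim_intg c d F f : prim c d F f -> intg c d f.
Proof. by case. Qed.

Lemma primB c d F f x y : prim c d F f -> c <= x -> x <= y -> y <= d ->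
  F y - F x = Int x y f.
Proof.
move=> Ff cx xy yd; rewrite -(Int_sub (prim_intg Ff) cx xy yd).
rewrite (primE (x := y) Ff) ?(le_trans cx xy)// (primE (x := x) Ff) ?cx ?(le_trans xy)//.
lra.
Qed.

Lemma prim_of_intg c d f k : intg c d f -> prim c d (fun x => k + Int c x f) f.
Proof.
by move=> fi; split=> // x _; rewrite set_itv1 Rintegral_set1 addr0.
Qed.

Lemma prim_cst c d k : c <= d -> prim c d (fun=> k) (fun=> 0).
Proof.
move=> cd; split; first exact: intg_cst.
by move=> x; rewrite in_itv/= => /andP[cx _]; rewrite Int_cst// mul0r addr0.
Qed.

Lemma primD c d F f G g : prim c d F f -> prim c d G g ->
  prim c d (fun x => F x + G x) (fun x => f x + g x).
Proof.
move=> Ff Gg; split; first by apply: intgD; [exact: prim_intg Ff|exact: prim_intg Gg].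
move=> x; rewrite in_itv/= => /[dup] xcd /andP[cx xd].
rewrite IntD; [|exact: intg_sub (prim_intg Ff)|exact: intg_sub (prim_intg Gg)].
by rewrite (primE Ff xcd) (primE Gg xcd); lra.
Qed.

Lemma primZ c d k F f : prim c d F f -> prim c d (fun x => k * F x) (fun x => k * f x).
Proof.
move=> Ff; split; first exact: intgZ (prim_intg Ff).
move=> x; rewrite in_itv/= => /[dup] xcd /andP[cx xd].
by rewrite IntZ ?(primE Ff xcd) ?mulrDr//; exact: intg_sub (prim_intg Ff).
Qed.

Lemma prim_eql c d F G f : (forall x, c <= x <= d -> F x = G x) -> prim c d F f -> prim c d G f.
Proof.
move=> FG Ff; split; first exact: prim_intg Ff.
move=> x; rewrite in_itv/= => /[dup] xcd /andP[cx xd].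
by rewrite -(FG x xcd) -(FG c) ?lexx ?(le_trans cx)//; exact: primE Ff xcd.
Qed.

Lemma prim_aer c d F f g : intg c d g -> {ae mu, forall x, c < x < d -> f x = g x} ->
  prim c d F f -> prim c d F g.
Proof.
move=> gi fg Ff; split => // x; rewrite in_itv/= => /[dup] xcd /andP[cx xd].
rewrite (primE Ff xcd); congr (_ + _); apply: ae_RintegralE => //.
- exact: intg_sub (prim_intg Ff).
- exact: intg_sub gi.
apply: aeW2 (aeW2 (fun x => @conj _ _) (ae_neq c) (ae_neq d)) fg => y [yc yd] fgy.
rewrite /= in_itv/= => /andP[cy yx]; apply: fgy.
by rewrite !lt_neqAle eq_sym yc cy yd (le_trans yx).
Qed.

Lemma prim_eqr c d F f g : (forall x, c <= x <= d -> f x = g x) -> prim c d F f -> prim c d F g.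
Proof.
move=> fg Ff; apply: (prim_aer _ _ Ff); first exact: intg_eq fg (prim_intg Ff).
by apply: aeW (ae_neq c) => x _ /andP[cx xd]; apply: fg; rewrite !ltW.
Qed.

Lemma primN c d F f : prim c d F f -> prim c d (fun x => - F x) (fun x => - f x).
Proof.
move=> /(primZ (-1)); under eq_fun do rewrite mulN1r.
by under [X in prim _ _ _ X]eq_fun do rewrite mulN1r.
Qed.

Lemma primSub c d F f G g : prim c d F f -> prim c d G g ->
  prim c d (fun x => F x - G x) (fun x => f x - g x).
Proof. by move=> Ff /primN; exact: primD. Qed.

Lemma prim_sum c d (I : Type) (s : seq I) (F f : I -> R -> R) : c <= d ->
  (forall i, prim c d (F i) (f i)) ->
  prim c d (fun x => \sum_(i <- s) F i x) (fun x => \sum_(i <- s) f i x).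
Proof.
move=> cd Ff; elim: s => [|i s IH].
  under eq_fun do rewrite big_nil; under [X in prim _ _ _ X]eq_fun do rewrite big_nil.
  exact: prim_cst.
under eq_fun do rewrite big_cons; under [X in prim _ _ _ X]eq_fun do rewrite big_cons.
exact: primD.
Qed.

Lemma prim_sub c d c' d' F f : c <= c' -> c' <= d' -> d' <= d -> prim c d F f -> prim c' d' F f.
Proof.
move=> cc cd' dd Ff; split; first exact: intg_sub (prim_intg Ff).
move=> x; rewrite in_itv/= => /andP[cx xd].
by rewrite -(primB Ff cc cx (le_trans xd dd)) addrC subrK.
Qed.

Let h_intg c d f : intg c d f -> mu.-integrable setT (EFin \o (f \_ `[c, d])).
Proof.
by move=> fi; rewrite -restrict_EFin; apply/integrable_restrict => //; rewrite setTI.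
Qed.

Lemma intg_cat c m d f : c <= m -> m <= d -> intg c m f -> intg m d f -> intg c d f.
Proof.
move=> cm md f1 f2.
have f2' : mu.-integrable setT (EFin \o (f \_ `]m, d])).
  rewrite -restrict_EFin; apply/integrable_restrict => //; rewrite setTI.
  by apply: integrableS f2 => //; apply: subset_itvr; rewrite bnd_simp.
have f12 := integrableD measurableT (h_intg f1) f2'.
have : intg c d (fun x => (f \_ `[c, m]) x + (f \_ `]m, d]) x).
  by apply: integrableS f12.
apply: intg_eq => x /andP[cx xd]; rewrite !patchE !mem_setE !in_itv/= cx xd andbT.
by case: ltP; rewrite ?addr0 ?add0r.
Qed.

Lemma prim_cat c m d F f : c <= m -> m <= d -> prim c m F f -> prim m d F f -> prim c d F f.
Proof.
move=> cm md F1 F2; have fi := intg_cat cm md (prim_intg F1) (prim_intg F2).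
split => // x; rewrite in_itv/= => /andP[cx xd].
have [xm|mx] := leP x m; first by apply: (primE F1); rewrite cx.
have mxd : m <= x <= d by rewrite ltW.
rewrite (primE F2 mxd) -(Int_sub fi cm (ltW mx) xd).
by rewrite (primE (x := m) F1) ?cm ?lexx//; lra.
Qed.

Lemma prim_nondecreasing c d F f x y : prim c d F f -> (forall x, c <= x <= d -> 0 <= f x) ->
  c <= x -> x <= y -> y <= d -> F x <= F y.
Proof.
move=> Ff f0 cx xy yd; rewrite -subr_ge0 (primB Ff cx xy yd); apply: Int_ge0 => z /andP[xz zy].
by apply: f0; rewrite (le_trans cx)//= (le_trans zy).
Qed.

Let U (s : seq (R * R)) : set R := \big[setU/set0]_(p <- s) `]p.1, p.2[%classic.

Let mU s : measurable (U s).
Proof. by apply: bigsetU_measurable => p _; exact: measurable_itv. Qed.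

Let UP s x : U s x -> exists2 p, p \in s & p.1 < x < p.2.
Proof.
rewrite /U; elim: s => [|p s IH]; first by rewrite big_nil.
rewrite big_cons => -[|/IH[q qs qx]]; last by exists q => //; rewrite inE qs orbT.
by rewrite /= in_itv/= => px; exists p => //; exact: mem_head.
Qed.

(** The open intervals of a non-overlapping family are disjoint, so the increments of F are
    controlled by one integral of |f| over their union, a set of small measure. *)
Let AC_step c d F f s : prim c d F f ->
  all (fun p => [&& c <= p.1, p.1 <= p.2 & p.2 <= d]) s ->
  pairwise (fun p q => (p.2 <= q.1) || (q.2 <= p.1)) s ->
  \sum_(p <- s) `|F p.2 - F p.1| <= \int[mu]_(x in U s) `|(f \_ `[c, d]) x| /\
   (mu (U s) <= (\sum_(p <- s) (p.2 - p.1))%:E)%E.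
Proof.
move=> Ff; have hi := h_intg (prim_intg Ff); set h := f \_ `[c, d] in hi *.
have nhi (A : set R) : measurable A -> mu.-integrable A (EFin \o (fun x => `|h x|)).
  by move=> mA; have := integrable_norm hi; apply: integrableS.
elim: s => [|p s IH] /=.
  by rewrite /U !big_nil Rintegral_set0 measure0.
move=> /andP[/and3P[cp pp pd] sI] /andP[ps sN]; have [IH1 IH2] := IH sI sN.
have E : U (p :: s) = `]p.1, p.2[%classic `|` U s by rewrite /U big_cons.
rewrite !big_cons E; split; last first.
  rewrite EFinD; apply: (le_trans (measureU2 _ _ _)); [exact: measurable_itv|exact: mU|].
  have Em : mu `]p.1, p.2[%classic = (p.2 - p.1)%:E.
    rewrite lebesgue_measure_itv/= lte_fin.
    by case: ltgtP pp => // -> _; rewrite subrr.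
  by apply: leeD; [rewrite -Em|exact: IH2].
rewrite Rintegral_setU//; last 3 first.
- exact: mU.
- by apply: nhi; exact: measurableU.
- apply/disj_setPS => x [/=]; rewrite in_itv/= => /andP[px xp] /UP[q qs /andP[qx xq]].
  have /allP/(_ _ qs)/orP[H|H] := ps.
    by have := lt_trans (lt_le_trans xp H) qx; rewrite ltxx.
  by have := lt_trans (lt_le_trans xq H) px; rewrite ltxx.
apply: lerD => //; rewrite (primB Ff cp pp pd).
have fi : intg p.1 p.2 f by exact: intg_sub (prim_intg Ff).
apply: le_trans (norm_Int_le fi) _.
rewrite le_eqVlt; apply/orP; left; apply/eqP.
rewrite Rintegral_itv_bndo_bndc; last exact: nhi.
rewrite Rintegral_itv_obnd_cbnd; last exact: nhi.
apply: eq_Int => x /andP[px xp]; rewrite /h patchE mem_set//= in_itv/=.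
by rewrite (le_trans cp)//= (le_trans xp).
Qed.

Lemma prim_AC c d F f : prim c d F f -> abs_continuous_on c d F.
Proof.
move=> Ff e e0.
have [dl [d0 H]] := integral_normr_continuous (h_intg (prim_intg Ff)) e0.
exists dl => // s sI sN sd; have [h1 h2] := AC_step Ff sI sN.
apply: (le_lt_trans h1); apply: H; first exact: mU.
by apply: (le_lt_trans h2); rewrite lte_fin.
Qed.

Lemma prim_cont c d F f : prim c d F f -> cont_on c d F.
Proof. by move=> /prim_AC/AC_within_continuous. Qed.

(** Lebesgue differentiation, applied to [f] extended by zero outside [c, d]. *)
Lemma prim_is_derive c d F f : prim c d F f ->
  {ae mu, forall x, c < x < d -> is_derive x 1 F (f x)}.
Proof.
move=> Ff; have fi := prim_intg Ff; have hi := h_intg fi; set h := f \_ `[c, d] in hi.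
have hy y : mu.-integrable `[c, y] (EFin \o h) by apply: integrableS hi.
have hl : locally_integrable setT h by apply: integrable_locally_restrict.
have := FTC1 hy hl.
apply: aeW => x H /andP[cx xd]; have [|dF F'] := H.
  by rewrite lte_fin.
have -> : f x = h x by rewrite /h patchE mem_set//= in_itv/= !ltW.
have D : is_derive x 1 (fun y => F c + Int c y h) (h x).
  rewrite -F' derive1E -[X in is_derive _ _ _ X]add0r.
  by apply: is_deriveD; exact: DeriveDef.
apply: near_eq_is_derive D; near=> y.
have : y \in `]c, d[ by near: y; apply: near_in_itvoo; rewrite in_itv/= cx.
rewrite in_itv/= => /andP[cy yd]; have ycd : c <= y <= d by rewrite !ltW.
rewrite (primE Ff ycd); congr (_ + _); apply: eq_Int => t /andP[ct ty].
by rewrite /h patchE mem_set//= in_itv/= ct (le_trans ty)// ltW.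
Unshelve. all: by end_near. Qed.

(** Absolute continuity provides some density; differentiating almost everywhere identifies it with
    [f]. Products and exponentials of primitives are handled in this way. *)
Lemma AC_derive_prim c d F f : c <= d -> abs_continuous_on c d F -> intg c d f ->
  {ae mu, forall x, c < x < d -> is_derive x 1 F (f x)} -> prim c d F f.
Proof.
move=> cd Fac fi Ff; have [g Fg] := AC_prim cd Fac.
apply: (prim_aer fi _ Fg).
apply: aeW2 Ff (prim_is_derive Fg) => x Fx gx xcd.
by have /(@derive_val _ _ _ _ _ _ _) <- := Fx xcd; have /(@derive_val _ _ _ _ _ _ _) <- := gx xcd.
Qed.

Lemma AC_mul c d F G : abs_continuous_on c d F -> abs_continuous_on c d G ->
  abs_continuous_on c d (fun x => F x * G x).
Proof.
move=> Fa Ga; have [M M0 FM] := cont_on_bounded (AC_within_continuous Fa).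
have [L L0 GL] := cont_on_bounded (AC_within_continuous Ga).
move=> e e0; pose k := M + L + 1.
have k0 : 0 < k by rewrite /k; lra.
have ek : 0 < e / k / 2 by rewrite !divr_gt0.
have [d1 d10 H1] := Fa _ ek; have [d2 d20 H2] := Ga _ ek.
exists (Num.min d1 d2); first by rewrite lt_min d10.
move=> s sI sN; rewrite lt_min => /andP[s1 s2].
have := ltrD (H1 _ sI sN s1) (H2 _ sI sN s2); rewrite -splitr ltr_pdivlMr//.
apply: le_lt_trans; rewrite -big_split/= mulr_suml.
rewrite big_seq [leRHS]big_seq; apply: ler_sum => p ps.
have /allP/(_ _ ps)/and3P[h1 h2 h3] := sI.
have -> : F p.2 * G p.2 - F p.1 * G p.1 = (F p.2 - F p.1) * G p.2 + F p.1 * (G p.2 - G p.1) by lra.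
apply: le_trans (ler_normD _ _) _; rewrite !normrM.
have F1 : `|F p.1| <= k by rewrite (le_trans (FM _ _))// ?h1 ?(le_trans h2)// /k; lra.
have G2 : `|G p.2| <= k by rewrite (le_trans (GL _ _))// ?h3 ?(le_trans h1)// /k; lra.
by rewrite mulrDl lerD ?[`|F p.1| * _]mulrC ?ler_wpM2l.
Qed.

Lemma prim_mul c d F f G g : c <= d -> prim c d F f -> prim c d G g ->
  prim c d (fun x => F x * G x) (fun x => f x * G x + F x * g x).
Proof.
move=> cd Ff Gg; apply: AC_derive_prim => //.
- by apply: AC_mul; [exact: prim_AC Ff|exact: prim_AC Gg].
- apply: intgD; first exact: intgM_cont (prim_intg Ff) (prim_cont Gg).
  under eq_fun do rewrite mulrC.
  exact: intgM_cont (prim_intg Gg) (prim_cont Ff).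
apply: aeW2 (prim_is_derive Ff) (prim_is_derive Gg) => x Fx Gx xcd.
have Fx' := Fx xcd; have Gx' := Gx xcd; apply: is_derive_eq.
by rewrite -![_ *: _]/(_ * _) addrC [G x * _]mulrC.
Qed.

Lemma prim_exp c d F f : c <= d -> prim c d F f ->
  prim c d (fun x => expR (F x)) (fun x => expR (F x) * f x).
Proof.
move=> cd Ff; have Fc := prim_cont Ff.
have eFc : cont_on c d (fun x => expR (F x)).
  by apply: cont_on_comp Fc _; exact: continuous_expR.
have [M M0 FM] := cont_on_bounded eFc.
apply: AC_derive_prim => //.
- move=> e e0; have M1 : 0 < M + 1 by lra.
  have [dl d0 H] := prim_AC Ff (divr_gt0 e0 M1); exists dl => // s sI sN sd.
  have := H s sI sN sd; rewrite ltr_pdivlMr//; apply: le_lt_trans.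
  rewrite mulr_suml big_seq [leRHS]big_seq; apply: ler_sum => p ps.
  have /allP/(_ _ ps)/and3P[h1 h2 h3] := sI.
  have B x : c <= x <= d -> expR (F x) <= M + 1.
    by move=> /FM; have := ler_norm (expR (F x)); lra.
  have B1 : expR (F p.1) <= M + 1 by rewrite B// h1 (le_trans h2).
  have B2 : expR (F p.2) <= M + 1 by rewrite B// h3 (le_trans h1).
  (* The inequality exp(u - v) >= 1 + u - v gives exp v - exp u <= (v - u) exp v. *)
  have lip u v : u <= v -> expR v <= M + 1 -> `|expR v - expR u| <= `|v - u| * (M + 1).
    move=> uv vM; rewrite !ger0_norm ?subr_ge0 ?ler_expR//.
    have := expR_ge1Dx (u - v); rewrite expRB ler_pdivlMr ?expR_gt0// => E.
    have : (v - u) * expR v <= (v - u) * (M + 1) by rewrite ler_wpM2l// subr_ge0.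
    nra.
  have [uv|/ltW uv] := leP (F p.1) (F p.2); first exact: lip.
  by rewrite distrC [X in X * _]distrC; exact: lip.
- under eq_fun do rewrite mulrC; exact: intgM_cont (prim_intg Ff) _.
apply: aeW (prim_is_derive Ff) => x Fx xcd.
have := @is_derive1_comp _ expR F x _ _ (is_derive_expR (F x)) (Fx xcd).
by [].
Qed.
End prim_theory.

(** * Linear systems with integrable coefficients *)

Section gronwall.
Variable R : realType.
Implicit Types (c d k x y : R) (F f u m : R -> R).

Lemma prim_norm_le c d F f x : prim c d F f -> c <= x <= d ->
  `|F x| <= `|F c| + Int c x (fun t => `|f t|).
Proof.
move=> Ff /[dup] xcd /andP[cx xd]; rewrite (primE Ff xcd).
apply: le_trans (ler_normD _ _) _; rewrite lerD2l; apply: norm_Int_le.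
exact: intg_sub (prim_intg Ff).
Qed.

Lemma Int_ge0_subr c d f x : intg c d f -> (forall t, c <= t <= d -> 0 <= f t) ->
  c <= x <= d -> Int c x f <= Int c d f.
Proof.
move=> fi f0 /andP[cx xd]; rewrite -subr_ge0 (Int_sub fi cx xd (lexx d)).
by apply: Int_ge0 => t /andP[xt td]; apply: f0; rewrite td (le_trans cx).
Qed.

(** The product of k + Int m u with exp(- Int m) is nonincreasing: its derivative is m exp(- Int m)
    (u - k - Int m u). *)
Lemma gronwall c d u m k : c <= d -> cont_on c d u -> intg c d m ->
  (forall x, c <= x <= d -> 0 <= m x) ->
  (forall x, c <= x <= d -> u x <= k + Int c x (fun t => m t * u t)) ->
  forall x, c <= x <= d -> u x <= k * expR (Int c x m).
Proof.
move=> cd uc mi m0 H x /[dup] xcd /andP[cx xd].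
have Wp := prim_of_intg k (intgM_cont mi uc).
have Ep := prim_exp cd (primN (prim_of_intg 0 mi)).
have := primN (prim_mul cd Wp Ep) => WE.
apply: le_trans (H x xcd) _.
have := prim_nondecreasing WE _ (lexx c) cx xd.
rewrite !set_itv1 !Rintegral_set1 !addr0 oppr0 expR0 mulr1 add0r lerN2 expRN.
rewrite ler_pdivrMr ?expR_gt0//; apply => t tcd.
set E := expR _; have E0 : 0 <= E by exact: expR_ge0.
have h := H t tcd.
have -> : - (m t * u t * E + (k + Int c t (fun t0 => m t0 * u t0)) * (E * - m t)) =
   m t * E * (k + Int c t (fun t0 => m t0 * u t0) - u t) by ring.
by rewrite !mulr_ge0 ?m0// subr_ge0.
Qed.

Lemma cont_on_unif c d f :
  (forall e, 0 < e -> exists2 g, cont_on c d g &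
    forall x, c <= x <= d -> `|f x - g x| <= e) -> cont_on c d f.
Proof.
move=> H; apply/subspace_continuousP => x /=; rewrite in_itv/= => xcd.
apply/cvgrPdist_lt => e e0; have e30 : 0 < e / 3 by rewrite divr_gt0.
have [g gc fg] := H _ e30.
have /subspace_continuousP/(_ x) := gc; rewrite /= in_itv/= => /(_ xcd)/cvgrPdist_lt/(_ _ e30).
rewrite !near_withinE; apply: filterS => y hy; rewrite /= in_itv/= => ycd.
have h1 := fg x xcd; have h2 := fg y ycd; have := hy; rewrite /= in_itv/= => /(_ ycd) h3.
have -> : f x - f y = (f x - g x) + (g x - g y) - (f y - g y) by ring.
apply: le_lt_trans (ler_normB _ _) _; have := ler_normD (f x - g x) (g x - g y); lra.
Qed.

Lemma cont_on_norm c d f : cont_on c d f -> cont_on c d (fun x => `|f x|).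
Proof. by move=> fc; apply: cont_on_comp fc _; exact: norm_continuous. Qed.

Lemma geom_le0 (k y : R) : (forall n, y <= k * (2^-1) ^+ n) -> y <= 0.
Proof.
move=> H; rewrite leNgt; apply/negP => y0.
have k0 : 0 < k by have := H 0%N; rewrite expr0 mulr1; exact: lt_le_trans.
pose n := Num.bound (k / y); have := H n; rewrite leNgt => /negP; apply.
rewrite exprVn ltr_pdivrMr ?exprn_gt0// mulrC -ltr_pdivrMr//.
have : k / y < n%:R by apply: archi_boundP; rewrite divr_ge0// ltW.
move=> /lt_trans; apply; rewrite -natrX ltr_nat; exact: ltn_expl.
Qed.

(** The limit is the supremum of the lower bounds v_n - h_n, where h_n = 2 k 2^-n is the tail of the
    geometric series; this gives the rate at once. *)
Lemma geom_cauchy_lim (v : nat -> R) (k : R) :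
  (forall n, `|v n.+1 - v n| <= k * (2^-1) ^+ n) ->
  exists l, forall n, `|l - v n| <= 2 * k * (2^-1) ^+ n.
Proof.
move=> H; pose h n : R := 2 * k * (2^-1) ^+ n.
have hS n : h n - h n.+1 = k * (2^-1) ^+ n by rewrite /h exprS; field.
have h0 n : 0 <= h n - h n.+1 by rewrite hS (le_trans _ (H n)).
have hp n : 0 <= h n by have := le_trans (normr_ge0 _) (H n); rewrite /h -mulrA; lra.
have up n p : `|v (n + p)%N - v n| <= h n - h (n + p)%N.
  elim: p => [|p IH]; first by rewrite addn0 !subrr normr0.
  have := H (n + p)%N; rewrite -hS addnS => h1.
  have -> : v (n + p).+1 - v n = (v (n + p).+1 - v (n + p)%N) + (v (n + p)%N - v n) by ring.
  by apply: le_trans (ler_normD _ _) _; lra.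
have nm n l : v n - h n <= v l + h l.
  have [nm|/ltnW mn] := leqP n l.
    by have := up n (l - n)%N; rewrite subnKC// ler_norml => /andP[? ?]; have := hp l; have := hp n; lra.
  by have := up l (n - l)%N; rewrite subnKC// ler_norml => /andP[? ?]; have := hp l; have := hp n; lra.
exists (sup (range (fun n => v n - h n))) => n; rewrite ler_norml; apply/andP; split.
  rewrite lerBrDr addrC; apply: ub_le_sup; last by exists n.
  by exists (v 0%N + h 0%N) => _ [l _ <-]; exact: nm.
rewrite lerBlDr addrC; apply: ge_sup; first by exists (v 0%N - h 0%N); exists 0%N.
by move=> _ [l _ <-]; exact: nm.
Qed.
End gronwall.

Section linear_ode.
Variables (R : realType) (I : finType) (c d : R).
Hypothesis cd : c <= d.
Implicit Types (A : I -> I -> R -> R) (f U : I -> R -> R).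

Definition lin_sol A f U := forall i,
  prim c d (U i) (fun x => \sum_j A i j x * U j x + f i x).

Let m A x := \sum_i \sum_j `|A i j x|.

Let m_intg A : (forall i j, intg c d (A i j)) -> intg c d (m A).
Proof. by move=> Ai; apply: intg_sum => i _; apply: intg_sum => j _; exact: intg_norm. Qed.

Let m_ge0 A x : 0 <= m A x.
Proof. by apply: sumr_ge0 => i _; apply: sumr_ge0. Qed.

Let AU_le A U x : \sum_i `|\sum_j A i j x * U j x| <= m A x * \sum_j `|U j x|.
Proof.
rewrite /m mulr_suml; apply: ler_sum => i _; apply: le_trans (ler_norm_sum _ _ _) _.
rewrite mulr_suml; apply: ler_sum => j _; rewrite normrM ler_wpM2l//.
by rewrite (bigD1 j)//= lerDl sumr_ge0.
Qed.

Let AU_intg A U : (forall i j, intg c d (A i j)) -> (forall j, cont_on c d (U j)) ->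
  forall i, intg c d (fun x => \sum_j A i j x * U j x).
Proof. by move=> Ai Uc i; apply: intg_sum => j _; exact: intgM_cont. Qed.

Lemma lin_sol_bound A f U : (forall i j, intg c d (A i j)) -> (forall i, intg c d (f i)) ->
  lin_sol A f U -> forall x, c <= x <= d ->
  \sum_i `|U i x| <= (\sum_i `|U i c| + Int c d (fun t => \sum_i `|f i t|)) *
    expR (Int c d (fun t => \sum_i \sum_j `|A i j t|)).
Proof.
move=> Ai fi Us x xcd; have mi := m_intg Ai.
have Uc i : cont_on c d (U i) by exact: prim_cont (Us i).
pose K := \sum_i `|U i c| + Int c d (fun t => \sum_i `|f i t|).
have uc : cont_on c d (fun x => \sum_i `|U i x|).
  by apply: cont_on_sum => i _; apply: cont_on_norm.
have nfi : intg c d (fun t => \sum_i `|f i t|) by apply: intg_sum => i _; exact: intg_norm.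
have Int0 : 0 <= Int c d (fun t => \sum_i `|f i t|).
  by apply: Int_ge0 => t _; apply: sumr_ge0.
have K0 : 0 <= K by rewrite addr_ge0// sumr_ge0.
have /le_trans : \sum_i `|U i x| <= K * expR (Int c x (m A)).
  apply: (gronwall (u := fun x => \sum_i `|U i x|) cd uc mi) => // {xcd}x xcd; rewrite /K.
  have /andP[cx xd] := xcd.
  have sb g : intg c d g -> intg c x g by apply: intg_sub.
  have AUfi i : intg c d (fun t => \sum_j A i j t * U j t + f i t) by exact: prim_intg (Us i).
  apply: (@le_trans _ _ (\sum_i (`|U i c| + Int c x (fun t => `|\sum_j A i j t * U j t + f i t|)))).
    by apply: ler_sum => i _; exact: prim_norm_le (Us i) xcd.
  rewrite big_split/= -addrA lerD2l.
  rewrite -Int_sum; last by move=> i _; apply/intg_norm/sb.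
  apply: le_trans (lerD (Int_ge0_subr nfi _ xcd) (lexx _)); last first.
    by move=> t _; apply: sumr_ge0.
  rewrite -IntD; [|exact: sb|by apply: sb; exact: intgM_cont].
  apply: le_Int.
  - by apply: intg_sum => i _; apply/intg_norm/sb.
  - by apply: sb; apply: intgD => //; exact: intgM_cont.
  move=> t _; apply: le_trans (lerD (lexx _) (AU_le A U t)).
  by rewrite -big_split/=; apply: ler_sum => i _; rewrite addrC; exact: ler_normD.
apply; apply: (ler_wpM2l K0); rewrite ler_expR.
by apply: Int_ge0_subr => // t _; exact: m_ge0.
Qed.

(** Picard iteration on the whole interval. Measured against exp(2 Int m), each step contracts by
    1/2, since m exp(2 Int m) is half the derivative of exp(2 Int m); thus [c, d] is not
    subdivided. *)
Lemma lin_sol_exists A f (U0 : I -> R) :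
  (forall i j, intg c d (A i j)) -> (forall i, intg c d (f i)) ->
  exists2 U, lin_sol A f U & forall i, U i c = U0 i.
Proof.
move=> Ai fi; have mi := m_intg Ai.
pose P U i x := U0 i + Int c x (fun t => \sum_j A i j t * U j t + f i t).
pose V n := iter n P (fun i _ => U0 i).
have Vc n i : cont_on c d (V n i).
  elim: n i => [|n IH] i /=; first exact: cont_on_cst.
  have rhs : intg c d (fun t => \sum_j A i j t * V n j t + f i t).
    by apply: intgD => //; exact: AU_intg.
  exact: prim_cont (prim_of_intg (U0 i) rhs).
have rhs n i : intg c d (fun t => \sum_j A i j t * V n j t + f i t).
  by apply: intgD => //; exact: AU_intg.
pose al x := 0 + Int c x (m A).
have alp : prim c d al (m A) by exact: prim_of_intg.
have ep : prim c d (fun x => expR (2 * al x)) (fun x => expR (2 * al x) * (2 * m A x)).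
  exact: prim_exp cd (primZ 2 alp).
have al0 : al c = 0 by rewrite /al set_itv1 Rintegral_set1 addr0.
pose D n x := \sum_i `|V n.+1 i x - V n i x|.
have Dc n : cont_on c d (D n).
  by apply: cont_on_sum => i _; apply: cont_on_norm; apply: cont_onD => //; exact: cont_onN.
have [K K0 DK] := cont_on_bounded (Dc 0%N).
have al_ge0 x : c <= x <= d -> 0 <= al x.
  by move=> _; rewrite /al add0r; apply: Int_ge0.
have DP n x : c <= x <= d -> D n x <= K * (2^-1) ^+ n * expR (2 * al x).
  elim: n x => [|n IH] x xcd.
    rewrite expr0 mulr1; apply: le_trans (ler_norm _) _; apply: le_trans (DK x xcd) _.
    rewrite -[leLHS]mulr1 ler_wpM2l// -expR0 ler_expR mulr_ge0// al_ge0//.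
  have /andP[cx xd] := xcd.
  have sb g : intg c d g -> intg c x g by apply: intg_sub.
  have mDi : intg c d (fun t => m A t * D n t) by exact: intgM_cont.
  apply: (@le_trans _ _ (Int c x (fun t => m A t * D n t))).
    rewrite /D.
    have E i : V n.+2 i x - V n.+1 i x =
        Int c x (fun t => \sum_j A i j t * (V n.+1 j t - V n j t)).
      rewrite [V n.+2]/(P (V n.+1)) {2}[V n.+1]/(P (V n)) /P.
      have -> : forall p q r : R, p + q - (p + r) = q - r by move=> *; ring.
      rewrite -IntB; [|exact: sb|exact: sb].
      apply: eq_Int => t _.
      have -> : forall p q r : R, p + q - (r + q) = p - r by move=> *; ring.
      by rewrite -sumrB; apply: eq_bigr => j _; rewrite mulrBr.
    have di i : intg c d (fun t => \sum_j A i j t * (V n.+1 j t - V n j t)).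
      by apply: AU_intg => // j; apply: cont_onD => //; exact: cont_onN.
    apply: (@le_trans _ _ (\sum_i Int c x (fun t => `|\sum_j A i j t * (V n.+1 j t - V n j t)|))).
      by apply: ler_sum => i _; rewrite E; apply/norm_Int_le/sb.
    rewrite -Int_sum; last by move=> i _; apply/intg_norm/sb.
    apply: le_Int.
    - by apply: intg_sum => i _; apply/intg_norm/sb.
    - exact: sb.
    - by move=> t _; exact: (AU_le A (fun j t => V n.+1 j t - V n j t)).
  have ei := prim_intg ep.
  apply: (@le_trans _ _ (Int c x (fun t => K * (2^-1) ^+ n.+1 * (expR (2 * al t) * (2 * m A t))))).
    apply: le_Int; [exact: sb|apply: sb; exact: intgZ|].
    move=> t /andP[ct tx].
    have := ler_wpM2l (m_ge0 A t) (IH t _); rewrite ct (le_trans tx)// => /(_ isT) /le_trans; apply.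
    by rewrite exprS; lra.
  rewrite IntZ; last exact: sb.
  rewrite ler_wpM2l ?mulr_ge0// ?exprn_ge0//.
  by rewrite -(primB ep (lexx c) cx xd) al0 mulr0 expR0; lra.
have ald x : c <= x <= d -> expR (2 * al x) <= expR (2 * al d).
  move=> xcd; rewrite ler_expR ler_wpM2l// /al !add0r; exact: Int_ge0_subr.
pose C := K * expR (2 * al d).
have VC i x n : c <= x <= d -> `|V n.+1 i x - V n i x| <= C * (2^-1) ^+ n.
  move=> xcd; apply: (@le_trans _ _ (D n x)).
    by rewrite /D (bigD1 i)//= lerDl sumr_ge0.
  apply: le_trans (DP n x xcd) _; rewrite /C [X in _ <= X]mulrAC.
  by apply: ler_wpM2l (ald x xcd); rewrite mulr_ge0// exprn_ge0.
have /choice[U UP] ix : exists l, c <= ix.2 <= d ->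
    forall n, `|l - V n ix.1 ix.2| <= 2 * C * (2^-1) ^+ n.
  have [xcd|] := boolP (c <= ix.2 <= d); last by exists 0.
  by have [l lP] := geom_cauchy_lim (fun n => VC ix.1 ix.2 n xcd); exists l.
pose W i x := U (i, x).
have WP i x n : c <= x <= d -> `|W i x - V n i x| <= 2 * C * (2^-1) ^+ n.
  by move=> xcd; exact: (UP (i, x)).
have C0 : 0 <= C by rewrite mulr_ge0// expR_ge0.
have Wc i : cont_on c d (W i).
  apply: cont_on_unif => e e0.
  have [n ne] : exists n, 2 * C * (2^-1) ^+ n <= e.
    apply: contrapT => /forallNP H; have : e <= 0.
      by apply: (@geom_le0 _ (2 * C)) => n; apply/ltW; rewrite ltNge; apply/negP/H.
    by rewrite leNgt e0.
  by exists (V n i) => // x xcd; exact: le_trans (WP i x n xcd) ne.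
have Wi i : intg c d (fun t => \sum_j A i j t * W j t + f i t).
  by apply: intgD => //; exact: AU_intg.
(* Both W - V_(n+1) and V_(n+1) - P W are O(2^-n), so W is a fixed point of P. *)
have WE i x : c <= x <= d -> W i x = P W i x.
  move=> xcd; have /andP[cx xd] := xcd; apply/eqP; rewrite -subr_eq0 -normr_le0.
  have sb g : intg c d g -> intg c x g by apply: intg_sub.
  pose M := Int c d (m A).
  apply: (@geom_le0 _ (2 * C + M * (#|I|%:R * (2 * C)))) => n.
  have -> : W i x - P W i x = (W i x - V n.+1 i x) + (V n.+1 i x - P W i x) by ring.
  apply: le_trans (ler_normD _ _) _; rewrite mulrDl; apply: lerD.
    apply: le_trans (WP i x n.+1 xcd) _; rewrite ler_wpM2l ?mulr_ge0// exprS.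
    by rewrite -[leRHS]mul1r ler_wpM2r ?exprn_ge0//; lra.
  have -> : V n.+1 i x - P W i x = Int c x (fun t => \sum_j A i j t * (V n j t - W j t)).
    rewrite [V n.+1]/(P (V n)) /P.
    have -> : forall p q r : R, p + q - (p + r) = q - r by move=> *; ring.
    rewrite -IntB; [|exact: sb|exact: sb].
    apply: eq_Int => t _.
    have -> : forall p q r : R, p + q - (r + q) = p - r by move=> *; ring.
    by rewrite -sumrB; apply: eq_bigr => j _; rewrite mulrBr.
  have di k : intg c d (fun t => \sum_j A k j t * (V n j t - W j t)).
    by apply: AU_intg => // j; apply: cont_onD => //; exact: cont_onN.
  apply: le_trans (norm_Int_le (sb _ (di i))) _.
  pose B := #|I|%:R * (2 * C) * (2^-1) ^+ n.
  apply: (@le_trans _ _ (Int c x (fun t => B * m A t))).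
    apply: le_Int; [exact/intg_norm/sb|exact/sb/intgZ|].
    move=> t /andP[ct tx]; have tcd : c <= t <= d by rewrite ct (le_trans tx).
    apply: (@le_trans _ _ (\sum_k `|\sum_j A k j t * (V n j t - W j t)|)).
      by rewrite [leRHS](bigD1 i)//= lerDl sumr_ge0.
    apply: le_trans (AU_le A (fun j t => V n j t - W j t) t) _.
    rewrite mulrC ler_wpM2r//.
    apply: (@le_trans _ _ (\sum_(j : I) 2 * C * (2^-1) ^+ n)).
      by apply: ler_sum => j _; rewrite distrC; exact: WP.
    by rewrite sumr_const -[_ *+ #|_|]mulr_natl /B !mulrA.
  rewrite IntZ; last exact: sb.
  have B0 : 0 <= B by rewrite /B !mulr_ge0// exprn_ge0.
  have := ler_wpM2l B0 (Int_ge0_subr mi (fun t _ => m_ge0 A t) xcd).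
  by move=> /le_trans; apply; rewrite -/M /B; lra.
exists W => [i|i].
  apply: prim_eql (prim_of_intg (U0 i) (Wi i)) => x xcd; exact/esym/WE.
by rewrite WE ?lexx// /P set_itv1 Rintegral_set1 addr0.
Qed.
End linear_ode.

(** * Reduction to a continuous first order system *)

Section open_pieces.
Variable R : realType.
Implicit Types (c d k p q x : R) (y v g D : R -> R).
Local Notation mu := (@lebesgue_measure R).

Lemma at_right_eq c d f g (l : R) : c < d -> (forall x, c < x < d -> f x = g x) ->
  f x @[x --> c^'+] --> l -> g x @[x --> c^'+] --> l.
Proof.
move=> cd fg; apply: cvg_trans; apply: near_eq_cvg; near=> x; rewrite -fg//.
by apply/andP; split; near: x; [exact: nbhs_right_gt|exact: nbhs_right_lt].
Unshelve. all: by end_near. Qed.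

Lemma at_left_eq c d f g (l : R) : c < d -> (forall x, c < x < d -> f x = g x) ->
  f x @[x --> d^'-] --> l -> g x @[x --> d^'-] --> l.
Proof.
move=> cd fg; apply: cvg_trans; apply: near_eq_cvg; near=> x; rewrite -fg//.
by apply/andP; split; near: x; [exact: nbhs_left_gt|exact: nbhs_left_lt].
Unshelve. all: by end_near. Qed.

Lemma cont_on_at_right c d f : c < d -> cont_on c d f -> f x @[x --> c^'+] --> f c.
Proof. by move=> cd /(continuous_within_itvP _ cd)[]. Qed.

Lemma cont_on_at_left c d f : c < d -> cont_on c d f -> f x @[x --> d^'-] --> f d.
Proof. by move=> cd /(continuous_within_itvP _ cd)[]. Qed.

Lemma cont_on_for c d f x : cont_on c d f -> c < x < d -> {for x, continuous f}.
Proof.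
move=> fc /andP[cx xd]; have [h _ _] := (continuous_within_itvP f (lt_trans cx xd)).1 fc.
by apply: h; rewrite in_itv/= cx.
Qed.

Lemma cont_const_open c d D k : c < d -> cont_on c d D ->
  (forall x, c < x < d -> D x = k) -> forall x, c <= x <= d -> D x = k.
Proof.
move=> cd Dc Dk x /andP[]; rewrite le_eqVlt => /predU1P[<- _|cx].
  have h1 := at_right_eq cd Dk (cont_on_at_right cd Dc).
  exact: (cvg_unique _ h1 (cvg_cst k)).
rewrite le_eqVlt => /predU1P[->|xd]; last by apply: Dk; rewrite cx.
have h1 := at_left_eq cd Dk (cont_on_at_left cd Dc).
exact: (cvg_unique _ h1 (cvg_cst k)).
Qed.

(** Inside the interval F minus the integral of f is constant; continuity carries the constant to
    the endpoints. *)
Lemma prim_open c d F f : c < d -> cont_on c d F -> intg c d f ->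
  (forall p q, c < p -> p <= q -> q < d -> prim p q F f) -> prim c d F f.
Proof.
move=> cd Fc fi H; have Pf := prim_of_intg 0 fi.
pose D x := F x - (0 + Int c x f); pose m := (c + d) / 2.
have cm : c < m by rewrite /m; lra.
have md : m < d by rewrite /m; lra.
have Dc : cont_on c d D by apply: cont_onD => //; apply: cont_onN; exact: prim_cont Pf.
have Dm x : c < x < d -> D x = D m.
  move=> /andP[cx xd]; rewrite /D.
  have [xm|/ltW mx] := leP x m.
    have := primB (H x m cx xm md) (lexx _) xm (lexx _).
    by rewrite -(primB Pf (ltW cx) xm (ltW md)); lra.
  have := primB (H m x cm mx xd) (lexx _) mx (lexx _).
  by rewrite -(primB Pf (ltW cm) mx (ltW xd)); lra.
have De := cont_const_open cd Dc Dm.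
apply: prim_eql (prim_of_intg (F c) fi) => x xcd.
have := De x xcd; rewrite -(De c) ?lexx ?ltW// /D set_itv1 Rintegral_set1; lra.
Qed.

Lemma prim_C1 p q y v : p <= q -> cont_on p q v ->
  (forall x, p <= x <= q -> derivable y x 1 /\ derive1 y x = v x) -> prim p q y v.
Proof.
move=> pq vc H; split; first exact: cont_on_intg.
move=> x; rewrite in_itv/= => /andP[]; rewrite le_eqVlt => /predU1P[<- _|px xq].
  by rewrite set_itv1 Rintegral_set1 addr0.
have yc z : p <= z <= q -> {for z, continuous y}.
  by move=> /H[dy _]; apply: differentiable_continuous; apply/derivable1_diffP.
rewrite /Rintegral (@continuous_FTC2 _ _ y)//=.
- by rewrite [RHS]addrC subrK.
- exact: cont_on_sub vc.
- split.
  + move=> z; rewrite in_itv/= => /andP[pz zx].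
    by have [] := H z _; rewrite // (ltW pz) (le_trans (ltW zx)).
  + by apply: cvg_at_right_filter; apply: yc; rewrite lexx.
  + by apply: cvg_at_left_filter; apply: yc; rewrite ltW.
- move=> z; rewrite in_itv/= => /andP[pz zx].
  by have [] := H z _; rewrite // (ltW pz) (le_trans (ltW zx)).
Qed.

Lemma for_continuous_eq c d f g x : (forall z, c < z < d -> f z = g z) ->
  c < x < d -> {for x, continuous f} -> {for x, continuous g}.
Proof.
move=> fg xcd h; rewrite /prop_for /continuous_at -fg//.
apply: cvg_trans h; apply: near_eq_cvg; near=> z; apply: fg.
have : z \in `]c, d[ by near: z; apply: near_in_itvoo; rewrite in_itv.
by rewrite in_itv.
Unshelve. all: by end_near. Qed.

(** The one-sided limits extend y' to a continuous V on [c, d], and Z is the primitive of V agreeing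
    with y at the midpoint. Z replaces y because y may take arbitrary values at c and d. *)
Lemma piece_first c d y (lc ld : R) : c < d ->
  (forall x, c < x < d -> derivable y x 1) ->
  (forall p q, c < p -> q < d -> abs_continuous_on p q (derive1 y)) ->
  derive1 y x @[x --> c^'+] --> lc -> derive1 y x @[x --> d^'-] --> ld ->
  exists Z V, [/\ prim c d Z V, cont_on c d V, V c = lc /\ V d = ld,
    forall x, c < x < d -> V x = derive1 y x & forall x, c < x < d -> Z x = y x].
Proof.
move=> cd dy ac yc yd.
pose V x := if x <= c then lc else if d <= x then ld else derive1 y x.
have VE x : c < x < d -> V x = derive1 y x by move=> /andP[cx xd]; rewrite /V leNgt cx/= leNgt xd.
have Vcc : V c = lc by rewrite /V lexx.
have Vdd : V d = ld by rewrite /V leNgt cd lexx.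
have Vc : cont_on c d V.
  apply/(continuous_within_itvP _ cd); split.
  - move=> x; rewrite in_itv/= => /andP[cx xd].
    have h1 : c < (c + x) / 2 by lra.
    have h2 : (x + d) / 2 < d by lra.
    have h0 : (c + x) / 2 < x < (x + d) / 2 by apply/andP; split; lra.
    have h : {for x, continuous (derive1 y)} :=
      cont_on_for (AC_within_continuous (ac _ _ h1 h2)) h0.
    by apply: (for_continuous_eq (fun x xcd => esym (VE x xcd)) _ h); rewrite cx.
  - by rewrite Vcc; exact: (at_right_eq cd (fun x xcd => esym (VE x xcd)) yc).
  - by rewrite Vdd; exact: (at_left_eq cd (fun x xcd => esym (VE x xcd)) yd).
pose m := (c + d) / 2.
have cm : c < m by rewrite /m; lra.
have md : m < d by rewrite /m; lra.
have Vi := cont_on_intg Vc.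
pose F x := y m - Int c m V + Int c x V.
have Zp : prim c d F V by exact: prim_of_intg.
have Fm : F m = y m by rewrite /F subrK.
exists F, V; split => // x /andP[cx xd]; clearbody F V m.
have py p q : c < p -> p <= q -> q < d -> prim p q y V.
  move=> cp pq qd; apply: prim_C1 => //; first by apply: cont_on_sub Vc; exact: ltW.
  move=> z /andP[pz zq]; have zcd : c < z < d by rewrite (lt_le_trans cp)//= (le_lt_trans zq).
  by split; [exact: dy|rewrite VE].
have [xm|/ltW mx] := leP x m.
  have := primB (py x m cx xm md) (lexx _) xm (lexx _).
  by rewrite -(primB Zp (ltW cx) xm (ltW md)) Fm; lra.
have := primB (py m x cm mx xd) (lexx _) mx (lexx _).
by rewrite -(primB Zp (ltW cm) mx (ltW xd)) Fm; lra.
Qed.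

Lemma piece_second c d v V g : c < d -> cont_on c d V -> intg c d g ->
  (forall x, c < x < d -> V x = v x) ->
  (forall p q, c < p -> q < d -> abs_continuous_on p q v) ->
  {ae mu, forall x, c < x < d -> derive1 v x = g x} -> prim c d V g.
Proof.
move=> cd Vc gi VE ac H; apply: prim_open => // p q cp pq qd.
have [h vh] := AC_prim pq (ac p q cp qd).
apply: (@prim_eql _ _ _ v).
  by move=> x /andP[px xq]; rewrite VE// (lt_le_trans cp px) (le_lt_trans xq qd).
apply: (prim_aer _ _ vh); first exact: intg_sub (ltW cp) (ltW qd) gi.
apply: aeW2 H (prim_is_derive vh) => x Hx Dx /[dup] xpq /andP[px xq].
rewrite -Hx ?(lt_trans cp px) ?(lt_trans xq qd)// derive1E.
by have := Dx xpq => {}Dx; rewrite derive_val.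
Qed.
End open_pieces.

(** * Real solutions as solutions of the first order system *)

Section SL_real.
Variables (R : realType) (N : nat) (alpha a : R).
Hypotheses (alpha0 : 0 < alpha) (a0 : 0 < a).
Local Notation mu := (@lebesgue_measure R).
Implicit Types (Q : R -> 'M[R]_N) (q : 'I_N -> 'I_N -> R -> R) (lam : R).
Implicit Types (y Z V : 'I_N -> R -> R).

(* Y = jump Z and Y' = V / jump turn the transmission conditions into the
   continuity of Z and V at pi/2. *)
Definition jump (x : R) : R := if x < pi / 2 then 1 else a.

(** Meant for q = [jump]^2 Q: dividing Y'' = (V / [jump])' by the substitution gives the second
    line. The Neumann conditions on V are stated separately, so that initial value solutions are
    covered as well. *)
Definition wsol q lam Z V : Prop := forall j,
  prim 0 pi (Z j) (fun x => V j x / jump x ^+ 2) /\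
  prim 0 pi (V j) (fun x => \sum_k q j k x * Z k x - lam * (jump x ^+ 2 * rho alpha x) * Z j x).

Lemma jump_gt0 x : 0 < jump x.
Proof. by rewrite /jump; case: ifP. Qed.

Lemma jumpl x : x < pi / 2 -> jump x = 1.
Proof. by rewrite /jump => ->. Qed.

Lemma jumpr x : pi / 2 <= x -> jump x = a.
Proof. by rewrite /jump leNgt => /negbTE ->. Qed.

Lemma rhol x : x < pi / 2 -> rho alpha x = 1.
Proof. by rewrite /rho => ->. Qed.

Lemma rhor x : pi / 2 <= x -> rho alpha x = alpha ^+ 2.
Proof. by rewrite /rho leNgt => /negbTE ->. Qed.

Let pi2 : (0 : R) < pi / 2. Proof. by rewrite divr_gt0// pi_gt0. Qed.
Let pi2' : pi / 2 < (pi : R). Proof. by have := pi_gt0 R; lra. Qed.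

Lemma cut_intervalP (x : R) : cut_interval x <-> (0 < x < pi / 2) \/ (pi / 2 < x < pi).
Proof. by rewrite /cut_interval /= !in_itv. Qed.

Lemma measurable_step (u v b : R) (D : set R) : measurable D ->
  measurable_fun D (fun x => if x < b then u else v).
Proof.
move=> mD; apply: measurable_funTS; apply: measurable_fun_ifT => //.
exact: measurable_fun_ltr.
Qed.

Lemma intg_step (c d b u v : R) (f : R -> R) : intg c d f -> intg c d (fun x => f x * (if x < b then u else v)).
Proof.
move=> fi; apply: (intgM_bounded (M := `|u| + `|v|) fi); first exact: measurable_step.
by move=> x _; case: ifP => _; rewrite ?lerDl ?lerDr.
Qed.

Lemma intg_jump2 (c d : R) (f : R -> R) : intg c d f -> intg c d (fun x => f x * jump x ^+ 2).
Proof.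
move=> /(intg_step (pi / 2) 1 (a ^+ 2)); apply: intg_eq => x _.
by rewrite /jump; case: ifP; rewrite // expr1n.
Qed.

Lemma intg_jump2V (c d : R) (f : R -> R) : intg c d f -> intg c d (fun x => f x / jump x ^+ 2).
Proof.
move=> /(intg_step (pi / 2) 1 (a ^+ 2)^-1); apply: intg_eq => x _.
by rewrite /jump; case: ifP; rewrite // expr1n invr1.
Qed.

Lemma intg_rho (c d : R) (f : R -> R) : intg c d f -> intg c d (fun x => f x * rho alpha x).
Proof. by move=> /(intg_step (pi / 2) 1 (alpha ^+ 2)). Qed.

(** Real-valued counterpart of [SL_solution]: for real lam, the real and imaginary parts of a
    solution satisfy it separately. *)
Definition rsol Q lam y : Prop :=
  [/\ forall j x, cut_interval x -> derivable (y j) x 1,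
    forall j, locally_abs_continuous (@cut_interval R) (derive1 (y j)),
    {ae mu, forall x, cut_interval x -> forall j,
      - derive1 (derive1 (y j)) x + \sum_k Q x j k * y k x = lam * rho alpha x * y j x},
    (forall j, exists2 l : R, y j x @[x --> (pi / 2)^'-] --> l & y j x @[x --> (pi / 2)^'+] --> a * l) /\
    (forall j, exists2 l : R, derive1 (y j) x @[x --> (pi / 2)^'-] --> l &
       derive1 (y j) x @[x --> (pi / 2)^'+] --> a^-1 * l) &
    forall j, derive1 (y j) x @[x --> 0^'+] --> (0 : R) /\ derive1 (y j) x @[x --> pi^'-] --> (0 : R)].

(** Each half is extended continuously to its endpoints and rescaled; the transmission conditions
    are exactly what makes the rescaled pieces agree at pi / 2. *)
Lemma rsol_wsol Q q lam y : (forall j k, intg 0 pi (q j k)) ->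
  {ae mu, forall x, 0 < x < pi -> forall j k, q j k x = jump x ^+ 2 * Q x j k} ->
  rsol Q lam y -> exists Z V, [/\ wsol q lam Z V, forall j, V j 0 = 0 /\ V j pi = 0 &
    forall j x, cut_interval x -> y j x = jump x * Z j x].
Proof.
move=> qi qQ [dy ac eqn [jmp jmp'] Neu].
have /choice[L LP] j : exists l : R, y j x @[x --> (pi / 2)^'-] --> l /\ y j x @[x --> (pi / 2)^'+] --> a * l.
  by have [l] := jmp j; exists l.
have /choice[L' LP'] j : exists l : R, derive1 (y j) x @[x --> (pi / 2)^'-] --> l /\
    derive1 (y j) x @[x --> (pi / 2)^'+] --> a^-1 * l.
  by have [l] := jmp' j; exists l.
have acl j (p q' : R) : 0 < p -> q' < pi / 2 -> abs_continuous_on p q' (derive1 (y j)).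
  move=> p0 qp; apply: ac => x; rewrite /= in_itv/= => /andP[px xq].
  by apply/cut_intervalP; left; rewrite (lt_le_trans p0)//= (le_lt_trans xq).
have acr j (p q' : R) : pi / 2 < p -> q' < pi -> abs_continuous_on p q' (derive1 (y j)).
  move=> p0 qp; apply: ac => x; rewrite /= in_itv/= => /andP[px xq].
  by apply/cut_intervalP; right; rewrite (lt_le_trans p0)//= (le_lt_trans xq).
have /choice[ZVl ZVlP] j : exists ZV : (R -> R) * (R -> R), [/\ prim 0 (pi / 2) ZV.1 ZV.2,
    cont_on 0 (pi / 2) ZV.2, ZV.2 0 = 0 /\ ZV.2 (pi / 2) = L' j,
    forall x, 0 < x < pi / 2 -> ZV.2 x = derive1 (y j) x & forall x, 0 < x < pi / 2 -> ZV.1 x = y j x].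
  have [|Z [V H]] := piece_first pi2 _ (acl j) (Neu j).1 (LP' j).1; last by exists (Z, V).
  by move=> x xp; apply: dy; apply/cut_intervalP; left.
have /choice[ZVr ZVrP] j : exists ZV : (R -> R) * (R -> R), [/\ prim (pi / 2) pi ZV.1 ZV.2,
    cont_on (pi / 2) pi ZV.2, ZV.2 (pi / 2) = a^-1 * L' j /\ ZV.2 pi = 0,
    forall x, pi / 2 < x < pi -> ZV.2 x = derive1 (y j) x & forall x, pi / 2 < x < pi -> ZV.1 x = y j x].
  have [|Z [V H]] := piece_first pi2' _ (acr j) (LP' j).2 (Neu j).2; last by exists (Z, V).
  by move=> x xp; apply: dy; apply/cut_intervalP; right.
(* Here pi / 2 belongs to the left piece, while [jump] counts it with the right half. The equalities
   at pi / 2 reconcile the two conventions. *)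
pose Z j x := if x <= pi / 2 then (ZVl j).1 x else a^-1 * (ZVr j).1 x.
pose V j x := if x <= pi / 2 then (ZVl j).2 x else a * (ZVr j).2 x.
have Zpi2 j : (ZVl j).1 (pi / 2) = a^-1 * (ZVr j).1 (pi / 2).
  have [Pl _ _ _ El] := ZVlP j; have [Pr _ _ _ Er] := ZVrP j.
  have hl := at_left_eq pi2 El (cont_on_at_left pi2 (prim_cont Pl)).
  have hr := at_right_eq pi2' Er (cont_on_at_right pi2' (prim_cont Pr)).
  have e1 : (ZVl j).1 (pi / 2) = L j by exact: (cvg_unique _ hl (LP j).1).
  have e2 : (ZVr j).1 (pi / 2) = a * L j by exact: (cvg_unique _ hr (LP j).2).
  rewrite e1 e2 mulrA mulVf ?mul1r//.
  by rewrite gt_eqF.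
have Zl j x : 0 <= x <= pi / 2 -> (ZVl j).1 x = Z j x by move=> /andP[_ h]; rewrite /Z h.
have Vl j x : 0 <= x <= pi / 2 -> (ZVl j).2 x = V j x by move=> /andP[_ h]; rewrite /V h.
have Zr j x : pi / 2 <= x <= pi -> a^-1 * (ZVr j).1 x = Z j x.
  by rewrite /Z; case: ltgtP => //= <- _.
have Vr j x : pi / 2 <= x <= pi -> a * (ZVr j).2 x = V j x.
  rewrite /V; case: ltgtP => //= <- _; have [_ _ [_ ->] _ _] := ZVlP j.
  by have [_ _ [-> _] _ _] := ZVrP j; rewrite mulrA mulfV ?mul1r// gt_eqF.
have Vcl j : cont_on 0 (pi / 2) (V j).
  by have [_ Vc _ _ _] := ZVlP j; apply: cont_on_eq Vc => x /Vl.
have Vcr j : cont_on (pi / 2) pi (V j).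
  have [_ Vc _ _ _] := ZVrP j; have h : cont_on (pi / 2) pi (fun x => a * (ZVr j).2 x).
    by apply: cont_onM Vc; exact: cont_on_cst.
  by apply: cont_on_eq h => x /Vr.
have Zp j : prim 0 pi (Z j) (fun x => V j x / jump x ^+ 2).
  apply: (prim_cat (ltW pi2) (ltW pi2')).
    have [Pl _ _ _ _] := ZVlP j.
    apply: (prim_aer _ _ (prim_eql (Zl j) Pl)).
      exact/intg_jump2V/cont_on_intg.
    apply: aeW (ae_neq 0) => x _ /andP[x0 xp].
    by rewrite jumpl// expr1n divr1 Vl// !ltW.
  have [Pr _ _ _ _] := ZVrP j.
  apply: (prim_eqr _ (prim_eql (Zr j) (primZ a^-1 Pr))) => x xp.
  rewrite -Vr// jumpr; last by case/andP: xp.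
  by field; rewrite gt_eqF.
have Zc j : cont_on 0 pi (Z j) := prim_cont (Zp j).
pose g j x := \sum_k q j k x * Z k x - lam * (jump x ^+ 2 * rho alpha x) * Z j x.
have gi j : intg 0 pi (g j).
  apply: intgB; first by apply: intg_sum => k _; exact: intgM_cont.
  have := intgZ lam (intg_rho (intg_jump2 (cont_on_intg (Zc j)))).
  by apply: intg_eq => x _; ring.
have yZ j x : cut_interval x -> y j x = jump x * Z j x.
  move=> /cut_intervalP[/andP[h1 h2]|/andP[h1 h2]].
    have [_ _ _ _ El] := ZVlP j; rewrite -El ?h1// jumpl// mul1r Zl// !ltW//.
  have [_ _ _ _ Er] := ZVrP j; rewrite -Er ?h1// jumpr ?ltW// -Zr ?ltW//.
  by rewrite mulrA mulfV ?mul1r// gt_eqF.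
have eqng j : {ae mu, forall x, cut_interval x -> derive1 (derive1 (y j)) x = g j x / jump x}.
  apply: aeW2 eqn qQ => x H1 H2 xc.
  have x0pi : 0 < x < pi.
    by move/cut_intervalP : xc => [] /andP[h1 h2]; apply/andP; split; have := pi2'; have := pi2; lra.
  have := H1 xc j; rewrite yZ//.
  have jn : jump x != 0 by rewrite gt_eqF// jump_gt0.
  have -> : \sum_k Q x j k * y k x = (\sum_k q j k x * Z k x) / jump x.
    rewrite mulr_suml; apply: eq_bigr => k _; rewrite yZ// H2//.
    by field.
  move=> /eqP; rewrite addrC subr_eq => /eqP e; rewrite /g.
  have -> : derive1 (derive1 (y j)) x = (\sum_k q j k x * Z k x) / jump x - lam * rho alpha x * (jump x * Z j x).
    by rewrite e; ring.
  by field.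
exists Z, V; split => //.
- move=> j; split => //; apply: (prim_cat (ltW pi2) (ltW pi2')).
    have [_ Vc _ El _] := ZVlP j.
    apply: (prim_eql (Vl j)).
    apply: (piece_second pi2 Vc (intg_sub (lexx 0) (ltW pi2') (gi j)) El (acl j)).
    apply: aeW (eqng j) => x H /[dup] xp /andP[h1 h2].
    by rewrite H; [rewrite jumpl// divr1|apply/cut_intervalP; left].
  have [_ Vc _ Er _] := ZVrP j.
  have gai : intg (pi / 2) pi (fun x => a^-1 * g j x).
    by apply: intgZ; exact: intg_sub (ltW pi2) (lexx pi) (gi j).
  apply: (prim_eqr _ (prim_eql (Vr j) (primZ a (piece_second pi2' Vc gai Er (acr j) _)))).
    by move=> x _; rewrite -/(g j x) mulrA mulfV ?mul1r// gt_eqF.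
  apply: aeW (eqng j) => x H /[dup] xp /andP[h1 h2].
  by rewrite H; [rewrite jumpr ?ltW// mulrC|apply/cut_intervalP; right].
- move=> j; split; first by rewrite -Vl ?lexx ?ltW//; have [_ _ [-> _] _ _] := ZVlP j.
  by rewrite -Vr ?lexx ?ltW//; have [_ _ [_ ->] _ _] := ZVrP j; rewrite mulr0.
Qed.
End SL_real.

(** * Complex solutions, their parts, and square integrability *)

Section complex_parts.
Variable R : rcfType.
Implicit Types (z u : R[i]) (x : R).

Lemma cReD z u : complex.Re (z + u) = complex.Re z + complex.Re u.
Proof. by case: z => ? ?; case: u. Qed.
Lemma cImD z u : complex.Im (z + u) = complex.Im z + complex.Im u.
Proof. by case: z => ? ?; case: u. Qed.
Lemma cReM z u : complex.Re (z * u) = complex.Re z * complex.Re u - complex.Im z * complex.Im u.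
Proof. by case: z => ? ?; case: u. Qed.
Lemma cImM z u : complex.Im (z * u) = complex.Re z * complex.Im u + complex.Im z * complex.Re u.
Proof. by case: z => ? ?; case: u. Qed.
Lemma cRe_sum (I : Type) (s : seq I) (F : I -> R[i]) :
  complex.Re (\sum_(i <- s) F i) = \sum_(i <- s) complex.Re (F i).
Proof. by elim: s => [|i s IH]; rewrite ?big_nil// !big_cons cReD IH. Qed.
Lemma cIm_sum (I : Type) (s : seq I) (F : I -> R[i]) :
  complex.Im (\sum_(i <- s) F i) = \sum_(i <- s) complex.Im (F i).
Proof. by elim: s => [|i s IH]; rewrite ?big_nil// !big_cons cImD IH. Qed.
Lemma complex_eq z u : complex.Re z = complex.Re u -> complex.Im z = complex.Im u -> z = u.
Proof. by case: z => ? ?; case: u => ? ? /= -> ->. Qed.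
End complex_parts.

Section L2.
Variable R : realType.
Local Notation mu := (@lebesgue_measure R).
Implicit Types f g : R -> R.

Lemma L2_bounded_ae f g (M : R) : measurable_fun `[0, pi] g ->
  (forall x, 0 <= x <= pi -> `|g x| <= M) ->
  {ae mu, forall x, 0 < x < pi -> f x = g x} -> L2_0pi f.
Proof.
move=> mg gM fg; exists (g \_ `[0, pi]); last first.
  apply: aeW fg => x H; rewrite /= in_itv/= => /[dup] x0 /andP[h1 h2].
  by rewrite H// patchE mem_set//= in_itv/= !ltW.
have mh : measurable_fun setT (g \_ `[0, pi]) by apply/(measurable_restrictT _ _).1.
have gi : intg 0 pi (fun x => g x ^+ 2).
  have := intgM_bounded (intgM_bounded (intg_cst 0 pi 1) mg gM) mg gM.
  by apply: intg_eq => x _; rewrite mul1r.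
rewrite inE; apply/andP; split; rewrite inE//=.
rewrite /finite_norm unlock poweR_lty//=.
have hi : mu.-integrable setT (EFin \o ((fun x => g x ^+ 2) \_ `[0, pi])).
  by rewrite -restrict_EFin; apply/integrable_restrict => //; rewrite setTI.
move/integrableP : hi => [_]; apply: le_lt_trans.
rewrite le_eqVlt; apply/orP; left; apply/eqP; apply: eq_integral => x _ /=.
rewrite !patchE; case: ifP => _.
  by rewrite powR_mulrn// normrX.
by rewrite !normr0 powR_mulrn// expr0n.
Qed.

Lemma L2_0piE f : L2_0pi f -> exists g, [/\ intg 0 pi g, intg 0 pi (fun x => g x ^+ 2) &
  {ae mu, forall x, 0 < x < pi -> f x = g x}].
Proof.
move=> [g gL fg]; exists g.
have {}fg : {ae mu, forall x, `]0, pi[%classic x -> f x = g x} := fg.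
have g2 : intg 0 pi (fun x => g x ^+ 2).
  by have := Lfun2_integrable_sqr gL; apply: integrableS.
have mg : measurable_fun setT g by move: gL; rewrite inE => /andP[]; rewrite inE.
have H x : (`]0, pi[%classic x -> f x = g x) -> 0 < x < pi -> f x = g x.
  by move=> h xp; apply: h; rewrite /= in_itv.
have ae : {ae mu, forall x, 0 < x < pi -> f x = g x} by apply: aeW fg => x; exact: H.
split => //.
(* Since |g| <= 1 + g^2, a square integrable function on a bounded interval is integrable. *)
have h : intg 0 pi (fun x => 1 + g x ^+ 2) by apply: intgD => //; exact: intg_cst.
apply: le_integrable h => //.
  by apply/measurable_EFinP; exact: measurable_funTS.
move=> x _ /=; rewrite lee_fin [leRHS]ger0_norm; last by rewrite addr_ge0 ?sqr_ge0.
by rewrite ler_norml; apply/andP; split; nra.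
Qed.
End L2.

Section local_pieces.
Variable R : realType.
Implicit Types (c d x : R) (F G f : R -> R).

Lemma is_derive_eq_itv c d F G x l : (forall z, c < z < d -> F z = G z) -> c < x < d ->
  is_derive x 1 F l -> is_derive x 1 G l.
Proof.
move=> FG xcd; apply: near_eq_is_derive; near=> z; apply: FG.
have : z \in `]c, d[ by near: z; apply: near_in_itvoo; rewrite in_itv.
by rewrite in_itv.
Unshelve. all: by end_near. Qed.

Lemma prim_cont_is_derive c d F f x : prim c d F f -> cont_on c d f -> c < x < d ->
  is_derive x 1 F (f x).
Proof.
move=> Ff fc /[dup] xcd /andP[cx xd].
have [|dF F'] := continuous_FTC1 xd (prim_intg Ff) _ (cont_on_for fc xcd).
  by rewrite lte_fin.
apply: (is_derive_eq_itv (F := fun y => F c + Int c y f) _ xcd).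
  by move=> z /andP[cz zd]; rewrite (primE (x := z) Ff)// !ltW.
rewrite -F' derive1E -[X in is_derive _ _ _ X]add0r.
by apply: is_deriveD; exact: DeriveDef.
Qed.

Lemma AC_eq c d F G : (forall x, c <= x <= d -> F x = G x) ->
  abs_continuous_on c d F -> abs_continuous_on c d G.
Proof.
move=> FG Fa e e0; have [dl d0 H] := Fa e e0; exists dl => // s sI sN sd.
apply: le_lt_trans (H s sI sN sd); rewrite big_seq [leRHS]big_seq.
apply: ler_sum => p ps; have /allP/(_ _ ps)/and3P[h1 h2 h3] := sI.
by rewrite !FG// ?h1 ?h3 ?(le_trans h2) ?(le_trans h1).
Qed.

Lemma AC_empty c d F : d < c -> abs_continuous_on c d F.
Proof.
move=> dc e e0; exists 1 => // -[|p s] /=; first by rewrite !big_nil.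
move=> /andP[/and3P[h1 h2 h3] _]; have := le_lt_trans (le_trans h1 (le_trans h2 h3)) dc.
by rewrite ltxx.
Qed.
End local_pieces.

Section SL_complex.
Variables (R : realType) (N : nat) (alpha a : R).
Hypotheses (alpha0 : 0 < alpha) (a0 : 0 < a).
Local Notation mu := (@lebesgue_measure R).
Implicit Types (Q : R -> 'M[R]_N) (q : 'I_N -> 'I_N -> R -> R) (lam : R).
Implicit Types (Z V : 'I_N -> R -> R) (Y : R -> 'cV[R[i]]_N).

Let pi2 : (0 : R) < pi / 2. Proof. by rewrite divr_gt0// pi_gt0. Qed.
Let pi2' : pi / 2 < (pi : R). Proof. by have := pi_gt0 R; lra. Qed.

Let ReE Y j : (fun t => complex.Re (vderive Y t j 0)) = derive1 (fun t => complex.Re (Y t j 0)).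
Proof. by apply/funext => t; rewrite /vderive mxE. Qed.
Let ImE Y j : (fun t => complex.Im (vderive Y t j 0)) = derive1 (fun t => complex.Im (Y t j 0)).
Proof. by apply/funext => t; rewrite /vderive mxE. Qed.

Let SL_exprE Q Y x j : SL_expr Q Y x j 0 =
  ((- derive1 (derive1 (fun t => complex.Re (Y t j 0))) x + \sum_k Q x j k * complex.Re (Y x k 0)) +i*
   (- derive1 (derive1 (fun t => complex.Im (Y t j 0))) x + \sum_k Q x j k * complex.Im (Y x k 0)))%C.
Proof.
rewrite /SL_expr !mxE ReE ImE; apply: complex_eq; rewrite ?cReD ?cImD ?cRe_sum ?cIm_sum/=.
  by congr (_ + _); apply: eq_bigr => k _; rewrite mxE cReM/= mul0r subr0.
by congr (_ + _); apply: eq_bigr => k _; rewrite mxE cImM/= mul0r addr0.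
Qed.

Lemma SL_solution_rsol Q lam Y : SL_solution alpha a Q (lam%:C)%C Y ->
  rsol alpha a Q lam (fun j x => complex.Re (Y x j 0)) /\
  rsol alpha a Q lam (fun j x => complex.Im (Y x j 0)).
Proof.
case=> _ dY acY _ eqn [l l1 l2] [l' l1' l2'] N0 Npi.
have eqn' : {ae mu, forall x, cut_interval x -> forall j,
    SL_expr Q Y x j 0 = (lam * rho alpha x)%:C%C * Y x j 0}.
  by apply: aeW eqn => x H xc j; rewrite H// mxE -rmorphM.
split; split.
- by move=> j; have [] := dY j.
- by move=> j; have [] := acY j; rewrite ReE.
- apply: aeW eqn' => x H xc j; have := congr1 (@complex.Re R) (H xc j).
  by rewrite SL_exprE cReM/= mul0r subr0.
- split=> j.
    exists (complex.Re (l j 0)); first by have [] := l1 j.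
    by have [+ _] := l2 j; rewrite mxE cReM/= mul0r subr0.
  exists (complex.Re (l' j 0)); first by have [] := l1' j; rewrite ReE.
  by have [+ _] := l2' j; rewrite mxE cReM/= mul0r subr0 ReE.
- move=> j; split; first by have [+ _] := N0 j; rewrite mxE ReE.
  by have [+ _] := Npi j; rewrite mxE ReE.
- by move=> j; have [] := dY j.
- by move=> j; have [] := acY j; rewrite ImE.
- apply: aeW eqn' => x H xc j; have := congr1 (@complex.Im R) (H xc j).
  by rewrite SL_exprE cImM/= mul0r addr0.
- split=> j.
    exists (complex.Im (l j 0)); first by have [] := l1 j.
    by have [_ +] := l2 j; rewrite mxE cImM/= mul0r addr0.
  exists (complex.Im (l' j 0)); first by have [] := l1' j; rewrite ImE.
  by have [_ +] := l2' j; rewrite mxE cImM/= mul0r addr0 ImE.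
- move=> j; split; first by have [_ +] := N0 j; rewrite mxE ImE.
  by have [_ +] := Npi j; rewrite mxE ImE.
Qed.

Definition embed Z (x : R) : 'cV[R[i]]_N := \col_j ((jump a x * Z j x)%:C)%C.

(** Converse of the reduction. The L2 conditions follow from boundedness; for the differential
    expression the equation is used first, replacing it almost everywhere by lam rho [jump] Z. *)
Lemma wsol_SL_solution Q q lam Z V : (forall j k, intg 0 pi (q j k)) ->
  {ae mu, forall x, 0 < x < pi -> forall j k, q j k x = jump a x ^+ 2 * Q x j k} ->
  wsol alpha a q lam Z V -> (forall j, V j 0 = 0 /\ V j pi = 0) ->
  SL_solution alpha a Q (lam%:C)%C (embed Z).
Proof.
move=> qi qQ ws V0.
have Zp j := (ws j).1; have Vp j := (ws j).2.
have Zc j : cont_on 0 pi (Z j) := prim_cont (Zp j).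
have Vc j : cont_on 0 pi (V j) := prim_cont (Vp j).
have jn x : jump a x != 0 by rewrite gt_eqF// jump_gt0.
have ReY j : (fun x => complex.Re (embed Z x j 0)) = (fun x => jump a x * Z j x).
  by apply/funext => x; rewrite mxE.
have ImY j : (fun x => complex.Im (embed Z x j 0)) = (fun=> 0).
  by apply/funext => x; rewrite mxE.
have dcst : derive1 (fun _ : R => 0 : R) = fun=> 0.
  by apply/funext => x; rewrite derive1E derive_cst.
have cutP (x : R) : cut_interval x -> 0 < x < pi.
  by move/cut_intervalP => [] /andP[h1 h2]; apply/andP; split; have := pi2'; have := pi2; lra.
have piece x : cut_interval x -> exists c d, [/\ c < x < d, 0 <= c, d <= pi &
    forall t, c < t < d -> cut_interval t /\ jump a t = jump a x].
  move=> /cut_intervalP[] /[dup] xx /andP[h1 h2].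
    exists 0, (pi / 2); split => //; first exact: ltW.
    move=> t /[dup] tt /andP[_ t2]; split; first by apply/cut_intervalP; left.
    by rewrite !jumpl.
  exists (pi / 2), pi; split => //; first exact: ltW.
  move=> t /[dup] tt /andP[t1 _]; split; first by apply/cut_intervalP; right.
  by rewrite !jumpr// ltW.
have dZ j x : cut_interval x -> is_derive x 1 (fun t => jump a t * Z j t) (V j x / jump a x).
  move=> /piece[c [d [/[dup] xcd /andP[cx xd] c0 dp H]]].
  have cd := lt_trans cx xd.
  have Vcd : cont_on c d (fun t => V j t / jump a x ^+ 2).
    by apply: cont_onM; [exact: cont_on_sub c0 dp (Vc j)|exact: cont_on_cst].
  have Zcd : prim c d (Z j) (fun t => V j t / jump a x ^+ 2).
    apply: (prim_aer _ _ (prim_sub c0 (ltW cd) dp (Zp j))); first exact: cont_on_intg.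
    by apply: aeW (ae_neq 0) => t _ /H[_ ->].
  apply: (is_derive_eq_itv (F := fun t => jump a x * Z j t) _ xcd).
    by move=> z /H[_ ->].
  have D := prim_cont_is_derive Zcd Vcd xcd.
  have -> : V j x / jump a x = jump a x * (V j x / jump a x ^+ 2) by field.
  exact: is_deriveZ.
have dY j x : cut_interval x -> derive1 (fun t => jump a t * Z j t) x = V j x / jump a x.
  by move=> xc; rewrite derive1E; have := dZ j x xc => D; rewrite derive_val.
have ReY' j : (fun x => complex.Re (vderive (embed Z) x j 0)) = derive1 (fun x => jump a x * Z j x).
  by rewrite ReE ReY.
have ImY' j : (fun x => complex.Im (vderive (embed Z) x j 0)) = fun=> 0.
  by rewrite ImE ImY dcst.
have ddY : {ae mu, forall x, forall j, cut_interval x ->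
   derive1 (derive1 (fun t => jump a t * Z j t)) x =
   (\sum_k q j k x * Z k x - lam * (jump a x ^+ 2 * rho alpha x) * Z j x) / jump a x}.
  apply: ae_forall_fin => j; apply: aeW (prim_is_derive (Vp j)) => x D xc.
  have {}D := D (cutP x xc).
  have [c [d [xcd c0 dp H]]] := piece x xc.
  suff D2 : is_derive x 1 (derive1 (fun t => jump a t * Z j t))
    ((\sum_k q j k x * Z k x - lam * (jump a x ^+ 2 * rho alpha x) * Z j x) / jump a x).
    by rewrite derive1E derive_val.
  apply: (is_derive_eq_itv (F := fun t => (jump a x)^-1 * V j t) _ xcd).
    by move=> z /H[zc jz]; rewrite dY// jz mulrC.
  by rewrite [X in is_derive _ _ _ X]mulrC; exact: is_deriveZ.
have expr_ae : {ae mu, forall x, cut_interval x -> forall j,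
    SL_expr Q (embed Z) x j 0 = (lam * rho alpha x * (jump a x * Z j x))%:C%C}.
  apply: aeW2 ddY qQ => x H1 H2 xc j; rewrite SL_exprE ReY ImY !dcst H1//.
  have {}H2 := H2 (cutP x xc).
  have -> : \sum_k Q x j k * complex.Re (embed Z x k 0) = (\sum_k q j k x * Z k x) / jump a x.
    by rewrite mulr_suml; apply: eq_bigr => k _; rewrite H2 mxE /=; field.
  have -> : - 0 + \sum_k Q x j k * complex.Im (embed Z x k 0) = 0.
    by rewrite oppr0 add0r big1// => k _; rewrite mxE /= mulr0.
  by congr (_ +i* _)%C; field.
have step_meas (u v : R) : measurable_fun `[0, pi] (fun x : R => if x < pi / 2 then u else v).
  exact: measurable_step.
have jm : measurable_fun `[0, pi] (jump a) by exact: measurable_step.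
have rm : measurable_fun `[0, pi] (rho alpha) by exact: measurable_step.
have Zm j : measurable_fun `[0, pi] (Z j) by exact: cont_on_measurable.
have jb x : `|jump a x| <= 1 + a.
  rewrite ger0_norm; last exact/ltW/jump_gt0.
  by rewrite /jump; case: ifP => _; move: a0; lra.
have rb x : `|rho alpha x| <= 1 + alpha ^+ 2.
  by rewrite /rho; case: ifP => _; rewrite ger0_norm ?lerDl ?lerDr ?sqr_ge0.
have L20 : L2_0pi (fun _ : R => 0 : R).
  apply: (@L2_bounded_ae _ _ (fun=> 0) 0) => //; first by move=> x _; rewrite normr0.
  by apply: aeW (ae_neq 0).
have ImEx j : L2_0pi (fun x => complex.Im (SL_expr Q (embed Z) x j 0)).
  apply: (@L2_bounded_ae _ _ (fun=> 0) 0) => //; first by move=> x _; rewrite normr0.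
  apply: aeW2 expr_ae (ae_neq (pi / 2)) => x H xn /andP[h1 h2]; rewrite H//.
  apply/cut_intervalP; case: (ltgtP x (pi / 2)) => h; [left|right|by rewrite h eqxx in xn].
    by rewrite h1.
  by rewrite h2.
have ReEx j : L2_0pi (fun x => complex.Re (SL_expr Q (embed Z) x j 0)).
  have [M M0 ZM] := cont_on_bounded (Zc j).
  apply: (@L2_bounded_ae _ _ (fun x => lam * rho alpha x * (jump a x * Z j x))
    (`|lam| * (1 + alpha ^+ 2) * ((1 + a) * M))).
  - by apply: measurable_funM; [apply: measurable_funM|apply: measurable_funM].
  - move=> x xp; rewrite !normrM; apply: ler_pM; rewrite ?mulr_ge0//.
      by rewrite ler_wpM2l.
    by apply: ler_pM; rewrite ?jb ?ZM.
  apply: aeW2 expr_ae (ae_neq (pi / 2)) => x H xn /andP[h1 h2]; rewrite H//.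
  apply/cut_intervalP; case: (ltgtP x (pi / 2)) => h; [left|right|by rewrite h eqxx in xn].
    by rewrite h1.
  by rewrite h2.
have Zl j : jump a x * Z j x @[x --> (pi / 2)^'-] --> Z j (pi / 2).
  apply: (at_left_eq pi2 _ (cont_on_at_left pi2 (cont_on_sub (lexx 0) (ltW pi2') (Zc j)))).
  by move=> x /andP[_ xp]; rewrite jumpl// mul1r.
have Zr j : jump a x * Z j x @[x --> (pi / 2)^'+] --> a * Z j (pi / 2).
  have aZ : cont_on (pi / 2) pi (fun x => a * Z j x).
    apply: cont_onM; first exact: cont_on_cst.
    exact: cont_on_sub (ltW pi2) (lexx _) (Zc j).
  apply: (at_right_eq pi2' _ (cont_on_at_right pi2' aZ)).
  by move=> x /andP[xp _]; rewrite jumpr// ltW.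
have dl x : 0 < x < pi / 2 -> cut_interval x by move=> xp; apply/cut_intervalP; left.
have dr x : pi / 2 < x < pi -> cut_interval x by move=> xp; apply/cut_intervalP; right.
have Vcl j : cont_on 0 (pi / 2) (V j) by exact: cont_on_sub (lexx 0) (ltW pi2') (Vc j).
have Vcr j : cont_on (pi / 2) pi (fun x => a^-1 * V j x).
  apply: cont_onM; first exact: cont_on_cst.
  exact: cont_on_sub (ltW pi2) (lexx _) (Vc j).
have dYl j x : 0 < x < pi / 2 -> V j x = derive1 (fun t => jump a t * Z j t) x.
  by move=> /[dup] xp /andP[_ x2]; rewrite dY ?jumpl ?divr1//; exact: dl.
have dYr j x : pi / 2 < x < pi -> a^-1 * V j x = derive1 (fun t => jump a t * Z j t) x.
  by move=> /[dup] xp /andP[x1 _]; rewrite dY ?jumpr ?(ltW x1) 1?mulrC//; exact: dr.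
split.
- move=> j; rewrite ReY ImY; split => //; have [M M0 ZM] := cont_on_bounded (Zc j).
  apply: (@L2_bounded_ae _ _ (fun x => jump a x * Z j x) ((1 + a) * M)).
  + exact: measurable_funM.
  + by move=> x xp; rewrite normrM; apply: ler_pM; rewrite ?jb ?ZM.
  + by apply: aeW (ae_neq 0).
- move=> j; rewrite ReY ImY; split => x xc; first by have D := dZ j x xc; apply: ex_derive.
  exact: derivable_cst.
- move=> j; rewrite ReY' ImY'; split => c d cdcut.
    have [cd|dc] := leP c d; last exact: AC_empty.
    have jc t : c <= t <= d -> jump a t = jump a c.
      have cc : cut_interval c by apply: cdcut; rewrite /= in_itv/= lexx.
      move=> /andP[ct td]; have [c2|c2] := ltP c (pi / 2); last by rewrite !jumpr// (le_trans c2).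
      have [t2|t2] := ltP t (pi / 2); first by rewrite !jumpl.
      have : cut_interval (pi / 2 : R) by apply: cdcut; rewrite /= in_itv/= ltW//= (le_trans t2).
      by move/cut_intervalP => []; rewrite ltxx ?andbF.
    have cc t : c <= t <= d -> cut_interval t by move=> tt; apply: cdcut; rewrite /= in_itv.
    have /andP[/ltW c0 _] : 0 < c < pi by apply/cutP/cc; rewrite lexx.
    have /andP[_ /ltW dp] : 0 < d < pi by apply/cutP/cc; rewrite lexx cd.
    apply: (@AC_eq _ _ _ (fun t => (jump a c)^-1 * V j t)).
      by move=> t tt; rewrite (dY j t (cc t tt)) (jc t tt) mulrC.
    apply: AC_mul; first exact: prim_AC (prim_cst _ cd).
    exact: AC_sub c0 dp (prim_AC (Vp j)).
  have [cd|dc] := leP c d; last exact: AC_empty.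
  exact: prim_AC (prim_cst _ cd).
- by move=> j; split.
- apply: aeW expr_ae => x H xc; apply/matrixP => j k; rewrite ord1 H// !mxE.
  by rewrite !rmorphM.
- exists (\col_j (Z j (pi / 2))%:C%C) => j.
    by rewrite ReY ImY mxE; split => //; exact: cvg_cst.
  by rewrite ReY ImY !mxE cReM cImM/= !mul0r subr0 addr0 mulr0; split => //; exact: cvg_cst.
- exists (\col_j (V j (pi / 2))%:C%C) => j; rewrite ReY' ImY'.
    rewrite mxE; split; last exact: cvg_cst.
    exact: (at_left_eq pi2 (dYl j) (cont_on_at_left pi2 (Vcl j))).
  rewrite !mxE cReM cImM/= !mul0r subr0 addr0 mulr0; split; last exact: cvg_cst.
  exact: (at_right_eq pi2' (dYr j) (cont_on_at_right pi2' (Vcr j))).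
- move=> j; rewrite ReY' ImY' mxE; split; last exact: cvg_cst.
  by have := at_right_eq pi2 (dYl j) (cont_on_at_right pi2 (Vcl j)); rewrite (V0 j).1.
- move=> j; rewrite ReY' ImY' mxE; split; last exact: cvg_cst.
  have := at_left_eq pi2' (dYr j) (cont_on_at_left pi2' (Vcr j)).
  by rewrite (V0 j).2 mulr0.
Qed.
End SL_complex.

(** * Inhomogeneous first order systems and initial data *)

Section weak_solutions.
Variables (R : realType) (N : nat) (alpha a : R).
Hypotheses (a0 : 0 < a).
Local Notation mu := (@lebesgue_measure R).
Implicit Types (q : 'I_N -> 'I_N -> R -> R) (lam : R).
Implicit Types (Z V g : 'I_N -> R -> R).

(** The source [g] is there for the resolvent, which later controls the quadratic form. *)
Definition wsolf q lam g Z V : Prop := forall j,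
  prim 0 pi (Z j) (fun x => V j x / jump a x ^+ 2) /\
  prim 0 pi (V j) (fun x => \sum_k q j k x * Z k x
    - lam * (jump a x ^+ 2 * rho alpha x) * Z j x + g j x).

Lemma wsolf0 q lam Z V : wsolf q lam (fun _ _ => 0) Z V <-> wsol alpha a q lam Z V.
Proof.
by split=> H j; have [H1 H2] := H j; split => //; apply: prim_eqr H2 => x _; rewrite addr0.
Qed.

Lemma intg_weight : intg 0 pi (fun x : R => jump a x ^+ 2 * rho alpha x).
Proof.
have := intg_rho alpha (intg_jump2 a (intg_cst 0 pi 1)).
by apply: intg_eq => x _; rewrite mul1r.
Qed.

Lemma wsolfD q lam g g' Z V Z' V' : wsolf q lam g Z V -> wsolf q lam g' Z' V' ->
  wsolf q lam (fun j x => g j x + g' j x) (fun j x => Z j x + Z' j x) (fun j x => V j x + V' j x).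
Proof.
move=> H H' j; have [H1 H2] := H j; have [H1' H2'] := H' j; split.
  by apply: prim_eqr (primD H1 H1') => x _; rewrite mulrDl.
apply: prim_eqr (primD H2 H2') => x _.
rewrite [\sum_k _ * (_ + _)](_ : _ = \sum_k q j k x * Z k x + \sum_k q j k x * Z' k x); last first.
  by rewrite -big_split; apply: eq_bigr => k _; rewrite mulrDr.
ring.
Qed.

Lemma wsolfZ q lam g Z V c : wsolf q lam g Z V ->
  wsolf q lam (fun j x => c * g j x) (fun j x => c * Z j x) (fun j x => c * V j x).
Proof.
move=> H j; have [H1 H2] := H j; split.
  by apply: prim_eqr (primZ c H1) => x _; rewrite mulrA.
apply: prim_eqr (primZ c H2) => x _.
rewrite [\sum_k _ * (_ * _)](_ : _ = c * \sum_k q j k x * Z k x); last first.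
  by rewrite mulr_sumr; apply: eq_bigr => k _; rewrite mulrCA.
ring.
Qed.

Lemma wsolD q lam Z V Z' V' : wsol alpha a q lam Z V -> wsol alpha a q lam Z' V' ->
  wsol alpha a q lam (fun j x => Z j x + Z' j x) (fun j x => V j x + V' j x).
Proof.
move=> /wsolf0 H /wsolf0 H'; apply/wsolf0 => j; have [H1 H2] := wsolfD H H' j.
by split => //; apply: prim_eqr H2 => x _; rewrite addr0.
Qed.

Lemma wsolZ q lam Z V c : wsol alpha a q lam Z V ->
  wsol alpha a q lam (fun j x => c * Z j x) (fun j x => c * V j x).
Proof.
move=> /wsolf0 H; apply/wsolf0 => j; have [H1 H2] := wsolfZ c H j.
by split => //; apply: prim_eqr H2 => x _; rewrite mulr0.
Qed.

Lemma wsol_sum (T : Type) (s : seq T) (c : T -> R) q lam (Z V : T -> 'I_N -> R -> R) :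
  (forall t, wsol alpha a q lam (Z t) (V t)) ->
  wsol alpha a q lam (fun j x => \sum_(t <- s) c t * Z t j x)
    (fun j x => \sum_(t <- s) c t * V t j x).
Proof.
move=> H; elim: s => [|t s IH].
  have c0 : prim 0 pi (fun=> 0 : R) (fun=> 0) by apply: prim_cst; exact: pi_ge0.
  move=> j; split.
    apply: (prim_eql (F := fun=> 0)); first by move=> x _; rewrite big_nil.
    by apply: prim_eqr c0 => x _; rewrite big_nil mul0r.
  apply: (prim_eql (F := fun=> 0)); first by move=> x _; rewrite big_nil.
  apply: prim_eqr c0 => x _; rewrite big_nil mulr0 subr0 big1// => k _.
  by rewrite big_nil mulr0.
have := wsolD (wsolZ (c t) (H t)) IH; congr (wsol _ _ _ _ _ _);
  by apply/funext => j; apply/funext => x; rewrite big_cons.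
Qed.

(** Coefficient matrix of the system for (Z, V); [inl] indexes the components of Z and [inr] those
    of V. *)
Let A q lam (i i' : 'I_N + 'I_N) (x : R) : R :=
  match i, i' with
  | inl j, inr k => if j == k then 1 / jump a x ^+ 2 else 0
  | inr j, inl k => q j k x - (if j == k then lam * (jump a x ^+ 2 * rho alpha x) else 0)
  | _, _ => 0
  end.

Let A_intg q lam : (forall j k, intg 0 pi (q j k)) -> forall i i', intg 0 pi (A q lam i i').
Proof.
move=> qi [j|j] [k|k] /=; try exact: intg_cst.
  apply: intg_eq (intg_jump2V a (intg_cst 0 pi (j == k)%:R)) => x _.
  by rewrite /A; case: (j == k) => /=; rewrite ?mul0r.
by apply: intgB => //; case: (j == k); [exact/intgZ/intg_weight|exact: intg_cst].
Qed.

Let ffun2 g (i : 'I_N + 'I_N) : R -> R := match i with inl _ => fun=> 0 | inr j => g j end.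
Let UZV Z V (i : 'I_N + 'I_N) : R -> R := match i with inl j => Z j | inr j => V j end.

Let wsolf_lin q lam g Z V : wsolf q lam g Z V <-> lin_sol 0 pi (A q lam) (ffun2 g) (UZV Z V).
Proof.
have El j x : \sum_i A q lam (inl j) i x * UZV Z V i x + ffun2 g (inl j) x = V j x / jump a x ^+ 2.
  rewrite big_sumType/= big1 ?add0r ?addr0; last by move=> k _; rewrite mul0r.
  rewrite (bigD1 j)//= eqxx big1 ?addr0; first by rewrite mul1r mulrC.
  by move=> k /negbTE; rewrite eq_sym => ->; rewrite mul0r.
have Er j x : \sum_i A q lam (inr j) i x * UZV Z V i x + ffun2 g (inr j) x =
    \sum_k q j k x * Z k x - lam * (jump a x ^+ 2 * rho alpha x) * Z j x + g j x.
  rewrite big_sumType/= [X in _ + X + g j x = _]big1 ?addr0; last by move=> k _; rewrite mul0r.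
  congr (_ + _); under eq_bigr do rewrite mulrBl.
  rewrite sumrB; congr (_ - _); rewrite (bigD1 j)//= eqxx big1 ?addr0//.
  by move=> k /negbTE; rewrite eq_sym => ->; rewrite mul0r.
split=> [H [j|j]|H j].
- by apply: prim_eqr (H j).1 => x _; rewrite El.
- by apply: prim_eqr (H j).2 => x _; rewrite Er.
- by split; [apply: prim_eqr (H (inl j)) => x _; rewrite El|apply: prim_eqr (H (inr j)) => x _; rewrite Er].
Qed.

Lemma wsolf_exists q lam g (z0 v0 : 'I_N -> R) : (forall j k, intg 0 pi (q j k)) ->
  (forall j, intg 0 pi (g j)) ->
  exists Z V, wsolf q lam g Z V /\ forall j, Z j 0 = z0 j /\ V j 0 = v0 j.
Proof.
move=> qi gi; have fi i : intg 0 pi (ffun2 g i) by case: i => j //=; exact: intg_cst.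
have [U Us U0] := lin_sol_exists (pi_ge0 R)
  (fun i => match i with inl j => z0 j | inr j => v0 j end) (A_intg lam qi) fi.
exists (fun j => U (inl j)), (fun j => U (inr j)); split.
  apply/wsolf_lin => i; apply: prim_eqr (prim_eql _ (Us i)) => x _; last by case: i.
  by congr (_ + _); apply: eq_bigr => -[].
by move=> j; rewrite !U0.
Qed.

Lemma wsolf_bound q lam : (forall j k, intg 0 pi (q j k)) ->
  exists2 C, 0 <= C & forall g Z V, (forall j, intg 0 pi (g j)) -> wsolf q lam g Z V ->
  forall x j, 0 <= x <= pi ->
    `|Z j x| <= C * (\sum_i (`|Z i 0| + `|V i 0|) + Int 0 pi (fun t => \sum_i `|g i t|)) /\
    `|V j x| <= C * (\sum_i (`|Z i 0| + `|V i 0|) + Int 0 pi (fun t => \sum_i `|g i t|)).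
Proof.
move=> qi; pose C := expR (Int 0 pi (fun t => \sum_i \sum_j `|A q lam i j t|)).
exists C; first exact: expR_ge0.
move=> g Z V gi /wsolf_lin H x j xp.
have fi i : intg 0 pi (ffun2 g i) by case: i => k //=; exact: intg_cst.
have := lin_sol_bound (pi_ge0 R) (A_intg lam qi) fi H xp.
rewrite -/C mulrC !big_sumType/= big_split/=.
have -> : Int 0 pi (fun t => \sum_i `|ffun2 g i t|) = Int 0 pi (fun t => \sum_i `|g i t|).
  apply: eq_Int => t _; rewrite big_sumType/= big1 ?add0r// => i _.
  by rewrite normr0.
move=> B; split; apply: le_trans _ B.
  by rewrite (bigD1 j)//= -addrA lerDl addr_ge0// sumr_ge0.
by rewrite addrC (bigD1 j)//= -addrA lerDl addr_ge0// sumr_ge0.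
Qed.

Lemma wsol_unique q lam Z V : (forall j k, intg 0 pi (q j k)) -> wsol alpha a q lam Z V ->
  (forall j, Z j 0 = 0 /\ V j 0 = 0) ->
  forall x j, 0 <= x <= pi -> Z j x = 0 /\ V j x = 0.
Proof.
move=> qi /wsolf0 H H0 x j xp; have [C C0 B] := wsolf_bound lam qi.
have := B _ _ _ (fun j => intg_cst 0 pi 0) H x j xp.
rewrite big1; last by move=> i _; rewrite (H0 i).1 (H0 i).2 normr0 addr0.
rewrite (eq_Int (g := fun=> 0)); last by move=> t _; rewrite big1// => i _; rewrite normr0.
rewrite Int_cst ?pi_ge0// mul0r addr0 mulr0 !normr_le0 => -[/eqP-> /eqP->].
by [].
Qed.

(* Both problems have mu as an eigenvalue of multiplicity at least N, which is
   also the dimension of the space of initial values Y(0). *)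
Lemma eigen_data (Q : R -> 'M[R]_N) q (lamQ lam0 : nat -> R) (phi psi : R -> R) lam :
  (forall j k, intg 0 pi (q j k)) ->
  {ae mu, forall x, 0 < x < pi -> forall j k, q j k x = jump a x ^+ 2 * Q x j k} ->
  SL_eigenvalues alpha a Q lamQ ->
  SL_eigenvalues alpha a (fun _ : R => 0 : 'M[R]_N) lam0 ->
  (forall n, lamQ n = lam0 n) ->
  prim 0 pi phi (fun x => psi x / jump a x ^+ 2) ->
  prim 0 pi psi (fun x => - (lam * (jump a x ^+ 2 * rho alpha x) * phi x)) ->
  phi 0 = 1 -> psi 0 = 0 -> psi pi = 0 ->
  forall j0, exists Z V, wsol alpha a q lam Z V /\
    forall j, [/\ Z j 0 = (j == j0)%:R, V j 0 = 0 & V j pi = 0].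
Proof.
move=> qi qQ [_ _ HQ] [_ _ H0] lamE phip psip phi0 psi0 psipi j0.
have [k1 [b [bs bfree _]] k1E] := HQ (lam%:C)%C.
have [k0 [b0 [_ _ bspan]] k0E] := H0 (lam%:C)%C.
have k01 : k0 = k1.
  move: k1E; rewrite (funext lamE : lamQ = lam0) => k1E.
  by apply/card_eq_II; apply: card_eq_trans k1E; rewrite card_eq_sym.
have c0 : prim 0 pi (fun=> 0 : R) (fun=> 0) by apply: prim_cst; exact: pi_ge0.
(* The functions phi e_l, for the N unit vectors e_l, are independent solutions of L(0); hence its
   multiplicity is at least N. *)
pose ephi (l j : 'I_N) x := (j == l)%:R * phi x : R.
have es l : SL_solution alpha a (fun _ : R => 0 : 'M[R]_N) (lam%:C)%C (embed a (ephi l)).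
  apply: (@wsol_SL_solution _ _ _ _ _ _ (fun _ _ _ => 0) _ _ (fun j x => (j == l)%:R * psi x)) => //.
  - by move=> j k; exact: intg_cst.
  - by apply: aeW (ae_neq 0) => x _ _ j k; rewrite mxE mulr0.
  - move=> j; split; first by apply: prim_eqr (primZ _ phip) => x _; rewrite mulrA.
    apply: prim_eqr (primZ _ psip) => x _; rewrite big1 ?sub0r; last by move=> k _; rewrite mul0r.
    by rewrite /ephi; ring.
  - by move=> j; rewrite psi0 psipi mulr0.
have /choice[c cP] l : exists c : 'I_k0 -> R[i], forall x, cut_interval x ->
    embed a (ephi l) x = \sum_(i < k0) c i *: b0 i x by exact: bspan.
pose C := \matrix_(l < N, i < k0) c l i.
(* Independence is tested at a single point where phi does not vanish; phi 0 = 1 and continuity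
   provide one in the left half. *)
have [x0 x0c phix0] : exists2 x, 0 < x < pi / 2 & phi x != 0.
  apply: contrapT => H; have p2 : (0 : R) < pi / 2 by rewrite divr_gt0// pi_gt0.
  have phic : cont_on 0 (pi / 2) phi.
    by apply: cont_on_sub (lexx 0) _ (prim_cont phip); have := pi_gt0 R; lra.
  have := cont_const_open (k := 0) p2 phic _ (x := 0); rewrite phi0 lexx ltW// => /(_ _ isT).
  move=> H1; suff : 1 = 0 :> R by move/eqP; rewrite oner_eq0.
  apply: H1 => x xp.
  by apply/eqP/negPn/negP => phix; apply: H; exists x.
have x0cut : cut_interval x0 by apply/cut_intervalP; left.
have Cfree : row_free C.
  rewrite -kermx_eq0; apply/rowV0P => u /sub_kermxP uC; apply/rowP => l; rewrite mxE.
  have : \sum_l u 0 l *: embed a (ephi l) x0 = 0.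
    under eq_bigr do rewrite cP// scaler_sumr.
    rewrite exchange_big/= big1// => i _.
    under eq_bigr do rewrite scalerA; rewrite -scaler_suml.
    have /matrixP/(_ 0 i) := uC; rewrite !mxE => uCi.
    rewrite (_ : \sum_l _ = 0) ?scale0r// -[RHS]uCi.
    by apply: eq_bigr => l' _; rewrite mxE.
  move=> /matrixP/(_ l 0); rewrite summxE mxE (bigD1 l)//= big1 ?addr0; last first.
    by move=> l' /negbTE l'l; rewrite !mxE /ephi eq_sym l'l mul0r mulr0 mulr0.
  rewrite !mxE /ephi eqxx mul1r => /eqP; rewrite mulf_eq0 => /orP[/eqP//|].
  rewrite eq_complex/= eqxx andbT mulf_eq0 (negbTE phix0) orbF.
  by rewrite gt_eqF// jump_gt0.
have Nk : (N <= k1)%N by rewrite -k01; move: Cfree; rewrite /row_free => /eqP <-; exact: rank_leq_col.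
have /choice[ZV ZVP] i : exists ZV : (('I_N -> R -> R) * ('I_N -> R -> R)) * (('I_N -> R -> R) * ('I_N -> R -> R)),
   [/\ wsol alpha a q lam ZV.1.1 ZV.1.2, wsol alpha a q lam ZV.2.1 ZV.2.2,
    (forall j, ZV.1.2 j 0 = 0 /\ ZV.1.2 j pi = 0) /\ (forall j, ZV.2.2 j 0 = 0 /\ ZV.2.2 j pi = 0) &
    forall j x, cut_interval x -> b i x j 0 =
      ((jump a x * ZV.1.1 j x) +i* (jump a x * ZV.2.1 j x))%C].
  have [sR sI] := SL_solution_rsol (bs i).
  have [Z1 [V1 [w1 v1 e1]]] := rsol_wsol a0 qi qQ sR.
  have [Z2 [V2 [w2 v2 e2]]] := rsol_wsol a0 qi qQ sI.
  exists ((Z1, V1), (Z2, V2)); split => //= j x xc; rewrite -e1// -e2//.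
  by case: (b i x j 0).
(* [Zc] and [Zd] are the real and imaginary parts of sum u_i b_i after removing the factor [jump];
   [Vc] and [Vd] are their momenta. *)
pose Zc (u : 'I_k1 -> R[i]) j x := \sum_i complex.Re (u i) * (ZV i).1.1 j x + \sum_i (- complex.Im (u i)) * (ZV i).2.1 j x.
pose Vc (u : 'I_k1 -> R[i]) j x := \sum_i complex.Re (u i) * (ZV i).1.2 j x + \sum_i (- complex.Im (u i)) * (ZV i).2.2 j x.
pose Zd (u : 'I_k1 -> R[i]) j x := \sum_i complex.Im (u i) * (ZV i).1.1 j x + \sum_i complex.Re (u i) * (ZV i).2.1 j x.
pose Vd (u : 'I_k1 -> R[i]) j x := \sum_i complex.Im (u i) * (ZV i).1.2 j x + \sum_i complex.Re (u i) * (ZV i).2.2 j x.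
have wc u : wsol alpha a q lam (Zc u) (Vc u).
  by apply: wsolD; apply: wsol_sum => i; have [] := ZVP i.
have wd u : wsol alpha a q lam (Zd u) (Vd u).
  by apply: wsolD; apply: wsol_sum => i; have [] := ZVP i.
have Vc0 u j : Vc u j 0 = 0 /\ Vc u j pi = 0.
  by split; rewrite /Vc !big1 ?addr0// => i _; have [_ _ [/(_ j)[h1 h2] /(_ j)[h3 h4]] _] := ZVP i;
    rewrite ?h1 ?h2 ?h3 ?h4 mulr0.
have Vd0 u j : Vd u j 0 = 0 /\ Vd u j pi = 0.
  by split; rewrite /Vd !big1 ?addr0// => i _; have [_ _ [/(_ j)[h1 h2] /(_ j)[h3 h4]] _] := ZVP i;
    rewrite ?h1 ?h2 ?h3 ?h4 mulr0.
(* [B] sends coefficients to initial values. A solution with Z(0) = V(0) = 0 vanishes, so the k1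
   rows are independent; there are N columns and k1 >= N, hence every initial value is attained. *)
pose B := \matrix_(i < k1, j < N) ((ZV i).1.1 j 0 +i* (ZV i).2.1 j 0)%C.
have BE (u : 'rV_k1) j : (u *m B) 0 j = (Zc (u 0) j 0 +i* Zd (u 0) j 0)%C.
  rewrite mxE; apply: complex_eq; rewrite ?cRe_sum ?cIm_sum /= /Zc /Zd -big_split/=; apply: eq_bigr => i _.
    by rewrite mxE cReM/= mulNr.
  by rewrite mxE cImM/= addrC.
have Bfree : row_free B.
  rewrite -kermx_eq0; apply/rowV0P => u /sub_kermxP uB; apply/rowP => i; rewrite mxE.
  have ZE j : Zc (u 0) j 0 = 0 /\ Zd (u 0) j 0 = 0.
    by have := BE u j; rewrite uB mxE => -[<- <-].
  apply: (bfree (u 0)) => x xc; apply/matrixP => j l; rewrite ord1 summxE mxE.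
  have xp : 0 <= x <= pi.
    by move/cut_intervalP : xc => [] /andP[h1 h2]; apply/andP; split; have := pi_gt0 R; lra.
  have [zc _] := wsol_unique qi (wc (u 0)) (fun j => conj (ZE j).1 (Vc0 (u 0) j).1) j xp.
  have [zd _] := wsol_unique qi (wd (u 0)) (fun j => conj (ZE j).2 (Vd0 (u 0) j).1) j xp.
  apply: complex_eq; rewrite ?cRe_sum ?cIm_sum/=.
    transitivity (jump a x * Zc (u 0) j x); last by rewrite zc mulr0.
    rewrite /Zc -big_split/= mulr_sumr; apply: eq_bigr => i' _.
    by have [_ _ _ e] := ZVP i'; rewrite mxE e// cReM/=; ring.
  transitivity (jump a x * Zd (u 0) j x); last by rewrite zd mulr0.
  rewrite /Zd -big_split/= mulr_sumr; apply: eq_bigr => i' _.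
  by have [_ _ _ e] := ZVP i'; rewrite mxE e// cImM/=; ring.
have Bfull : row_full B.
  rewrite /row_full eqn_leq rank_leq_col/=; move: Bfree; rewrite /row_free => /eqP ->.
  exact: Nk.
have /submxP[u uE] : ((delta_mx 0 j0 : 'rV_N) <= B)%MS by exact: submx_full.
exists (Zc (u 0)), (Vc (u 0)); split => // j; split; [|exact: (Vc0 _ _).1|exact: (Vc0 _ _).2].
have := BE u j; rewrite -uE mxE eqxx/= => /(congr1 (@complex.Re R))/= <-.
by case: (j == j0).
Qed.
End weak_solutions.

(** * The potential has mean zero *)

Section energy.
Variable R : realType.
Implicit Types (c d : R) (E D g : R -> R).

(** For the energy h = D^2 + kap^2 E^2 the relation m w0 = kap^2 cancels the terms in D E and leaves
    h' = 2 D g. At the maximum M^2 of h this gives M^2 <= s^2 + 2 M Int |g|, whence M <= s + 2 Int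
    |g|. *)
Lemma energy_bound c d E D g (w0 m kap s : R) : c <= d -> 0 < w0 -> 0 <= s -> m * w0 = kap ^+ 2 ->
  prim c d E (fun x => D x / w0) -> prim c d D (fun x => g x - m * E x) -> intg c d g ->
  D c ^+ 2 + kap ^+ 2 * E c ^+ 2 <= s ^+ 2 ->
  forall x, c <= x <= d -> let B := s + 2 * Int c d (fun t => `|g t|) in
    `|D x| <= B /\ `|kap * E x| <= B.
Proof.
move=> cd w00 s0 mw Ep Dp gi hs x xcd B.
pose h x := D x * D x + kap ^+ 2 * (E x * E x).
have hp : prim c d h (fun x => 2 * D x * g x).
  apply: (prim_eqr _ (primD (prim_mul cd Dp Dp) (primZ (kap ^+ 2) (prim_mul cd Ep Ep)))).
  by move=> t _; rewrite -mw; field; rewrite gt_eqF.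
have hc := prim_cont hp.
have [y ycd hy] := EVT_max cd hc; have ycd' : c <= y <= d by move: ycd; rewrite in_itv.
have h0 t : 0 <= h t by rewrite /h -!expr2 addr_ge0// ?sqr_ge0// mulr_ge0// sqr_ge0.
pose M := Num.sqrt (h y); have M0 : 0 <= M by exact: sqrtr_ge0.
have M2 : M ^+ 2 = h y by rewrite sqr_sqrtr.
have hM t : c <= t <= d -> h t <= M ^+ 2 by move=> tcd; rewrite M2; apply: hy; rewrite in_itv.
have DM t : c <= t <= d -> `|D t| <= M.
  move=> /hM; rewrite /h -!expr2 => H; rewrite -(@ler_pXn2r _ 2)// ?nnegrE// real_normK ?num_real//.
  by apply: le_trans H; rewrite lerDl mulr_ge0// sqr_ge0.
have EM t : c <= t <= d -> `|kap * E t| <= M.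
  move=> /hM; rewrite /h -!expr2 => H; rewrite -(@ler_pXn2r _ 2)// ?nnegrE// real_normK ?num_real//.
  by apply: le_trans H; rewrite exprMn lerDr sqr_ge0.
pose G := Int c d (fun t => `|g t|).
have G0 : 0 <= G by apply: Int_ge0 => t _.
have MB : M <= B.
  have : M ^+ 2 <= s ^+ 2 + 2 * M * G.
    rewrite M2 (primE hp ycd') ; apply: lerD.
      by move: hs; rewrite /h -!expr2.
    have /andP[cy yd] := ycd'.
    have gi' := intg_norm gi.
    apply: (@le_trans _ _ (Int c y (fun t => 2 * M * `|g t|))).
      apply: le_Int; [exact: intg_sub (prim_intg hp)|by apply: intg_sub (intgZ _ gi')|].
      move=> t /andP[ct ty]; rewrite -!mulrA ler_pM2l// (le_trans (ler_norm _))// normrM.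
      by rewrite ler_wpM2r// DM// ct (le_trans ty).
    rewrite IntZ; last exact: intg_sub gi'.
    by rewrite ler_wpM2l ?mulr_ge0//; apply: Int_ge0_subr.
  rewrite /B -/G => H; rewrite leNgt; apply/negP => H2.
  have : (s + 2 * G) * M < M * M by rewrite ltr_pM2r// (le_lt_trans _ H2)// addr_ge0// mulr_ge0.
  have : s * s <= s * M by rewrite ler_wpM2l//; nra.
  nra.
by split; apply: le_trans MB; [exact: DM|exact: EM].
Qed.

Lemma Int_subitv_ge0 c d c' d' g : c <= c' -> c' <= d' -> d' <= d -> intg c d g ->
  (forall t, c <= t <= d -> 0 <= g t) -> Int c' d' g <= Int c d g.
Proof.
move=> cc cd dd gi g0.
apply: (@le_trans _ _ (Int c d' g)); last first.
  by apply: Int_ge0_subr => //; rewrite dd (le_trans cc).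
have <- := Int_sub gi cc cd dd; rewrite gerBl.
by apply: Int_ge0 => t /andP[ct tc]; apply: g0; rewrite ct (le_trans tc)// (le_trans cd).
Qed.
End energy.

(** * Comparison with the free eigenfunction at high frequency *)

Section asymptotics.
Variables (R : realType) (N : nat) (alpha a : R).
Hypotheses (alpha0 : 0 < alpha) (a0 : 0 < a).
Variable q : 'I_N -> 'I_N -> R -> R.
Hypothesis qi : forall j k, intg 0 pi (q j k).

Let pi2 : (0 : R) < pi / 2. Proof. by rewrite divr_gt0// pi_gt0. Qed.
Let pi2' : pi / 2 < (pi : R). Proof. by have := pi_gt0 R; lra. Qed.

Definition scalar_eigen lam (phi psi : R -> R) : Prop :=
  [/\ prim 0 pi phi (fun x => psi x / jump a x ^+ 2),
   prim 0 pi psi (fun x => - (lam * (jump a x ^+ 2 * rho alpha x) * phi x)),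
   phi 0 = 1, psi 0 = 0 & psi pi = 0].

(** The function phi V_i - Z_i psi has derivative phi (q Z)_i and vanishes at 0 and pi. *)
Lemma green_phi lam phi psi Z V : scalar_eigen lam phi psi -> wsol alpha a q lam Z V ->
  (forall j, V j 0 = 0 /\ V j pi = 0) ->
  forall i, Int 0 pi (fun x => phi x * \sum_k q i k x * Z k x) = 0.
Proof.
move=> [pp sp p0 s0 spi] ws V0 i; have [Zp Vp] := ws i.
have P := primSub (prim_mul (pi_ge0 R) pp Vp) (prim_mul (pi_ge0 R) Zp sp).
have := primB P (lexx 0) (pi_ge0 R) (lexx pi).
rewrite (V0 i).1 (V0 i).2 s0 spi !mulr0 !subr0 => e; rewrite [RHS]e.
by apply: eq_Int => x _; ring.
Qed.

Let K : R := \sum_i \sum_j Int 0 pi (fun t => `|q i j t|).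
Let K0 : 0 <= K.
Proof. by rewrite sumr_ge0// => i _; rewrite sumr_ge0// => j _; exact: Int_ge0. Qed.

(** On the right half the energy estimate has kap = k [b]. In [C1] the term 2 serves the left half;
    the quotient comes from the right half, where the initial energy is at most ((1 + b) 2 K
    S)^2. *)
Let b := a ^+ 2 * alpha.
Let b0 : 0 < b. Proof. by rewrite mulr_gt0// exprn_gt0. Qed.
Let C1 : R := 2 + (2 * (1 + b) + 2) / b.
Let C10 : 0 < C1. Proof. by rewrite addr_gt0// divr_gt0// addr_gt0// mulr_gt0// addr_gt0. Qed.

Let gK (i : 'I_N) (Z : 'I_N -> R -> R) (S c d : R) : 0 <= c -> c <= d -> d <= pi -> 0 <= S ->
  (forall k, cont_on 0 pi (Z k)) ->
  (forall k x, 0 <= x <= pi -> `|Z k x| <= S) ->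
  Int c d (fun t => `|\sum_k q i k t * Z k t|) <= K * S.
Proof.
move=> c0 cd dp S0 Zc ZS.
have sb g : intg 0 pi g -> intg c d g by apply: intg_sub.
have gi : intg 0 pi (fun t => \sum_k q i k t * Z k t).
  by apply: intg_sum => k _; exact: intgM_cont.
have si : intg 0 pi (fun t => \sum_k `|q i k t|) by apply: intg_sum => k _; exact: intg_norm.
have si' : intg 0 pi (fun t => \sum_i \sum_k `|q i k t|).
  by apply: intg_sum => k _; apply: intg_sum => l _; exact: intg_norm.
apply: (@le_trans _ _ (Int c d (fun t => S * \sum_k `|q i k t|))).
  apply: le_Int; [exact/intg_norm/sb|exact/sb/intgZ|].
  move=> t /andP[ct td]; have tp : 0 <= t <= pi by rewrite (le_trans c0)//= (le_trans td).
  apply: le_trans (ler_norm_sum _ _ _) _; rewrite mulr_sumr; apply: ler_sum => k _.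
  by rewrite normrM mulrC ler_wpM2r// ZS.
rewrite IntZ; last exact: sb.
rewrite mulrC ler_wpM2r//.
apply: (@le_trans _ _ (Int 0 pi (fun t => \sum_k `|q i k t|))).
  by apply: Int_subitv_ge0 => // t _; apply: sumr_ge0.
rewrite /K (bigD1 i)//= Int_sum; last by move=> k _; exact: intg_norm.
by rewrite lerDl sumr_ge0// => l _; apply: sumr_ge0 => k _; exact: Int_ge0.
Qed.

(** The error Z - phi e_j0 solves the free system with source q Z. The energy estimate bounds it by
    C1 K (P + e) / k, where e is the sum of the maximal errors themselves; for k >= C the e on the
    right is absorbed and e <= P. *)
Lemma eigen_asymptotic : exists2 C : R, 0 <= C & forall (k P : R) phi psi Z V (j0 : 'I_N),
  1 <= k -> C <= k -> 0 <= P -> (forall x, 0 <= x <= pi -> `|phi x| <= P) ->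
  scalar_eigen (k ^+ 2) phi psi -> wsol alpha a q (k ^+ 2) Z V ->
  (forall j, Z j 0 = (j == j0)%:R /\ V j 0 = 0) ->
  forall i x, 0 <= x <= pi -> `|Z i x - (i == j0)%:R * phi x| <= C * P / k.
Proof.
(* For k >= C this makes N C1 K / k at most 1/2, which absorbs e; it also dominates the final
   constant 2 C1 K. *)
pose C := 2 * N.+1%:R * C1 * K; have C0 : 0 <= C by rewrite !mulr_ge0// ltW.
exists C => // k P phi psi Z V j0 k1 Ck P0 phiP [pp sp p0 s0 spi] ws Z0.
have k0 : 0 < k by exact: lt_le_trans k1.
have Zc j : cont_on 0 pi (Z j) := prim_cont (ws j).1.
pose E i x := Z i x - (i == j0)%:R * phi x.
pose D i x := V i x - (i == j0)%:R * psi x.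
pose g i x := \sum_k q i k x * Z k x.
have Ep i : prim 0 pi (E i) (fun x => D i x / jump a x ^+ 2).
  apply: (prim_eqr _ (primSub (ws i).1 (primZ (i == j0)%:R pp))) => x _.
  by rewrite /D mulrBl mulrA.
have Dp i : prim 0 pi (D i) (fun x => g i x - k ^+ 2 * (jump a x ^+ 2 * rho alpha x) * E i x).
  apply: (prim_eqr _ (primSub (ws i).2 (primZ (i == j0)%:R sp))) => x _.
  by rewrite /E /g; ring.
have Ec i : cont_on 0 pi (E i) := prim_cont (Ep i).
have gi i : intg 0 pi (g i) by apply: intg_sum => j _; exact: intgM_cont.
have /choice[M MP] i : exists M, (exists2 y, 0 <= y <= pi & M = `|E i y|) /\
    forall x, 0 <= x <= pi -> `|E i x| <= M.
  have [y yp hy] := EVT_max (pi_ge0 R) (cont_on_norm (Ec i)).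
  exists `|E i y|; split; first by exists y => //; move: yp; rewrite in_itv.
  by move=> x xp; apply: hy; rewrite in_itv.
pose e := \sum_i M i.
have M0 i : 0 <= M i by have [[y _ ->] _] := MP i.
have Ee i x : 0 <= x <= pi -> `|E i x| <= e.
  move=> xp; apply: le_trans ((MP i).2 x xp) _.
  by rewrite /e (bigD1 i)//= lerDl sumr_ge0.
have e0 : 0 <= e by exact: sumr_ge0.
pose S := P + e; have S0 : 0 <= S by rewrite addr_ge0.
have ZS j x : 0 <= x <= pi -> `|Z j x| <= S.
  move=> xp; have -> : Z j x = (j == j0)%:R * phi x + E j x by rewrite /E; ring.
  apply: le_trans (ler_normD _ _) _; apply: lerD; last exact: Ee.
  by rewrite normrM; case: (j == j0); rewrite ?normr1 ?normr0 ?mul1r ?mul0r ?phiP.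
have main i x : 0 <= x <= pi -> `|E i x| <= C1 * K * S / k.
  have E00 : E i 0 = 0 by rewrite /E (Z0 i).1 p0 mulr1 subrr.
  have D00 : D i 0 = 0 by rewrite /D (Z0 i).2 s0 mulr0 subrr.
  have KS0 : 0 <= K * S by rewrite mulr_ge0.
  have El : prim 0 (pi / 2) (E i) (fun x => D i x / 1).
    apply: (prim_aer _ _ (prim_sub (lexx 0) (ltW pi2) (ltW pi2') (Ep i))).
      under eq_fun do rewrite divr1.
      exact: intg_sub (lexx 0) (ltW pi2') (cont_on_intg (prim_cont (Dp i))).
    by apply: aeW (ae_neq 0) => t _ /andP[_ t2]; rewrite jumpl// expr1n.
  have Dl : prim 0 (pi / 2) (D i) (fun x => g i x - k ^+ 2 * E i x).
    apply: (prim_aer _ _ (prim_sub (lexx 0) (ltW pi2) (ltW pi2') (Dp i))).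
      apply: intg_sub (lexx 0) (ltW pi2') _; apply: intgB => //.
      exact/intgZ/cont_on_intg.
    by apply: aeW (ae_neq 0) => t _ /andP[_ t2]; rewrite jumpl// rhol// expr1n mul1r mulr1.
  have Er : prim (pi / 2) pi (E i) (fun x => D i x / a ^+ 2).
    apply: (prim_eqr _ (prim_sub (ltW pi2) (ltW pi2') (lexx pi) (Ep i))).
    by move=> t /andP[t1 _]; rewrite jumpr.
  have Dr : prim (pi / 2) pi (D i) (fun x => g i x - k ^+ 2 * (a ^+ 2 * alpha ^+ 2) * E i x).
    apply: (prim_eqr _ (prim_sub (ltW pi2) (ltW pi2') (lexx pi) (Dp i))).
    by move=> t /andP[t1 _]; rewrite jumpr// rhor.
  have gil : intg 0 (pi / 2) (g i) := intg_sub (lexx 0) (ltW pi2') (gi i).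
  have gir : intg (pi / 2) pi (g i) := intg_sub (ltW pi2) (lexx pi) (gi i).
  have hl : D i 0 ^+ 2 + k ^+ 2 * E i 0 ^+ 2 <= 0 ^+ 2 by rewrite E00 D00 !expr0n/= mulr0 addr0.
  have HL := energy_bound (ltW pi2) ltr01 (lexx 0) (mulr1 (k ^+ 2)) El Dl gil hl.
  have gl := gK i (lexx 0) (ltW pi2) (ltW pi2') S0 Zc ZS.
  have gr := gK i (ltW pi2) (ltW pi2') (lexx pi) S0 Zc ZS.
  pose B1 := 2 * (K * S).
  have {}HL t : 0 <= t <= pi / 2 -> `|D i t| <= B1 /\ k * `|E i t| <= B1.
    move=> tp; have [h1 h2] := HL t tp; rewrite add0r in h1 h2.
    have le2 := ler_wpM2l (ltW (ltr0n R 2)) gl.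
    split; first exact: le_trans h1 le2.
    by move: h2; rewrite normrM (gtr0_norm k0) => h2; exact: le_trans h2 le2.
  have B10 : 0 <= B1 by rewrite mulr_ge0.
  pose kap := k * b.
  have kap0 : 0 < kap by rewrite mulr_gt0.
  have mw : k ^+ 2 * (a ^+ 2 * alpha ^+ 2) * a ^+ 2 = kap ^+ 2 by rewrite /kap /b; ring.
  have [|d2 e2] := HL (pi / 2); first by rewrite lexx ltW.
  (* The left-half bounds at pi / 2 become the initial energy of the right half, with k replaced by
     kap = k b. *)
  have hr : D i (pi / 2) ^+ 2 + kap ^+ 2 * E i (pi / 2) ^+ 2 <= ((1 + b) * B1) ^+ 2.
    have d3 : D i (pi / 2) ^+ 2 <= B1 ^+ 2.
      by rewrite -(real_normK (num_real (D i _))) ler_pXn2r.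
    have e3 : (k * E i (pi / 2)) ^+ 2 <= B1 ^+ 2.
      rewrite -(real_normK (num_real (k * E i _))) ler_pXn2r ?nnegrE// normrM.
      by rewrite (gtr0_norm k0).
    have e4 := ler_wpM2l (sqr_ge0 b) e3.
    have b1 : 0 <= b * B1 ^+ 2 by rewrite mulr_ge0 ?sqr_ge0// ltW.
    have -> : kap ^+ 2 * E i (pi / 2) ^+ 2 = b ^+ 2 * (k * E i (pi / 2)) ^+ 2 by rewrite /kap; ring.
    have -> : ((1 + b) * B1) ^+ 2 = B1 ^+ 2 + 2 * (b * B1 ^+ 2) + b ^+ 2 * B1 ^+ 2 by ring.
    apply: lerD e4; apply: le_trans d3 _; rewrite lerDl; exact: mulr_ge0.
  have s0' : 0 <= (1 + b) * B1 by rewrite mulr_ge0// addr_ge0// ltW.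
  have HR := energy_bound (ltW pi2') (exprn_gt0 2 a0) s0' mw Er Dr gir hr.
  move=> /andP[x0 xp]; rewrite ler_pdivlMr// mulrC.
  have [x2|/ltW x2] := leP x (pi / 2).
    have [|_ h] := HL x; first by rewrite x0.
    apply: le_trans h _; rewrite /B1 -mulrA ler_wpM2r//.
    by rewrite /C1 lerDl divr_ge0 ?ltW// addr_gt0// mulr_gt0// addr_gt0.
  have [|_ h] := HR x; first by rewrite x2.
  rewrite normrM (gtr0_norm kap0) /kap in h.
  have := le_trans h (lerD (lexx _) (ler_wpM2l (ltW (ltr0n R 2)) gr)).
  rewrite [k * b]mulrC -(mulrA b k) -ler_pdivlMl// => /le_trans; apply.
  have -> : b^-1 * ((1 + b) * B1 + 2 * (K * S)) = (2 * (1 + b) + 2) / b * (K * S) by rewrite /B1; ring.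
  by rewrite -(mulrA C1 K S) ler_wpM2r// /C1 lerDr.
have eE : e <= N%:R * (C1 * K * S / k).
  apply: (@le_trans _ _ (\sum_(i < N) C1 * K * S / k)).
    by apply: ler_sum => i _; have [[y yp ->] _] := MP i; exact: main.
  by rewrite sumr_const card_ord -[_ *+ N]mulr_natl.
have eP : e <= P.
  have : N%:R * (C1 * K) / k <= 2^-1.
    rewrite ler_pdivrMr//.
    have NK : N%:R * (C1 * K) <= N.+1%:R * (C1 * K).
      by rewrite ler_wpM2r ?mulr_ge0 ?(ltW C10)// ler_nat.
    have CE : C = 2 * (N.+1%:R * (C1 * K)) by rewrite /C; ring.
    rewrite CE in Ck; apply: le_trans NK _.
    by rewrite ler_pdivlMl.
  move=> h; have := ler_wpM2r S0 h; have -> : N%:R * (C1 * K) / k * S = N%:R * (C1 * K * S / k) by ring.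
  by rewrite /S in eE *; lra.
move=> i x xp; apply: le_trans (main i x xp) _.
rewrite ler_wpM2r ?invr_ge0 ?(ltW k0)//.
apply: (@le_trans _ _ (C1 * K * (2 * P))).
  by rewrite ler_wpM2l ?mulr_ge0 ?(ltW C10)// /S; lra.
have -> : C * P = N.+1%:R * (C1 * K * (2 * P)) by rewrite /C; ring.
by rewrite ler_peMl ?mulr_ge0 ?(ltW C10)// ler1n.
Qed.
End asymptotics.

(** * Trigonometric primitives and estimates *)

Section trig.
Variable R : realType.
Implicit Types (c d x y u : R).

Lemma is_derive_cos_affine (A w s x : R) :
  is_derive x 1 (fun t => A * cos (w * (t - s))) (- (w * A) * sin (w * (x - s))).
Proof.
have h : is_derive x 1 (fun t : R => w * (t - s)) w.
  have := is_deriveZ w (is_deriveB (is_derive_id x (1 : R)) (is_derive_cst s x (1 : R))).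
  by move=> H; apply: is_derive_eq H _; rewrite subr0 /GRing.scale/= mulr1.
have := is_deriveZ A (is_derive1_comp (is_derive_cos _) h).
by move=> H; apply: is_derive_eq H _; rewrite /GRing.scale/=; ring.
Qed.

Lemma is_derive_sin_affine (A w s x : R) :
  is_derive x 1 (fun t => A * sin (w * (t - s))) (w * A * cos (w * (x - s))).
Proof.
have h : is_derive x 1 (fun t : R => w * (t - s)) w.
  have := is_deriveZ w (is_deriveB (is_derive_id x (1 : R)) (is_derive_cst s x (1 : R))).
  by move=> H; apply: is_derive_eq H _; rewrite subr0 /GRing.scale/= mulr1.
have := is_deriveZ A (is_derive1_comp (is_derive_sin _) h).
by move=> H; apply: is_derive_eq H _; rewrite /GRing.scale/=; ring.
Qed.

Lemma continuous_cos_affine (A w s : R) : continuous (fun t => A * cos (w * (t - s))).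
Proof.
move=> x; apply/differentiable_continuous/derivable1_diffP.
by have [] := is_derive_cos_affine A w s x.
Qed.

Lemma continuous_sin_affine (A w s : R) : continuous (fun t => A * sin (w * (t - s))).
Proof.
move=> x; apply/differentiable_continuous/derivable1_diffP.
by have [] := is_derive_sin_affine A w s x.
Qed.

Lemma prim_cos_affine c d (A w s : R) : c <= d ->
  prim c d (fun t => A * cos (w * (t - s))) (fun t => - (w * A) * sin (w * (t - s))).
Proof.
move=> cd; apply: prim_C1 => //; first exact/cont_on_continuous/continuous_sin_affine.
move=> x _; have [h1 h2] := is_derive_cos_affine A w s x; split=> //.
by rewrite derive1E h2.
Qed.

Lemma prim_sin_affine c d (A w s : R) : c <= d ->
  prim c d (fun t => A * sin (w * (t - s))) (fun t => w * A * cos (w * (t - s))).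
Proof.
move=> cd; apply: prim_C1 => //; first exact/cont_on_continuous/continuous_cos_affine.
move=> x _; have [h1 h2] := is_derive_sin_affine A w s x; split=> //.
by rewrite derive1E h2.
Qed.

Lemma cos_lipschitz x y : `|cos x - cos y| <= `|x - y|.
Proof.
wlog xy : x y / y <= x.
  by move=> H; have [/H//|/ltW/H] := leP y x; rewrite distrC [leRHS]distrC.
have P : prim y x cos (fun t => - sin t).
  apply: (prim_eql _ (prim_eqr _ (prim_cos_affine 1 1 0 xy))) => t _; rewrite !mul1r subr0//.
  by rewrite mulN1r.
rewrite (primB P (lexx y) xy (lexx x)).
apply: le_trans (norm_Int_le (prim_intg P)) _.
rewrite (ger0_norm (_ : 0 <= x - y)) ?subr_ge0//.
apply: (@le_trans _ _ (Int y x (fun=> 1))); last by rewrite Int_cst// mul1r.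
apply: le_Int => [||t _]; [exact/intg_norm/(prim_intg P)|exact: intg_cst|].
by rewrite normrN; exact: sin_max.
Qed.

Lemma sin_le_norm x : `|sin x| <= `|x|.
Proof.
have := cos_lipschitz (pi / 2 - x) (pi / 2).
by rewrite cos_pihalf subr0 -[_ - x]opprB cosN cosBpihalf opprB addrAC subrr add0r normrN.
Qed.

Lemma sin_pi_natmul x (m : nat) : sin (x + pi * m%:R) = (-1) ^+ m * sin x.
Proof. by rewrite mulr_natr; apply: (alternatingn (@sinDpi R)). Qed.

Lemma cos_pi_natmul x (m : nat) : cos (x + pi * m%:R) = (-1) ^+ m * cos x.
Proof. by rewrite mulr_natr; apply: (alternatingn (@cosDpi R)). Qed.

Lemma cos_sqr_near u e (m : nat) : `|u - pi * m%:R| <= e -> 1 - e ^+ 2 <= cos u ^+ 2 <= 1.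
Proof.
move=> h; have e0 : 0 <= e := le_trans (normr_ge0 _) h.
have := cos2Dsin2 u; have := sqr_ge0 (sin u).
have : sin u ^+ 2 <= e ^+ 2.
  have -> : u = (u - pi * m%:R) + pi * m%:R by rewrite subrK.
  rewrite sin_pi_natmul exprMn -exprM mulnC exprM sqrrN expr1n expr1n mul1r.
  rewrite -(real_normK (num_real (sin _))) ler_pXn2r ?nnegrE//.
  exact: le_trans (sin_le_norm _) h.
by move: (sin u ^+ 2) (cos u ^+ 2) (e ^+ 2) => s c f; lra.
Qed.

Lemma Int_cos4 (p : nat) : (0 < p)%N -> Int 0 pi (fun x : R => cos (4 * p%:R * x)) = 0.
Proof.
move=> p0; have p0' : (p%:R : R) != 0 by rewrite pnatr_eq0 -lt0n.
have P := prim_sin_affine (1 / (4 * p%:R)) (4 * p%:R) 0 (pi_ge0 R).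
have := primB P (lexx 0) (pi_ge0 R) (lexx pi).
rewrite !subr0 mulr0 sin0 mulr0 subr0.
have -> : 4 * p%:R * pi = 0 + pi * (4 * p)%:R :> R by rewrite natrM; ring.
rewrite sin_pi_natmul sin0 !mulr0 => e; rewrite [RHS]e; apply: eq_Int => t _.
by rewrite subr0; field.
Qed.
End trig.

(** * Bessel's inequality for the cosines of frequency 4n *)

Section bessel.
Variable R : realType.
Let e (n : nat) (x : R) := cos (4 * n%:R * x).
Let ec n : cont_on 0 pi (e n).
Proof.
apply: cont_on_eq (cont_on_continuous (@continuous_cos_affine R 1 (4 * n%:R) 0)) => x _.
by rewrite mul1r subr0.
Qed.

Let prod_cos x y : cos x * cos y = 2^-1 * cos (x - y) + 2^-1 * cos (x + y) :> R.
Proof. by rewrite cosB cosD; lra. Qed.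

Let e_orth n p : (0 < p)%N -> Int 0 pi (fun x => e n x * e (n + p) x) = 0.
Proof.
move=> p0.
have E x : e n x * e (n + p) x = 2^-1 * e p x + 2^-1 * e (2 * n + p)%N x.
  rewrite /e prod_cos !(natrD, natrM) -cosN; congr (_ * cos _ + _ * cos _); ring.
rewrite (eq_Int (fun x _ => E x)) IntD; try exact/intgZ/cont_on_intg/ec.
rewrite !IntZ; try exact/cont_on_intg/ec.
by rewrite !Int_cos4 ?addn_gt0 ?p0 ?orbT// !mulr0 addr0.
Qed.

Let e_norm n : (0 < n)%N -> Int 0 pi (fun x => e n x * e n x) = pi / 2.
Proof.
move=> n0.
have E x : e n x * e n x = 2^-1 + 2^-1 * e (2 * n)%N x.
  rewrite /e prod_cos subrr cos0 natrM mulr1; congr (_ + _ * cos _); ring.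
rewrite (eq_Int (fun x _ => E x)) IntD; [|exact: intg_cst|exact/intgZ/cont_on_intg/ec].
rewrite IntZ ?Int_cst ?pi_ge0//; last exact/cont_on_intg/ec.
by rewrite Int_cos4 ?muln_gt0// mulr0 addr0 subr0 mulrC.
Qed.

(** Bessel's inequality bounds the partial sums of the squared coefficients; their series converges,
    so the coefficients tend to 0. The family cos(4 n x) is enough because phi^2 has frequencies
    close to these. *)
Lemma riemann_lebesgue_cos4 (f : R -> R) : intg 0 pi f -> intg 0 pi (fun x => f x ^+ 2) ->
  (fun n : nat => Int 0 pi (fun x => f x * cos (4 * n%:R * x))) @ \oo --> 0.
Proof.
move=> fi f2i; pose c n := Int 0 pi (fun x => f x * e n x).
(* The sum starts with [e 1]: the constant [e 0] has squared norm pi instead of pi / 2. *)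
pose S n x := \sum_(i < n) (2 / pi * c i.+1) * e i.+1 x.
have pi0 := pi_gt0 R.
have Sc n : cont_on 0 pi (S n).
  by apply: cont_on_sum => i _; apply: cont_onM; [exact: cont_on_cst|exact: ec].
have gi n : intg 0 pi (fun x => f x - S n x) by apply: intgB => //; exact: cont_on_intg.
have g2i n : intg 0 pi (fun x => (f x - S n x) ^+ 2).
  apply: (@intg_eq _ _ _ (fun x => f x ^+ 2 - 2 * (f x * S n x) + S n x * S n x)).
    by move=> x _; ring.
  apply: intgD; last by apply: cont_on_intg; exact: cont_onM.
  by apply: intgB => //; apply: intgZ; exact: intgM_cont.
have gm n m : (n < m)%N -> Int 0 pi (fun x => (f x - S n x) * e m x) = c m.
  move=> nm; have E x : (f x - S n x) * e m x = f x * e m x - \sum_(i < n) 2 / pi * c i.+1 * (e i.+1 x * e m x).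
    by rewrite mulrBl mulr_suml; congr (_ - _); apply: eq_bigr => i _; rewrite mulrA.
  have ei i : intg 0 pi (fun x => 2 / pi * c i.+1 * (e i.+1 x * e m x)).
    by apply/intgZ/cont_on_intg; exact: cont_onM.
  rewrite (eq_Int (fun x _ => E x)) IntB; [|exact: intgM_cont|exact: intg_sum].
  rewrite Int_sum// big1 ?subr0// => i _.
  rewrite IntZ; last by apply: cont_on_intg; exact: cont_onM.
  have -> : m = (i.+1 + (m - i.+1))%N by rewrite subnKC// (leq_trans (ltn_ord i))// ltnW.
  by rewrite e_orth ?mulr0// subn_gt0 (leq_ltn_trans (ltn_ord i)).
have key n : Int 0 pi (fun x => (f x - S n x) ^+ 2) =
    Int 0 pi (fun x => f x ^+ 2) - 2 / pi * \sum_(i < n) c i.+1 ^+ 2.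
  elim: n => [|n IH].
    rewrite big_ord0 mulr0 subr0; apply: eq_Int => x _; by rewrite /S big_ord0 subr0.
  pose t := 2 / pi * c n.+1.
  have E x : (f x - S n.+1 x) ^+ 2 =
     (f x - S n x) ^+ 2 - 2 * t * ((f x - S n x) * e n.+1 x) + t ^+ 2 * (e n.+1 x * e n.+1 x).
    by rewrite /S big_ord_recr/= -/(S n x) -/t; ring.
  have i1 : intg 0 pi (fun x => (f x - S n x) * e n.+1 x) by exact: intgM_cont.
  have i2 : intg 0 pi (fun x => e n.+1 x * e n.+1 x) by apply: cont_on_intg; exact: cont_onM.
  rewrite (eq_Int (fun x _ => E x)) IntD; last 2 first.
  - by apply: intgB => //; exact: intgZ.
  - exact: intgZ.
  rewrite IntB//; last exact: intgZ.
  rewrite !IntZ// IH gm// e_norm// big_ord_recr/= /t.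
  have pin : (pi : R) != 0 by rewrite gt_eqF.
  move: (c n.+1) (\sum_(i < n) _) (Int 0 pi (fun x => f x ^+ 2)) => u v w.
  by move: (@pi R) pin => p pn; field.
have B n : \sum_(i < n) c i.+1 ^+ 2 <= pi / 2 * Int 0 pi (fun x => f x ^+ 2).
  have : 0 <= Int 0 pi (fun x => (f x - S n x) ^+ 2) by apply: Int_ge0 => x _; exact: sqr_ge0.
  by rewrite key subr_ge0 -ler_pdivlMl ?divr_gt0// invf_div.
have cv : cvgn (series (fun i => c i.+1 ^+ 2)).
  apply: nondecreasing_is_cvgn.
    by apply/nondecreasing_series => n _ _; exact: sqr_ge0.
  exists (pi / 2 * Int 0 pi (fun x => f x ^+ 2)) => _ [n _ <-].
  by rewrite /series/= big_mkord; exact: B.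
have /cvgrPdist_lt h := cvg_series_cvg_0 cv.
rewrite -(cvg_shiftS); apply/cvgrPdist_lt => eps eps0.
have := h _ (exprn_gt0 2 eps0); apply: filterS => n; rewrite !sub0r !normrN normrX.
by rewrite ltr_pXn2r ?nnegrE// ltW.
Qed.
End bessel.

(** * Near resonance of both halves at once *)

Section recurrence.
Variables (R : realType) (alpha a : R).
Hypotheses (alpha0 : 0 < alpha) (a0 : 0 < a).

(** Pigeonhole on the fractional parts of alpha M1 j. Using multiples of [M1] forces m >= M, and
    alpha M1 > M + 1 forces l >= M, since l differs from alpha m by less than 1. *)
Lemma rational_approx (M : nat) (delta : R) : 0 < delta ->
  exists m l : nat, [/\ (M <= m)%N, (M <= l)%N & `|alpha * m%:R - l%:R| < delta].
Proof.
move=> d0; pose M1 := maxn M (Num.truncn ((M.+1%:R + 1) / alpha)).+1.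
have M1M : (M <= M1)%N by rewrite leq_maxl.
have aM1 : M%:R + 1 < alpha * M1%:R.
  have h1 := truncnS_gt ((M.+1%:R + 1) / alpha).
  have h2 : (Num.truncn ((M.+1%:R + 1) / alpha)).+1%:R <= M1%:R :> R by rewrite ler_nat leq_maxr.
  have := lt_le_trans h1 h2; rewrite ltr_pdivrMr// [_ * alpha]mulrC; apply: lt_trans.
  by rewrite ltrD2r ltr_nat.
pose K := (Num.truncn (delta^-1)).+1.
have K0 : 0 < K%:R :> R by rewrite ltr0n.
have Kd : K%:R^-1 < delta by rewrite -[delta]invrK ltf_pV2 ?posrE ?invr_gt0//; exact: truncnS_gt.
pose y (j : nat) : R := alpha * (M1 * j)%:R.
have y0 j : 0 <= y j by rewrite mulr_ge0// ltW.
pose n j := Num.truncn (y j).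
pose fr j := y j - (n j)%:R.
have fr0 j : 0 <= fr j < 1.
  by have /andP[h1 h2] := truncn_itv (y0 j); rewrite subr_ge0 h1 ltrBlDl natr1 h2.
have tK (j : nat) : (Num.truncn (K%:R * fr j) < K)%N.
  have /andP[h1 h2] := fr0 j.
  by rewrite truncn_lt_nat ?mulr_ge0 ?(ltW K0)// -[ltRHS]mulr1 ltr_pM2l.
pose f (j : 'I_K.+1) : 'I_K := Ordinal (tK j).
have [i [j [ij fij]]] : exists i j : 'I_K.+1, (i < j)%N /\ f i = f j.
  have /injectivePn[i [j ij fij]] : ~~ injectiveb f.
    by apply/negP => /injectiveP/leq_card; rewrite !card_ord ltnn.
  have [h|h|h] := ltngtP i j; [by exists i, j|by exists j, i|].
  by move: ij; rewrite (ord_inj h) eqxx.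
have nij : (n i <= n j)%N.
  by apply: le_truncn; rewrite ler_wpM2l ?(ltW alpha0)// ler_nat leq_mul2l (ltnW ij) orbT.
have D : `|fr j - fr i| < delta.
  apply: lt_trans Kd; rewrite -[ltRHS]mul1r ltr_pdivlMr// -[X in _ * X]gtr0_norm// -normrM.
  have E : Num.truncn (K%:R * fr i) = Num.truncn (K%:R * fr j) by have := congr1 val fij.
  have Kfr (k : nat) : 0 <= K%:R * fr k by rewrite mulr_ge0 ?(ltW K0)//; case/andP: (fr0 k).
  have /andP[h1 h2] := truncn_itv (Kfr i).
  have /andP[h3 h4] := truncn_itv (Kfr j).
  rewrite E in h1 h2; rewrite -natr1 in h2 h4.
  by rewrite ltr_norml; apply/andP; split; lra.
exists (M1 * (j - i))%N, (n j - n i)%N.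
have ME : alpha * (M1 * (j - i))%:R - (n j - n i)%:R = fr j - fr i.
  by rewrite mulnBr !natrB// ?leq_mul2l ?(ltnW ij) ?orbT// /fr /y; ring.
have j1 : (0 < j - i)%N by rewrite subn_gt0.
split.
- by rewrite (leq_trans M1M)// leq_pmulr.
- rewrite -ltnS -(ltr_nat R) -natr1.
  have : alpha * M1%:R <= alpha * (M1 * (j - i))%:R by rewrite ler_pM2l// ler_nat leq_pmulr.
  have /andP[f1 f2] := fr0 i; have /andP[f3 f4] := fr0 j.
  move: aM1 ME; move: (alpha * M1%:R) (alpha * (_)%:R) (fr i) (fr j) f1 f2 f3 f4 => A B u v *.
  lra.
- by rewrite ME.
Qed.

(* The last equation says that k^2, with k = 2 u / pi, is an eigenvalue of L(0). *)
Lemma resonance (eps : R) (M : nat) : 0 < eps ->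
  exists m l : nat, exists u : R, [/\ (M <= m)%N, (M <= l)%N,
    `|u - pi * m%:R| <= eps, `|alpha * u - pi * l%:R| <= eps &
    sin u * cos (alpha * u) + a ^+ 2 * alpha * cos u * sin (alpha * u) = 0].
Proof.
move=> eps0.
have pi0 := pi_gt0 R.
pose e := Num.min eps 1.
have e0 : 0 < e by rewrite lt_min eps0/=.
have e_eps : e <= eps by rewrite ge_min lexx.
have e1 : e <= 1 by rewrite ge_min lexx orbT.
pose delta := Num.min e (alpha * e) / pi.
have [|m [l [Mm Ml d]]] := @rational_approx M delta.
  by rewrite divr_gt0// lt_min e0 mulr_gt0.
pose d0 := pi * (alpha * m%:R - l%:R).
have dd : `|d0| <= Num.min e (alpha * e).
  by rewrite normrM (gtr0_norm pi0) mulrC -ler_pdivlMr// ltW.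
have d1 : `|d0| <= e by apply: le_trans dd _; rewrite ge_min lexx.
have d2 : `|d0 / alpha| <= e.
  rewrite normrM normfV (gtr0_norm alpha0) ler_pdivrMr// mulrC.
  by apply: le_trans dd _; rewrite ge_min lexx orbT.
pose th := d0 / alpha.
(* Up to the sign (-1)^(m+l), this is the left-hand side of the eigenvalue equation at u = pi m - s
   th. As alpha th = d0, alpha u = pi l + (1 - s) d0: the path leads from u = pi m to alpha u = pi
   l. *)
pose h s := - sin (s * th) * cos (d0 + s * - d0) + a ^+ 2 * alpha * cos (s * th) * sin (d0 + s * - d0).
have hc : cont_on 0 1 h.
  have aff (p q : R) : cont_on 0 1 (fun s => p + s * q).
    apply: cont_on_continuous => x; apply: cvgD; first exact: cvg_cst.
    by apply: cvgM; [exact: cvg_id|exact: cvg_cst].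
  have lin (q : R) : cont_on 0 1 (fun s => s * q).
    by apply: cont_on_eq (aff 0 q) => x _; rewrite add0r.
  apply: cont_onD; apply: cont_onM.
  - exact/cont_onN/(cont_on_comp (lin _) (@continuous_sin R)).
  - exact: cont_on_comp (aff _ _) (@continuous_cos R).
  - apply: cont_onM; first exact: cont_on_cst.
    exact/(cont_on_comp (lin _) (@continuous_cos R)).
  - exact: cont_on_comp (aff _ _) (@continuous_sin R).
have pi2 : (2 : R) <= pi by exact: pi_ge2.
have sin_ge0 (x : R) : 0 <= x -> `|x| <= 1 -> 0 <= sin x.
  by move=> x0; rewrite ger0_norm// => x1; rewrite sin_ge0_pi// x0/=; lra.
have sin_le0 (x : R) : x <= 0 -> `|x| <= 1 -> sin x <= 0.
  by move=> x0 x1; rewrite -oppr_ge0 -sinN sin_ge0 ?oppr_ge0// normrN.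
have h0 : h 0 = a ^+ 2 * alpha * sin d0 by rewrite /h !mul0r sin0 cos0 addr0 oppr0 mul0r mulr1 add0r.
have h1 : h 1 = - sin th by rewrite /h !mul1r subrr sin0 cos0 mulr1 mulr0 addr0.
have A0 : 0 < a ^+ 2 * alpha by rewrite mulr_gt0// exprn_gt0.
have d1' := le_trans d1 e1; have d2' := le_trans d2 e1.
(* The end values are a positive multiple of sin d0 and - sin th. Since d0 and th have the same sign
   and size at most 1, these values have opposite signs; this is why [e] is capped by 1. *)
have [|s] := @IVT R h 0 1 0 ler01 hc.
  rewrite h0 h1 ge_min le_max oppr_le0 oppr_ge0 pmulr_rle0// pmulr_rge0//.
  have [dp|/ltW dn] := leP 0 d0.
    by rewrite (sin_ge0 _ dp d1') (sin_ge0 th)// ?orbT// divr_ge0// ltW.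
  by rewrite (sin_le0 _ dn d1') (sin_le0 th)// ?orbT// ler_pdivrMr// mul0r.
rewrite in_itv/= => /andP[s0 s1] hs.
exists m, l, (- (s * th) + pi * m%:R).
have lE : alpha * (- (s * th) + pi * m%:R) = d0 + s * - d0 + pi * l%:R.
  by rewrite /th /d0; field; rewrite gt_eqF.
split=> //.
- rewrite addrK normrN normrM (ger0_norm s0); apply: le_trans (le_trans d2 e_eps).
  by rewrite ler_piMl.
- rewrite lE addrK; have -> : d0 + s * - d0 = (1 - s) * d0 by ring.
  rewrite normrM ger0_norm ?subr_ge0//; apply: le_trans (le_trans d1 e_eps).
  by rewrite ler_piMl// gerBl.
- rewrite lE !sin_pi_natmul !cos_pi_natmul sinN cosN.
  transitivity ((-1) ^+ m * (-1) ^+ l * h s); last by rewrite hs mulr0.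
  by rewrite /h; ring.
Qed.
End recurrence.

(** * The scalar eigenfunction of L(0) near resonance *)

Section resonant_eigenfunction.
Variables (R : realType) (alpha a : R).
Hypotheses (alpha0 : 0 < alpha) (a0 : 0 < a).

Let pi2 : (0 : R) < pi / 2. Proof. by rewrite divr_gt0// pi_gt0. Qed.
Let pi2' : pi / 2 < (pi : R). Proof. by have := pi_gt0 R; lra. Qed.

(** The frequency k whose phase k pi / 2 across the left half is [u]; the phase across the right
    half is then alpha u. *)
Definition ref_freq (u : R) : R := 2 * u / pi.

(** Cosines centred at 0 and at pi meet the two Neumann conditions, and the factor cos u / cos(alpha
    u) makes the values agree at pi / 2. The jump factor is already divided out. *)
Definition ref_eigenfun (u x : R) : R :=
  if x < pi / 2 then cos (ref_freq u * x)
  else cos u / cos (alpha * u) * cos (ref_freq u * alpha * (x - pi)).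

Let ref_momentum (u x : R) : R :=
  if x < pi / 2 then - ref_freq u * sin (ref_freq u * x)
  else - (a ^+ 2 * (ref_freq u * alpha * (cos u / cos (alpha * u)))) * sin (ref_freq u * alpha * (x - pi)).

(** The values agree at pi / 2 by the choice of the amplitude; the momenta agree there by the
    equation assumed for u. *)
Lemma ref_scalar_eigen u : cos (alpha * u) != 0 ->
  sin u * cos (alpha * u) + a ^+ 2 * alpha * cos u * sin (alpha * u) = 0 ->
  scalar_eigen alpha a (ref_freq u ^+ 2) (ref_eigenfun u) (ref_momentum u).
Proof.
move=> cn0 res; pose k := ref_freq u; pose A := cos u / cos (alpha * u).
have pin0 : (pi : R) != 0 by rewrite gt_eqF// pi_gt0.
have kpi : k * (pi / 2) = u by rewrite /k /ref_freq; move: (@pi R) pin0 => p p0; field.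
have kpi' : k * alpha * (pi / 2 - pi) = - (alpha * u).
  by rewrite -kpi; move: (@pi R) => p; field.
have El x : x < pi / 2 -> ref_eigenfun u x = cos (k * x) by rewrite /ref_eigenfun => ->.
have Er x : pi / 2 <= x -> ref_eigenfun u x = A * cos (k * alpha * (x - pi)).
  by rewrite /ref_eigenfun ltNge => ->.
have Ml x : x < pi / 2 -> ref_momentum u x = - k * sin (k * x) by rewrite /ref_momentum => ->.
have Mr x : pi / 2 <= x -> ref_momentum u x = - (a ^+ 2 * (k * alpha * A)) * sin (k * alpha * (x - pi)).
  by rewrite /ref_momentum ltNge => ->.
have Em : ref_eigenfun u (pi / 2) = cos (k * (pi / 2)).
  by rewrite Er// kpi kpi' cosN divfK.
have Mm : ref_momentum u (pi / 2) = - k * sin (k * (pi / 2)).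
  rewrite Mr// kpi kpi' sinN /A.
  have -> : sin u = - (a ^+ 2 * alpha * cos u * sin (alpha * u)) / cos (alpha * u).
    by apply: (mulIf cn0); rewrite divfK//; apply/eqP; rewrite -subr_eq0 opprK res.
  by field.
have El' x : 0 <= x <= pi / 2 -> ref_eigenfun u x = cos (k * x).
  by move=> /andP[_]; rewrite le_eqVlt => /predU1P[->//|/El].
have Ml' x : 0 <= x <= pi / 2 -> ref_momentum u x = - k * sin (k * x).
  by move=> /andP[_]; rewrite le_eqVlt => /predU1P[->//|/Ml].
have an0 : a != 0 by rewrite gt_eqF.
split.
- apply: (prim_cat (ltW pi2) (ltW pi2')).
    apply: (prim_aer (f := fun t => - (k * 1) * sin (k * (t - 0)))).
    + apply: intg_jump2V; apply: (intg_eq (f := fun t => - k * sin (k * (t - 0)))).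
        by move=> x /Ml' ->; rewrite subr0.
      exact/cont_on_intg/cont_on_continuous/continuous_sin_affine.
    + by apply: (aeW _ (ae_neq 0)) => x _ /andP[x0 x1]; rewrite jumpl// Ml// expr1n divr1 mulr1 subr0.
    + apply: prim_eql (prim_cos_affine 1 k 0 (ltW pi2)) => x /El' ->.
      by rewrite mul1r subr0.
  apply: prim_eqr (prim_eql _ (prim_cos_affine A (k * alpha) pi (ltW pi2'))) => x /andP[x1 _].
    by rewrite Mr// jumpr//; field.
  by rewrite Er.
- apply: (prim_cat (ltW pi2) (ltW pi2')).
    apply: (prim_aer (f := fun t => k * - k * cos (k * (t - 0)))).
    + apply: (intg_eq (f := fun x => - (k ^+ 2 * (jump a x ^+ 2 * rho alpha x)) * cos (k * (x - 0)))).
        by move=> x /El' ->; rewrite subr0 -/k; ring.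
      apply: intgM_cont; last first.
        apply: cont_on_eq (cont_on_continuous (@continuous_cos_affine R 1 k 0)) => x _.
        by rewrite mul1r.
      apply/intgN/intgZ; apply: intg_sub (intg_weight alpha a) => //; exact: ltW.
    + apply: (aeW _ (ae_neq 0)) => x _ /andP[x0 x1]; rewrite jumpl// rhol// El// subr0 -/k; ring.
    + apply: prim_eql (prim_sin_affine (- k) k 0 (ltW pi2)) => x /Ml' ->.
      by rewrite subr0.
  apply: prim_eqr (prim_eql _ (prim_sin_affine (- (a ^+ 2 * (k * alpha * A))) (k * alpha) pi (ltW pi2'))) => x /andP[x1 _].
    by rewrite Er// jumpr// rhor// -/k; ring.
  by rewrite Mr.
- by rewrite El// mulr0 cos0.
- by rewrite Ml// mulr0 sin0 mulr0.
- by rewrite Mr 1?ltW// subrr mulr0 sin0 mulr0.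
Qed.

(** By the double angle formula phi^2 is a constant plus a cosine. Moving its frequency to 4m or 4l
    costs 2 eps. On the right the squared amplitude is within eps of 1, because the squares of cos u
    and cos(alpha u) are near 1; this accounts for the third eps. *)
Lemma ref_eigenfun_sqr u (m l : nat) eps : 0 < eps -> eps <= 2^-1 ->
  `|u - pi * m%:R| <= eps -> `|alpha * u - pi * l%:R| <= eps ->
  forall x, 0 <= x <= pi ->
  `|ref_eigenfun u x ^+ 2 - (2^-1 + 2^-1 * (if x < pi / 2 then cos (4 * m%:R * x) else cos (4 * l%:R * x)))|
     <= 3 * eps /\ `|ref_eigenfun u x| <= 2.
Proof.
move=> e0 e1 um ul x /andP[x0 xp].
have pi0 := pi_gt0 R; have pin0 : (pi : R) != 0 by rewrite gt_eqF.
have cos_sq y : cos y ^+ 2 = 2^-1 + 2^-1 * cos (2 * y) :> R.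
  by rewrite mulr_natl cos_mulr2n; lra.
have near (v : R) (n : nat) t : `|v - pi * n%:R| <= eps -> `|t| <= pi ->
    `|cos (4 * v / pi * t) - cos (4 * n%:R * t)| <= 4 * eps.
  move=> vn tp; apply: le_trans (cos_lipschitz _ _) _.
  have -> : 4 * v / pi * t - 4 * n%:R * t = 4 * ((v - pi * n%:R) * (t / pi)).
    by move: (@pi R) pin0 => p p0; field.
  rewrite normrM ger0_norm// ler_pM2l// normrM; apply: le_trans vn.
  by rewrite ler_piMr// normrM normfV (gtr0_norm pi0) ler_pdivrMr// mul1r.
rewrite /ref_eigenfun; have [x2|x2] := ltP x (pi / 2).
  split; last by rewrite (le_trans (cos_max _))// ler1n.
  rewrite cos_sq.
  have := @near u m x um; rewrite ger0_norm// => /(_ xp).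
  have -> : 2 * (ref_freq u * x) = 4 * u / pi * x by rewrite /ref_freq; ring.
  rewrite !ler_norml; move: (cos _) (cos _) => p q; lra.
have /andP[a1 a2] := cos_sqr_near um; have /andP[b1 b2] := cos_sqr_near ul.
set A := cos u / cos (alpha * u).
have e2 : eps ^+ 2 <= 2^-1 * eps by rewrite expr2 ler_wpM2r// ltW.
have e20 : 0 <= eps ^+ 2 by exact: sqr_ge0.
have cl : 0 < cos (alpha * u) ^+ 2 by lra.
have A2 : `|A ^+ 2 - 1| <= eps.
  have -> : A ^+ 2 = cos u ^+ 2 / cos (alpha * u) ^+ 2 by rewrite /A expr_div_n.
  rewrite ler_norml lerBlDr lerBrDr ler_pdivrMr// ler_pdivlMr//.
  move: (cos u ^+ 2) (cos (alpha * u) ^+ 2) (eps ^+ 2) e2 e20 a1 a2 b1 b2 {um ul near cl} => s c f *.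
  by apply/andP; split; nra.
split.
  rewrite exprMn cos_sq.
  have := @near (alpha * u) l (x - pi) ul; rewrite ler_norml => /(_ _)/wrap[|].
    by apply/andP; split; lra.
  have -> : 2 * (ref_freq u * alpha * (x - pi)) = 4 * (alpha * u) / pi * (x - pi).
    by rewrite /ref_freq; ring.
  have -> : cos (4 * l%:R * x) = cos (4 * l%:R * (x - pi)).
    rewrite -[4 * l%:R * x](_ : 4 * l%:R * (x - pi) + pi * (4 * l)%:R = _); last by rewrite natrM; ring.
    by rewrite cos_pi_natmul mulnC exprM (_ : (-1) ^+ l ^+ 4 = 1) ?mul1r// -exprM mulnC exprM -[4%N]/(2 * 2)%N exprM sqrrN !expr1n.
  move: A2 (cos_max (4 * (alpha * u) / pi * (x - pi))); rewrite !ler_norml.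
  move: (cos _) (cos _) (A ^+ 2) => p q B; nra.
rewrite -(@ler_pXn2r _ 2)// ?nnegrE// real_normK ?num_real// exprMn.
have A22 : A ^+ 2 <= 2 by move: A2; rewrite ler_norml; lra.
have := ler_pM (sqr_ge0 A) (sqr_ge0 (cos (ref_freq u * alpha * (x - pi)))) A22 (_ : _ <= 1).
rewrite cos_sq mulr1 => /(_ _)/wrap[|h]; last by apply: le_trans h _; lra.
by have := cos_max (2 * (ref_freq u * alpha * (x - pi))); rewrite ler_norml; lra.
Qed.
End resonant_eigenfunction.

(** * Vanishing of the weighted mean *)

Section mean_zero.
Variables (R : realType) (N : nat) (alpha a : R).
Hypotheses (alpha0 : 0 < alpha) (a0 : 0 < a).
Variable q : 'I_N -> 'I_N -> R -> R.
Hypothesis qi : forall j k, intg 0 pi (q j k).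
Hypothesis q2i : forall j k, intg 0 pi (fun x => q j k x ^+ 2).
Hypothesis eigenq : forall lam phi psi, scalar_eigen alpha a lam phi psi ->
  forall j0, exists Z V, wsol alpha a q lam Z V /\
    forall j, [/\ Z j 0 = (j == j0)%:R, V j 0 = 0 & V j pi = 0].

Lemma Int_q_eq0 i j : Int 0 pi (q i j) = 0.
Proof.
have pi0 := pi_gt0 R.
pose K1 : R := \sum_k Int 0 pi (fun t => `|q i k t|).
pose K2 : R := Int 0 pi (fun t => `|q i j t|).
have K10 : 0 <= K1 by apply: sumr_ge0 => k _; exact: Int_ge0.
have K20 : 0 <= K2 by exact: Int_ge0.
have [C C0 asym] := eigen_asymptotic alpha0 a0 qi.
(* The halves oscillate with unrelated frequencies m and l, so the Riemann-Lebesgue lemma is applied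
   to each half extended by zero. *)
pose f1 x := q i j x * (if x < pi / 2 then 1 else 0).
pose f2 x := q i j x * (if x < pi / 2 then 0 else 1).
have f1i : intg 0 pi f1 by exact: intg_step.
have f2i : intg 0 pi f2 by exact: intg_step.
have f1i2 : intg 0 pi (fun x => f1 x ^+ 2).
  apply: intg_eq (intg_step (pi / 2) 1 0 (q2i i j)) => x _.
  by rewrite /f1; case: ifP; rewrite ?mulr1 ?mulr0 ?expr0n.
have f2i2 : intg 0 pi (fun x => f2 x ^+ 2).
  apply: intg_eq (intg_step (pi / 2) 0 1 (q2i i j)) => x _.
  by rewrite /f2; case: ifP; rewrite ?mulr1 ?mulr0 ?expr0n.
have cc n : cont_on 0 pi (fun x : R => cos (4 * n%:R * x)).
  apply: cont_on_eq (cont_on_continuous (@continuous_cos_affine R 1 (4 * n%:R) 0)) => x _.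
  by rewrite mul1r subr0.
(* [eta] bounds the phase errors, the oscillating integrals and C / k simultaneously. It runs
   through 2^-(n+1), where the shift keeps it at most 1/2. *)
suff main eta : 0 < eta -> eta <= 2^-1 -> `|Int 0 pi (q i j)| <= eta * (6 * K2 + 8 * K1 + 2).
  apply/eqP; rewrite -normr_le0; apply: (@geom_le0 _ (6 * K2 + 8 * K1 + 2)) => n.
  apply: le_trans (main ((2^-1) ^+ n.+1) _ _) _.
  - by rewrite exprn_gt0.
  - by rewrite exprS ler_piMr// exprn_ile1// invf_le1// ler1n.
  - rewrite mulrC ler_wpM2l ?addr_ge0 ?mulr_ge0// exprS ler_piMl ?exprn_ge0//.
    by rewrite invf_le1// ler1n.
move=> eta0 eta1.
have /cvgrPdist_le/(_ _ eta0)[M1 _ H1] := riemann_lebesgue_cos4 f1i f1i2.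
have /cvgrPdist_le/(_ _ eta0)[M2 _ H2] := riemann_lebesgue_cos4 f2i f2i2.
(* Indices beyond [M] pass both Riemann-Lebesgue thresholds; moreover k = 2 u / pi is at least m, so
   k exceeds 1, C and C / eta. *)
pose M := maxn (maxn M1 M2) (Num.truncn (1 + C + C / eta)).+1.
have [m [l [u [Mm Ml um ul res]]]] := resonance alpha0 a0 M eta0.
pose phi := ref_eigenfun alpha u.
have cosu : cos (alpha * u) != 0.
  have /andP[h _] := cos_sqr_near ul; apply/eqP => c0; move: h; rewrite c0 expr0n/= leNgt.
  by apply/negP; nra.
have se := ref_scalar_eigen a0 cosu res; rewrite -/phi in se.
have [Z [V [ws Z0]]] := eigenq se j.
pose k := ref_freq u.
have kM : 1 + C + C / eta <= k.
  have mM : (Num.truncn (1 + C + C / eta)).+1%:R <= m%:R :> R.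
    by rewrite ler_nat (leq_trans _ Mm)// leq_maxr.
  have := truncnS_gt (1 + C + C / eta) => h.
  have m1 : 1 <= m%:R :> R by rewrite ler1n (leq_trans _ Mm)// leq_max ltnS leq0n orbT.
  apply: le_trans (ltW (lt_le_trans h mM)) _.
  rewrite /k /ref_freq ler_pdivlMr//; move: um; rewrite ler_norml => /andP[um _].
  have : pi * 1 <= pi * m%:R :> R by rewrite ler_pM2l.
  have := pi_ge2 R; rewrite mulr1 [m%:R * pi]mulrC; move: (pi * m%:R) um => w.
  by move: (@pi R) => p; lra.
have Ce : 0 <= C / eta by rewrite divr_ge0// ltW.
have k1 : 1 <= k by apply: le_trans kM; rewrite -addrA lerDl addr_ge0.
have Ck : C <= k by apply: le_trans kM; lra.
have k0 : 0 < k by exact: lt_le_trans k1.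
have Ck' : C / k <= eta.
  rewrite ler_pdivrMr// -ler_pdivrMl// mulrC; apply: le_trans kM; lra.
have PP x xp := ref_eigenfun_sqr eta0 eta1 um ul (x := x) xp.
have phi2 x : 0 <= x <= pi -> `|phi x| <= 2 by move=> /PP[].
have Z01 l0 : Z l0 0 = (l0 == j)%:R /\ V l0 0 = 0 by have [] := Z0 l0.
have Z02 l0 : V l0 0 = 0 /\ V l0 pi = 0 by have [] := Z0 l0.
have AS := asym k 2 phi _ Z V j k1 Ck (ler0n R 2) phi2 se ws Z01.
have phic : cont_on 0 pi phi by have [/prim_cont] := se.
have Zc l0 : cont_on 0 pi (Z l0) := prim_cont (ws l0).1.
have gr := green_phi se ws Z02 i.
pose err x := phi x ^+ 2 - (2^-1 + 2^-1 * (if x < pi / 2 then cos (4 * m%:R * x) else cos (4 * l%:R * x))).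
pose rest x := phi x * \sum_l0 q i l0 x * (Z l0 x - (l0 == j)%:R * phi x).
(* Multiply 1 = 2 phi^2 - cos - 2 err by q_ij, and write phi q_ij as (q Z)_i minus the contribution
   of the errors Z_l - delta_lj phi. The leading term integrates to zero by [green_phi]. *)
have E x : q i j x = 2 * (phi x * \sum_l0 q i l0 x * Z l0 x) - 2 * rest x
   - (f1 x * cos (4 * m%:R * x)) - f2 x * cos (4 * l%:R * x) - 2 * (q i j x * err x).
  have -> : \sum_l0 q i l0 x * Z l0 x = \sum_l0 q i l0 x * (Z l0 x - (l0 == j)%:R * phi x) + q i j x * phi x.
    rewrite (bigD1 j)//= [in RHS](bigD1 j)//= eqxx mul1r.
    have -> : \sum_(i0 < N | i0 != j) q i i0 x * (Z i0 x - (i0 == j)%:R * phi x) = \sum_(i0 < N | i0 != j) q i i0 x * Z i0 x.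
      by apply: eq_bigr => l0 /negPf ->; rewrite mul0r subr0.
    ring.
  by rewrite /rest /err /f1 /f2; case: ifP => _; field.
have phi2c : cont_on 0 pi (fun x => phi x * phi x) by exact: cont_onM.
have i1 : intg 0 pi (fun x => phi x * \sum_l0 q i l0 x * Z l0 x).
  apply: (intg_eq (f := fun x => (\sum_l0 q i l0 x * Z l0 x) * phi x)) => [x _|]; first exact: mulrC.
  by apply: intgM_cont => //; apply: intg_sum => l0 _; exact: intgM_cont.
have resti : intg 0 pi rest.
  apply: (intg_eq (f := fun x => (\sum_l0 q i l0 x * (Z l0 x + - ((l0 == j)%:R * phi x))) * phi x)) => [x _|]; first exact: mulrC.
  apply: intgM_cont => //; apply: intg_sum => l0 _; apply: intgM_cont => //.
  by apply: cont_onD => //; apply: cont_onN; apply: cont_onM => //; exact: cont_on_cst.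
have i2 : intg 0 pi (fun x => f1 x * cos (4 * m%:R * x)) by exact: intgM_cont.
have i3 : intg 0 pi (fun x => f2 x * cos (4 * l%:R * x)) by exact: intgM_cont.
have i4 : intg 0 pi (fun x => q i j x * err x).
  apply: (intg_eq (f := fun x => q i j x * (phi x * phi x) - 2^-1 * q i j x - 2^-1 * (f1 x * cos (4 * m%:R * x) + f2 x * cos (4 * l%:R * x)))).
    by move=> x _; rewrite /err /f1 /f2; case: ifP => _; ring.
  by apply: intgB; [apply: intgB; [exact: intgM_cont|exact: intgZ]|apply: intgZ; exact: intgD].
have b1 : `|Int 0 pi rest| <= 4 * eta * K1.
  apply: le_trans (norm_Int_le resti) _.
  have -> : K1 = Int 0 pi (fun t => \sum_k `|q i k t|) by rewrite Int_sum// => l0 _; exact: intg_norm.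
  have si : intg 0 pi (fun t => \sum_k `|q i k t|) by apply: intg_sum => l0 _; exact: intg_norm.
  rewrite -IntZ//; apply: le_Int => [||x xp]; [exact: intg_norm|exact: intgZ|].
  rewrite /rest normrM -mulrA.
  have h : `|\sum_l0 q i l0 x * (Z l0 x - (l0 == j)%:R * phi x)| <= 2 * (eta * \sum_l0 `|q i l0 x|).
    apply: le_trans (ler_norm_sum _ _ _) _; rewrite !mulr_sumr; apply: ler_sum => l0 _.
    rewrite normrM mulrC mulrA ler_wpM2r//; apply: le_trans (AS l0 x xp) _.
    by rewrite mulrAC mulrC ler_pM2l.
  apply: (@le_trans _ _ (2 * (2 * (eta * \sum_l0 `|q i l0 x|)))); last by rewrite mulrA -natrM.
  by apply: ler_pM => //; exact: phi2.
have b2 : `|Int 0 pi (fun x => f1 x * cos (4 * m%:R * x))| <= eta.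
  have := H1 m; rewrite sub0r normrN; apply.
  by rewrite /= (leq_trans _ Mm)// /M -maxnA leq_maxl.
have b3 : `|Int 0 pi (fun x => f2 x * cos (4 * l%:R * x))| <= eta.
  have := H2 l; rewrite sub0r normrN; apply.
  by rewrite /= (leq_trans _ Ml)// /M (maxnC M1) -maxnA leq_maxl.
have b4 : `|Int 0 pi (fun x => q i j x * err x)| <= 3 * eta * K2.
  apply: le_trans (norm_Int_le i4) _; rewrite -IntZ; last exact: intg_norm.
  apply: le_Int => [||x xp]; [exact: intg_norm|exact/intgZ/intg_norm|].
  by rewrite normrM mulrC ler_wpM2r//; have [] := PP x xp.
have -> : Int 0 pi (q i j) = 2 * Int 0 pi (fun x => phi x * \sum_l0 q i l0 x * Z l0 x) - 2 * Int 0 pi rest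
   - Int 0 pi (fun x => f1 x * cos (4 * m%:R * x)) - Int 0 pi (fun x => f2 x * cos (4 * l%:R * x))
   - 2 * Int 0 pi (fun x => q i j x * err x).
  have j1 := intgB (intgZ 2 i1) (intgZ 2 resti); have j2 := intgB j1 i2; have j3 := intgB j2 i3.
  rewrite -[2 * Int _ _ (fun x => q i j x * _)]IntZ// -[2 * Int _ _ rest]IntZ// -[2 * Int _ _ (fun x => phi x * _)]IntZ//.
  by rewrite -IntB; [|exact: intgZ..]; rewrite -IntB// -IntB// -IntB; [|by []|exact: intgZ]; apply: eq_Int => x _; exact: E.
rewrite gr mulr0; move: b1 b2 b3 b4.
move: (Int 0 pi rest) (Int 0 pi (fun x => f1 x * _)) (Int 0 pi (fun x => f2 x * _)) (Int 0 pi (fun x => q i j x * err x)) => A B B' D.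
by move: K1 K2 {K10 K20} => {}K1 {}K2; rewrite !ler_norml; lra.
Qed.
End mean_zero.

(** * The quadratic form *)

Section quadratic_form.
Variables (R : realType) (N : nat) (alpha a : R).
Hypotheses (alpha0 : 0 < alpha) (a0 : 0 < a).
Variable q : 'I_N -> 'I_N -> R -> R.
Hypothesis qi : forall i j, intg 0 pi (q i j).
Hypothesis qsym : forall i j, q i j = q j i.
Local Notation mu := (@lebesgue_measure R).
Implicit Types (lam : R) (Z V X W g : 'I_N -> R -> R).
Local Notation r x := (jump a x ^+ 2 * rho alpha x).

(** Trial functions with momentum V = [jump]^2 Z'. No boundary values are prescribed, the Neumann
    conditions being natural for the form; continuity of V keeps the integrands integrable. *)
Definition tpair Z V := forall i,
  prim 0 pi (Z i) (fun x => V i x / jump a x ^+ 2) /\ cont_on 0 pi (V i).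

(** Integrand of the bilinear form of L(Q) - lam after the substitution; V W / [jump]^2 stands for
    [jump]^2 Z' X'. *)
Definition density lam Z V X W x := \sum_i (V i x * W i x / jump a x ^+ 2
  + (\sum_j q i j x * Z j x) * X i x - lam * r x * (Z i x * X i x)).

Definition form lam Z V X W := Int 0 pi (density lam Z V X W).

Definition mass Z := Int 0 pi (fun x => \sum_i r x * (Z i x * Z i x)).

Lemma tpair_cont Z V i : tpair Z V -> cont_on 0 pi (Z i).
Proof. by move=> /(_ i)[/prim_cont]. Qed.

Lemma weight_bounds x : 0 <= r x /\ r x <= 1 + a ^+ 2 * alpha ^+ 2.
Proof.
have h : 0 <= a ^+ 2 * alpha ^+ 2 by rewrite mulr_ge0 ?sqr_ge0.
have [x2|x2] := ltP x (pi / 2); first by rewrite jumpl// rhol// expr1n mul1r ler01 lerDl.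
by rewrite jumpr// rhor//; split=> //; rewrite lerDr.
Qed.

Lemma density_intg lam Z V X W : tpair Z V -> tpair X W -> intg 0 pi (density lam Z V X W).
Proof.
move=> ZV XW; apply: intg_sum => i _; apply: intgB; first apply: intgD.
- by apply/intg_jump2V/cont_on_intg/cont_onM; [exact: (ZV i).2|exact: (XW i).2].
- by apply: (intgM_cont _ (tpair_cont XW)); apply: intg_sum => j _; exact: intgM_cont _ (tpair_cont ZV).
- apply: intgM_cont; first exact/intgZ/intg_weight.
  by apply: cont_onM; [exact: tpair_cont ZV|exact: tpair_cont XW].
Qed.

Lemma mass_intg Z V : tpair Z V -> intg 0 pi (fun x => \sum_i r x * (Z i x * Z i x)).
Proof.
move=> ZV; apply: intg_sum => i _; apply: intgM_cont; first exact: intg_weight.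
by apply: cont_onM; exact: tpair_cont ZV.
Qed.

Lemma mass_ge0 Z : 0 <= mass Z.
Proof.
by apply: Int_ge0 => x _; apply: sumr_ge0 => i _; rewrite mulr_ge0 ?(weight_bounds x).1// -expr2 sqr_ge0.
Qed.

Lemma tpairD t Z V X W : tpair Z V -> tpair X W ->
  tpair (fun i x => Z i x + t * X i x) (fun i x => V i x + t * W i x).
Proof.
move=> ZV XW i; have [h1 h2] := ZV i; have [h3 h4] := XW i; split.
  by apply: prim_eqr (primD h1 (primZ t h3)) => x _; rewrite mulrDl mulrA.
by apply: cont_onD => //; apply: cont_onM => //; exact: cont_on_cst.
Qed.

Lemma form_sym lam Z V X W : form lam Z V X W = form lam X W Z V.
Proof.
apply: eq_Int => x _; rewrite /density !(sumrB, big_split)/=; congr (_ + _ - _).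
- by apply: eq_bigr => i _; rewrite (mulrC (V i x)).
- under eq_bigr do rewrite mulr_suml.
  under [RHS]eq_bigr do rewrite mulr_suml.
  rewrite exchange_big/=; apply: eq_bigr => i _; apply: eq_bigr => j _.
  by rewrite qsym; ring.
- by apply: eq_bigr => i _; ring.
Qed.

Lemma formD lam t Z V X W : tpair Z V -> tpair X W ->
  form lam (fun i x => Z i x + t * X i x) (fun i x => V i x + t * W i x)
    (fun i x => Z i x + t * X i x) (fun i x => V i x + t * W i x) =
  form lam Z V Z V + 2 * t * form lam Z V X W + t ^+ 2 * form lam X W X W.
Proof.
move=> ZV XW.
have -> : 2 * t * form lam Z V X W = t * (form lam Z V X W + form lam X W Z V).
  by rewrite (form_sym lam X); ring.
have i1 := density_intg lam ZV ZV; have i2 := density_intg lam ZV XW.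
have i3 := density_intg lam XW ZV; have i4 := density_intg lam XW XW.
rewrite /form -IntD// -IntZ; last exact: intgD.
rewrite -IntD//; last exact/intgZ/intgD.
rewrite -IntZ// -IntD; [|by apply: intgD => //; exact/intgZ/intgD|exact: intgZ].
apply: eq_Int => x _; rewrite /density mulrDr !mulr_sumr -!big_split/=.
apply: eq_bigr => i _.
have -> : \sum_j q i j x * (Z j x + t * X j x) = \sum_j q i j x * Z j x + t * \sum_j q i j x * X j x.
  by rewrite mulr_sumr -big_split/=; apply: eq_bigr => j _; ring.
ring.
Qed.

Lemma form_shift lam d Z V : tpair Z V -> form (lam + d) Z V Z V = form lam Z V Z V - d * mass Z.
Proof.
move=> ZV; rewrite /form /mass -IntZ; last exact: mass_intg ZV.
rewrite -IntB; [|exact: density_intg|by apply: intgZ; exact: mass_intg ZV].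
apply: eq_Int => x _; rewrite /density mulr_sumr -sumrB; apply: eq_bigr => i _; ring.
Qed.

(** Integration by parts of sum Z_i W_i, whose boundary terms vanish with W. Thus a Neumann solution
    with source g represents the functional - Int g Z in the form. *)
Lemma form_wsolf lam g X W Z V : (forall i, intg 0 pi (g i)) -> wsolf alpha a q lam g X W ->
  (forall i, W i 0 = 0 /\ W i pi = 0) -> tpair Z V ->
  form lam X W Z V = - Int 0 pi (fun x => \sum_i g i x * Z i x).
Proof.
move=> gi XW W0 ZV.
have XWt : tpair X W by move=> i; split; [exact: (XW i).1|exact: prim_cont (XW i).2].
have P : prim 0 pi (fun x => \sum_i Z i x * W i x) (fun x => \sum_i (V i x / jump a x ^+ 2 * W i x
    + Z i x * (\sum_k q i k x * X k x - lam * r x * X i x + g i x))).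
  by apply: prim_sum; [exact: pi_ge0|move=> i; exact: prim_mul (pi_ge0 R) (ZV i).1 (XW i).2].
have gZi : intg 0 pi (fun x => \sum_i g i x * Z i x).
  by apply: intg_sum => i _; exact: intgM_cont (gi i) (tpair_cont ZV).
apply/eqP; rewrite -addr_eq0 /form -IntD//; last exact: density_intg.
have := primB P (lexx 0) (pi_ge0 R) (lexx pi).
rewrite !big1 ?subrr; last 2 first.
- by move=> i _; rewrite (W0 i).1 mulr0.
- by move=> i _; rewrite (W0 i).2 mulr0.
move=> e; apply/eqP; rewrite [RHS]e; apply: eq_Int => x _.
rewrite /density -big_split/=; apply: eq_bigr => i _; ring.
Qed.

(** Expresses that lam is not an eigenvalue: together with V(0) = 0, the condition Z(0) = 0
    determines the zero solution. *)
Definition Neumann_injective lam := forall Z V, wsol alpha a q lam Z V ->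
  (forall i, V i 0 = 0 /\ V i pi = 0) -> forall i, Z i 0 = 0.

(** Shooting. The matrix [D] of final momenta of the solutions starting at (e_l, 0) is invertible by
    injectivity, and subtracting a suitable combination of them from a particular solution achieves
    W(pi) = 0. The constant depends on q and lam, not on g. *)
Lemma resolvent lam : Neumann_injective lam -> exists2 C, 0 <= C &
  forall g, (forall i, intg 0 pi (g i)) -> exists X W, [/\ wsolf alpha a q lam g X W,
    forall i, W i 0 = 0 /\ W i pi = 0 &
    forall i x, 0 <= x <= pi -> `|X i x| <= C * Int 0 pi (fun t => \sum_k `|g k t|)].
Proof.
move=> inj; have [C C0 B] := wsolf_bound alpha a lam qi.
have /choice[Phi PhiP] (l : 'I_N) : exists ZV : ('I_N -> R -> R) * ('I_N -> R -> R),
    wsol alpha a q lam ZV.1 ZV.2 /\ forall j, ZV.1 j 0 = (j == l)%:R /\ ZV.2 j 0 = 0.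
  have [Z [V [/wsolf0 H H0]]] := wsolf_exists alpha a lam (fun j => (j == l)%:R) (fun=> 0) qi
    (fun=> intg_cst 0 pi 0).
  by exists (Z, V).
pose D := \matrix_(l < N, i < N) (Phi l).2 i pi.
have DE (u : 'rV_N) i : (u *m D) 0 i = \sum_l u 0 l * (Phi l).2 i pi.
  by rewrite mxE; apply: eq_bigr => l _; rewrite mxE.
have Dunit : D \in unitmx.
  rewrite -row_free_unit -kermx_eq0; apply/rowV0P => u /sub_kermxP uD; apply/rowP => i; rewrite mxE.
  have := inj _ _ (wsol_sum (index_enum 'I_N) (u 0) (fun l => (PhiP l).1)) _ i.
  rewrite (bigD1 i)//= big1 ?addr0; last first.
    by move=> l /negbTE li; rewrite ((PhiP l).2 i).1 eq_sym li mulr0.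
  rewrite ((PhiP i).2 i).1 eqxx mulr1; apply=> j; split.
    by rewrite big1// => l _; rewrite ((PhiP l).2 j).2 mulr0.
  by rewrite -DE uD mxE.
pose kap : R := \sum_i \sum_l `|invmx D l i|.
have kap0 : 0 <= kap by apply: sumr_ge0 => i _; apply: sumr_ge0.
exists (C * (C * kap + 1)); first by rewrite mulr_ge0// addr_ge0// mulr_ge0.
move=> g gi; pose G := Int 0 pi (fun t => \sum_k `|g k t|).
have G0 : 0 <= G by apply: Int_ge0 => t _; apply: sumr_ge0.
have [P [T [PT PT0]]] := wsolf_exists alpha a lam (fun=> 0) (fun=> 0) qi gi.
pose c : 'rV_N := - (\row_i T i pi) *m invmx D.
pose X i x := P i x + \sum_l c 0 l * (Phi l).1 i x.
pose W i x := T i x + \sum_l c 0 l * (Phi l).2 i x.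
have XW : wsolf alpha a q lam g X W.
  have /wsolf0 h := wsol_sum (index_enum 'I_N) (c 0) (fun l => (PhiP l).1).
  move=> i; have [h1 h2] := wsolfD PT h i; split=> //.
  by apply: prim_eqr h2 => x _; rewrite addr0.
have X0 i : X i 0 = c 0 i.
  rewrite /X (PT0 i).1 add0r (bigD1 i)//= big1 ?addr0 ?((PhiP i).2 i).1 ?eqxx ?mulr1//.
  by move=> l /negbTE li; rewrite ((PhiP l).2 i).1 eq_sym li mulr0.
have W0 i : W i 0 = 0.
  by rewrite /W (PT0 i).2 add0r big1// => l _; rewrite ((PhiP l).2 i).2 mulr0.
exists X, W; split=> // [i|i x xp].
  by split=> //; rewrite /W -DE /c mulmxKV// !mxE subrr.
have [h _] := B _ _ _ gi XW x i xp; apply: le_trans h _.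
rewrite -/G -mulrA ler_wpM2l// mulrDl mul1r lerD2r.
have TC l : `|T l pi| <= C * G.
  have [|_] := B _ _ _ gi PT pi l; first by rewrite pi_ge0 lexx.
  by rewrite big1 ?add0r// => k _; rewrite (PT0 k).1 (PT0 k).2 normr0 addr0.
rewrite mulrAC /kap mulr_sumr; apply: ler_sum => k _.
rewrite X0 W0 normr0 addr0 /c mxE mulr_sumr; apply: le_trans (ler_norm_sum _ _ _) _.
by apply: ler_sum => l _; rewrite normrM ler_wpM2r// !mxE normrN.
Qed.

Lemma sum_sqr_le (b : 'I_N -> R) : (\sum_i b i) ^+ 2 <= 2 * N%:R * \sum_i b i ^+ 2.
Proof.
have -> : (\sum_i b i) ^+ 2 = \sum_i \sum_j b i * b j.
  by rewrite expr2 mulr_suml; apply: eq_bigr => i _; rewrite mulr_sumr.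
have -> : 2 * N%:R * \sum_i b i ^+ 2 = \sum_i \sum_j (b i ^+ 2 + b j ^+ 2).
  have E i : \sum_j (b i ^+ 2 + b j ^+ 2) = N%:R * b i ^+ 2 + \sum_j b j ^+ 2.
    by rewrite big_split/= sumr_const card_ord mulr_natl.
  rewrite [RHS](eq_bigr _ (fun i _ => E i)) big_split/= -mulr_sumr sumr_const card_ord.
  by rewrite -[X in _ + X]mulr_natl; ring.
by apply: ler_sum => i _; apply: ler_sum => j _; nra.
Qed.

(** Cauchy-Schwarz against 1, from the nonnegative integral of the squared deviation from the mean
    [m]. *)
Lemma Int_sqr_le (h : R -> R) : intg 0 pi h -> intg 0 pi (fun x => h x ^+ 2) ->
  (Int 0 pi h) ^+ 2 <= pi * Int 0 pi (fun x => h x ^+ 2).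
Proof.
move=> hi h2i; pose m := Int 0 pi h / pi.
have pi0 := pi_gt0 R.
have : 0 <= Int 0 pi (fun x => (h x - m) ^+ 2) by apply: Int_ge0 => x _; exact: sqr_ge0.
have E x : (h x - m) ^+ 2 = h x ^+ 2 - 2 * m * h x + m ^+ 2 by ring.
rewrite (eq_Int (fun x _ => E x)) IntD; [|by apply: intgB => //; exact: intgZ|exact: intg_cst].
rewrite IntB//; last exact: intgZ.
rewrite IntZ// Int_cst ?pi_ge0// subr0.
have -> : Int 0 pi h = m * pi by rewrite /m divfK// gt_eqF.
have SE : exists S, S = Int 0 pi (fun x => h x ^+ 2) by eexists.
have [S SE'] := SE; rewrite -SE'; clearbody m.
by move: (@pi R) pi0 => {E SE SE' hi h2i} p p0; nra.
Qed.

(** Let X be the Neumann solution with source - r Z, so that form(X, Z) = mass Z and form(X, X) <= K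
    mass Z. Nonnegativity of the form at X - K Z then gives K^2 form(Z, Z) >= K mass Z. *)
Lemma form_gap lam : Neumann_injective lam ->
  (forall Z V, tpair Z V -> 0 <= form lam Z V Z V) ->
  exists2 d, 0 < d & forall Z V, tpair Z V -> d * mass Z <= form lam Z V Z V.
Proof.
move=> inj pos; have [C C0 res] := resolvent inj.
have pi0 := pi_gt0 R.
pose rm := 1 + a ^+ 2 * alpha ^+ 2.
have rm0 : 0 <= rm by rewrite addr_ge0// mulr_ge0 ?sqr_ge0.
(* [C] is the resolvent bound, pi comes from Cauchy-Schwarz on (0, pi), 2 N from the sum over
   components, and [rm] bounds the weight; the summand 1 makes [K] positive. *)
pose K := 1 + C * (pi * (2 * N%:R * rm)).
have K0 : 0 < K by rewrite ltr_pwDl// !mulr_ge0// ltW.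
exists K^-1; first by rewrite invr_gt0.
move=> Z V ZV; pose g i x := - (r x * Z i x).
have gi i : intg 0 pi (g i).
  by apply: intgN; apply: (intgM_cont _ (tpair_cont ZV)); exact: intg_weight.
have [X [W [XW W0 XB]]] := res g gi.
have XWt : tpair X W by move=> i; split; [exact: (XW i).1|exact: prim_cont (XW i).2].
have fXZ : form lam X W Z V = mass Z.
  rewrite (form_wsolf gi XW W0 ZV) -[LHS]mulN1r -IntZ; last first.
    by apply: intg_sum => i _; exact: intgM_cont (gi i) (tpair_cont ZV).
  apply: eq_Int => x _; rewrite mulr_sumr; apply: eq_bigr => i _; rewrite /g; ring.
pose h x := \sum_i `|g i x|.
have hi : intg 0 pi h by apply: intg_sum => i _; exact: intg_norm.
have h2 x : h x ^+ 2 <= 2 * N%:R * rm * \sum_i r x * (Z i x * Z i x).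
  apply: le_trans (sum_sqr_le _) _; rewrite -(mulrA (2 * N%:R) rm) ler_wpM2l ?mulr_ge0// mulr_sumr.
  apply: ler_sum => i _; have [r0 r1] := weight_bounds x.
  have -> : `|g i x| ^+ 2 = r x * (r x * (Z i x * Z i x)).
    by rewrite real_normK ?num_real// /g; ring.
  by rewrite ler_wpM2r// mulr_ge0// -expr2 sqr_ge0.
have h2i : intg 0 pi (fun x => h x ^+ 2).
  pose h' x := \sum_i `|Z i x|.
  have h'c : cont_on 0 pi h' by apply: cont_on_sum => i _; exact/cont_on_norm/(tpair_cont ZV).
  have := intg_rho alpha (intg_rho alpha (intg_jump2 a (intg_jump2 a (cont_on_intg (cont_onM h'c h'c))))).
  apply: intg_eq => x _; rewrite /h /h'.
  have -> : \sum_i `|g i x| = r x * \sum_i `|Z i x|.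
    rewrite mulr_sumr; apply: eq_bigr => i _.
    by rewrite normrN normrM ger0_norm//; exact: (weight_bounds x).1.
  ring.
have G2 : (Int 0 pi h) ^+ 2 <= pi * (2 * N%:R * rm) * mass Z.
  apply: le_trans (Int_sqr_le hi h2i) _; rewrite -mulrA ler_wpM2l ?(ltW pi0)//.
  rewrite /mass -IntZ; last exact: mass_intg ZV.
  by apply: le_Int => //; apply: intgZ; exact: mass_intg ZV.
have fXX : form lam X W X W <= K * mass Z.
  rewrite (form_wsolf gi XW W0 XWt).
  have gXi : intg 0 pi (fun x => \sum_i g i x * X i x).
    by apply: intg_sum => i _; exact: intgM_cont (gi i) (tpair_cont XWt).
  apply: le_trans (ler_norm _) _; rewrite normrN; apply: le_trans (norm_Int_le gXi) _.
  apply: (@le_trans _ _ (Int 0 pi (fun x => C * Int 0 pi h * h x))).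
    apply: le_Int => [||x xp]; [exact: intg_norm|exact: intgZ|].
    apply: le_trans (ler_norm_sum _ _ _) _; rewrite /h mulr_sumr; apply: ler_sum => i _.
    by rewrite normrM mulrC ler_wpM2r// XB.
  rewrite IntZ// -mulrA -expr2.
  apply: le_trans (ler_wpM2l C0 G2) _.
  by rewrite (mulrA C _ (mass Z)) ler_wpM2r ?mass_ge0// lerDr.
have := pos _ _ (tpairD (- K) XWt ZV); rewrite formD// fXZ => H.
rewrite ler_pdivrMl//; move: (form lam X W X W) (form lam Z V Z V) (mass Z) fXX H => A B m fXX H.
have : 0 <= K * (K * B - m) by nra.
by rewrite pmulr_rge0// subr_ge0.
Qed.

Hypothesis q0 : forall i j, Int 0 pi (q i j) = 0.

(* Integrating by parts with F' = q_ij, F(0) = F(pi) = 0 replaces q by a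
   bounded function. *)
Lemma form_bounded_below : exists lam, forall Z V, tpair Z V -> 0 <= form lam Z V Z V.
Proof.
pose F i j x := 0 + Int 0 x (q i j).
have Fp i j : prim 0 pi (F i j) (q i j) by exact: prim_of_intg.
have F0 i j : F i j 0 = 0 by rewrite /F set_itv1 Rintegral_set1 addr0.
have Fpi i j : F i j pi = 0 by rewrite /F q0 addr0.
have /choice[M MP] (ij : 'I_N * 'I_N) : exists M : R, 0 <= M /\ forall x, 0 <= x <= pi -> `|F ij.1 ij.2 x| <= M.
  by have [M M0 MP] := cont_on_bounded (prim_cont (Fp ij.1 ij.2)); exists M.
pose M1 := \sum_ij M ij.
have M10 : 0 <= M1 by apply: sumr_ge0 => ij _; exact: (MP ij).1.
have FM i j x : 0 <= x <= pi -> `|F i j x| <= M1.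
  move=> xp; apply: le_trans ((MP (i, j)).2 x xp) _.
  by rewrite /M1 (bigD1 (i, j))//= lerDl sumr_ge0// => ij _; exact: (MP ij).1.
(* Splitting F V Z into V^2 / n + n M1^2 Z^2 and summing over all pairs of indices repeats each
   component 2 N times; since n >= 2 N, at most the available V^2 is spent. *)
pose n := (2 * N.+1)%:R : R.
have n0 : 0 < n by rewrite ltr0n.
have nN : 2 * N%:R <= n by rewrite /n natrM ler_pM2l// ler_nat.
(* A lower bound for [jump]^4 rho on both halves. Dividing by it in [L] makes the shift dominate the
   terms in Z^2, after 1 / [jump]^2 has been factored out. *)
pose om := Num.min 1 (a ^+ 2 * (a ^+ 2 * alpha ^+ 2)).
have om0 : 0 < om by rewrite lt_min ltr01/= !mulr_gt0 ?exprn_gt0.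
pose L := n * (M1 ^+ 2 * n) / om.
have L0 : 0 <= L by rewrite divr_ge0 ?(ltW om0)// !mulr_ge0 ?sqr_ge0// ltW.
exists (- L) => Z V ZV.
(* [P] vanishes at 0 and pi, so its derivative [p] has integral zero; subtracting it eliminates q
   from the integrand, which is then nonnegative pointwise. *)
pose P x := \sum_i \sum_j F i j x * (Z j x * Z i x).
pose p x := \sum_i \sum_j (q i j x * (Z j x * Z i x)
  + F i j x * (V j x / jump a x ^+ 2 * Z i x + Z j x * (V i x / jump a x ^+ 2))).
have Pp : prim 0 pi P p.
  apply: prim_sum; first exact: pi_ge0.
  move=> i; apply: prim_sum; first exact: pi_ge0.
  by move=> j; apply: prim_mul (pi_ge0 R) (Fp i j) (prim_mul (pi_ge0 R) (ZV j).1 (ZV i).1).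
have p0 : Int 0 pi p = 0.
  rewrite -(primB Pp (lexx 0) (pi_ge0 R) (lexx pi)) /P.
  by rewrite !big1 ?subrr// => i _; rewrite big1// => j _; rewrite ?F0 ?Fpi mul0r.
have -> : form (- L) Z V Z V = form (- L) Z V Z V - Int 0 pi p by rewrite p0 subr0.
rewrite /form -IntB; [|exact: density_intg|exact: prim_intg Pp].
apply: Int_ge0 => x xp; rewrite /density /p -sumrB.
set w := jump a x ^+ 2; have w0 : 0 < w by rewrite exprn_gt0// jump_gt0.
have omw : om <= w * (w * rho alpha x).
  rewrite /w /om ge_min; have [x2|x2] := ltP x (pi / 2).
    by rewrite jumpl// rhol// expr1n !mul1r lexx.
  by rewrite jumpr// rhor// lexx orbT.
have Lw : n * (M1 ^+ 2 * n) <= L * (w * (w * rho alpha x)).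
  by apply: (@le_trans _ _ (L * om)); [rewrite /L divfK// gt_eqF|rewrite ler_wpM2l].
have E i : V i x * V i x / w + (\sum_j q i j x * Z j x) * Z i x - - L * (w * rho alpha x) * (Z i x * Z i x)
   - \sum_j (q i j x * (Z j x * Z i x) + F i j x * (V j x / w * Z i x + Z j x * (V i x / w))) =
  w^-1 * (V i x ^+ 2 + L * (w * (w * rho alpha x)) * Z i x ^+ 2 - \sum_j F i j x * (V j x * Z i x + Z j x * V i x)).
  rewrite big_split/= mulr_suml.
  have -> : \sum_j F i j x * (V j x / w * Z i x + Z j x * (V i x / w)) =
      w^-1 * \sum_j F i j x * (V j x * Z i x + Z j x * V i x).
    by rewrite mulr_sumr; apply: eq_bigr => j _; ring.
  rewrite (eq_bigr (fun j => q i j x * (Z j x * Z i x))) => [|j _]; last by rewrite mulrA.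
  by move: (\sum_j _) (\sum_j _) => A B; field; rewrite gt_eqF.
rewrite (eq_bigr _ (fun i _ => E i)) -mulr_sumr mulr_ge0 ?invr_ge0 ?(ltW w0)//.
rewrite sumrB subr_ge0.
pose k := M1 ^+ 2 * n.
have bound i j : F i j x * (V j x * Z i x + Z j x * V i x) <=
    (V i x ^+ 2 / n + k * Z i x ^+ 2) + (V j x ^+ 2 / n + k * Z j x ^+ 2).
  have Fk : F i j x ^+ 2 <= M1 ^+ 2.
    by rewrite -(real_normK (num_real (F i j x))) ler_pXn2r// ?nnegrE// FM.
  have step u v : F i j x * (u * v) <= u ^+ 2 / n + k * v ^+ 2.
    have : F i j x ^+ 2 * (n * v ^+ 2) <= k * v ^+ 2.
      by rewrite /k -mulrA ler_wpM2r// mulr_ge0 ?sqr_ge0// ltW.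
    have : 0 <= (u - n * F i j x * v) ^+ 2 / n + u ^+ 2 / n + F i j x ^+ 2 * (n * v ^+ 2).
      apply: addr_ge0; first by apply: addr_ge0; exact: divr_ge0 (sqr_ge0 _) (ltW n0).
      exact: mulr_ge0 (sqr_ge0 _) (mulr_ge0 (ltW n0) (sqr_ge0 _)).
    have -> : (u - n * F i j x * v) ^+ 2 / n = u ^+ 2 / n - 2 * (F i j x * (u * v)) + F i j x ^+ 2 * (n * v ^+ 2).
      by field; rewrite gt_eqF.
    move: (u ^+ 2 / n) (F i j x * (u * v)) (F i j x ^+ 2 * _) (k * v ^+ 2) => *; lra.
  rewrite mulrDr (mulrC (Z j x)); have := lerD (step (V j x) (Z i x)) (step (V i x) (Z j x)).
  move: (V i x ^+ 2 / n) (V j x ^+ 2 / n) (k * Z i x ^+ 2) (k * Z j x ^+ 2) => *; lra.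
apply: (@le_trans _ _ (\sum_i \sum_j ((V i x ^+ 2 / n + k * Z i x ^+ 2) + (V j x ^+ 2 / n + k * Z j x ^+ 2)))).
  by apply: ler_sum => i _; apply: ler_sum => j _; exact: bound.
have S (b : 'I_N -> R) : \sum_i \sum_j (b i + b j) = 2 * N%:R * \sum_i b i.
  have Eb i : \sum_j (b i + b j) = N%:R * b i + \sum_j b j.
    by rewrite big_split/= sumr_const card_ord mulr_natl.
  rewrite (eq_bigr _ (fun i _ => Eb i)) big_split/= -mulr_sumr sumr_const card_ord.
  by rewrite -[X in _ + X]mulr_natl; ring.
rewrite S; have b0 i : 0 <= V i x ^+ 2 / n + k * Z i x ^+ 2.
  have k0 : 0 <= k := mulr_ge0 (sqr_ge0 _) (ltW n0).
  exact: addr_ge0 (divr_ge0 (sqr_ge0 _) (ltW n0)) (mulr_ge0 k0 (sqr_ge0 _)).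
apply: le_trans (ler_wpM2r (sumr_ge0 _ (fun i _ => b0 i)) nN) _.
rewrite mulr_sumr; apply: ler_sum => i _; rewrite mulrDr mulrC divfK ?gt_eqF// lerD2l.
by rewrite (mulrA n k) ler_wpM2r ?sqr_ge0.
Qed.

(** The set [S] of admissible lam is bounded above by 0 if it does not contain 0. Its supremum would
    then be a negative element at which the gap yields a larger one. *)
Lemma form_ge0 : (forall lam, lam < 0 -> Neumann_injective lam) ->
  forall Z V, tpair Z V -> 0 <= form 0 Z V Z V.
Proof.
move=> inj; pose S := [set lam | forall Z V, tpair Z V -> 0 <= form lam Z V Z V].
suff : S 0 by [].
apply: contrapT => S0.
have ubS lam : S lam -> lam <= 0.
  move=> Sl; rewrite leNgt; apply/negP => l0; apply: S0 => Z V ZV.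
  have := form_shift lam (- lam) ZV; rewrite subrr => ->.
  by rewrite mulNr opprK addr_ge0 ?Sl// mulr_ge0 ?mass_ge0// ltW.
have supS : has_sup S by split; [have [lam] := form_bounded_below; exists lam|exists 0].
pose s := sup S.
(* The supremum is attained because, for a fixed pair, the form is affine in lam. Using mass Z + 1
   avoids dividing by zero. *)
have Ss : S s.
  move=> Z V ZV; rewrite leNgt; apply/negP => f0.
  have m0 := mass_ge0 Z; have m1 : 0 < mass Z + 1 by rewrite ltr_wpDl.
  have e0 : 0 < - form s Z V Z V / (mass Z + 1) by rewrite divr_gt0// oppr_gt0.
  have [lam Sl] := sup_adherent e0 supS; rewrite -/s => sl.
  have := Sl _ _ ZV; rewrite -(subrKC s lam) (form_shift _ _ ZV).
  have : (s - lam) * (mass Z + 1) < - form s Z V Z V by rewrite -ltr_pdivlMr//; lra.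
  have : lam <= s by apply: ub_le_sup => //; exact: supS.2.
  move: (form s Z V Z V) (mass Z) m0 => f m m0 h1 h2; nra.
have s0 : s < 0.
  rewrite lt_neqAle (ubS _ Ss) andbT; apply/eqP => s0; apply: S0; by rewrite -s0.
have [d d0 gap] := form_gap (inj _ s0) Ss.
have : S (s + d) by move=> Z V ZV; rewrite (form_shift _ _ ZV) subr_ge0 gap.
move=> /(ub_le_sup supS.2); rewrite -/s gerDl leNgt d0//.
Qed.

Lemma prim_const_ae0 (c d : R) (F f : R -> R) : prim c d F f ->
  (forall x, c <= x <= d -> F x = F c) -> {ae mu, forall x, c < x < d -> f x = 0}.
Proof.
move=> Ff Fc; apply: aeW (prim_is_derive Ff) => x /[swap] xcd /(_ xcd) h.
have : is_derive x 1 F 0.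
  apply: (is_derive_eq_itv (c := c) (d := d) (F := fun=> F c)) => // z /andP[cz zd].
  by rewrite Fc// !ltW.
by case=> _ <-; case: h.
Qed.

(** The first variation at e_j is taken in the direction ze e_i, where F is the primitive of q_ij
    and ze' = F / [jump]^2. Its vanishing means Int q_ij ze = 0; integrating by parts, with F zero
    at both ends, gives Int F^2 / [jump]^2 = 0, so F = 0. *)
Lemma potential_ae0 : (forall Z V, tpair Z V -> 0 <= form 0 Z V Z V) ->
  forall i j, {ae mu, forall x, 0 < x < pi -> q i j x = 0}.
Proof.
move=> pos i j; have pi0 := pi_ge0 R.
pose F x := 0 + Int 0 x (q i j).
have Fp : prim 0 pi F (q i j) by exact: prim_of_intg.
have F0 : F 0 = 0 by rewrite /F set_itv1 Rintegral_set1 addr0.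
have Fpi : F pi = 0 by rewrite /F q0 addr0.
have Fc := prim_cont Fp.
have Fwi : intg 0 pi (fun x => F x / jump a x ^+ 2) by exact/intg_jump2V/cont_on_intg.
pose ze x := 0 + Int 0 x (fun x => F x / jump a x ^+ 2).
have zp : prim 0 pi ze (fun x => F x / jump a x ^+ 2) by exact: prim_of_intg.
pose Z1 (k : 'I_N) (x : R) : R := (k == j)%:R.
pose V1 (k : 'I_N) (x : R) : R := 0.
have ZV1 : tpair Z1 V1.
  move=> k; split; last exact: cont_on_cst.
  by apply: prim_eqr (prim_cst (k == j)%:R pi0) => x _; rewrite mul0r.
pose X k x := (k == i)%:R * ze x.
pose W k x := (k == i)%:R * F x.
have XW : tpair X W.
  move=> k; split; last by apply: cont_onM => //; exact: cont_on_cst.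
  by apply: prim_eqr (primZ (k == i)%:R zp) => x _; rewrite mulrA.
have sum1 (l : 'I_N) (f : 'I_N -> R) : \sum_k f k * (k == l)%:R = f l.
  by rewrite (bigD1 l)//= eqxx mulr1 big1 ?addr0// => k /negbTE ->; rewrite mulr0.
have f1 : form 0 Z1 V1 Z1 V1 = 0.
  transitivity (Int 0 pi (q j j)); last exact: q0.
  apply: eq_Int => x _; rewrite /density.
  rewrite -[RHS](sum1 j (fun k => q k j x)); apply: eq_bigr => k _.
  by rewrite sum1 /V1 !mul0r add0r subr0.
have f2 : form 0 Z1 V1 X W = Int 0 pi (fun x => q i j x * ze x).
  apply: eq_Int => x _; rewrite /density.
  rewrite -[RHS](sum1 i (fun k => q k j x * ze x)); apply: eq_bigr => k _.
  by rewrite sum1 /V1 /X !mul0r add0r subr0 -mulrA; congr (_ * _); rewrite mulrC.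
have Izeta : Int 0 pi (fun x => q i j x * ze x) = 0.
  rewrite -f2; set B := form _ _ _ _ _; pose D := form 0 X W X W.
  have D0 : 0 <= D by exact: pos.
  have H t : 0 <= 2 * t * B + t ^+ 2 * D.
    by have := pos _ _ (tpairD t ZV1 XW); rewrite formD// f1 add0r.
  have D1 : 0 < D + 1 by rewrite ltr_wpDl.
  (* At this t the quadratic 2 t B + t^2 D is negative unless B = 0; the added 1 covers D = 0. *)
  have := H (- (B / (D + 1))).
  have -> : 2 * - (B / (D + 1)) * B + (- (B / (D + 1))) ^+ 2 * D = - (B ^+ 2 * ((D + 2) / (D + 1) ^+ 2)).
    by field; rewrite gt_eqF.
  have c0 : 0 < (D + 2) / (D + 1) ^+ 2 by rewrite divr_gt0 ?exprn_gt0// ltr_wpDl.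
  rewrite oppr_ge0 pmulr_lle0// => B2.
  by apply/eqP; rewrite -sqrf_eq0 eq_le B2 sqr_ge0.
have F2i : intg 0 pi (fun x => F x * (F x / jump a x ^+ 2)).
  by apply: intg_eq (intg_jump2V a (cont_on_intg (cont_onM Fc Fc))) => x _; rewrite mulrA.
have F2pos x : 0 <= F x * (F x / jump a x ^+ 2) by rewrite mulrA -expr2 divr_ge0 ?sqr_ge0.
have IF2 : Int 0 pi (fun x => F x * (F x / jump a x ^+ 2)) = 0.
  have P := prim_mul pi0 Fp zp; have := primB P (lexx 0) pi0 (lexx pi).
  rewrite F0 Fpi !mul0r subr0 IntD ?Izeta ?add0r//.
  exact: intgM_cont (prim_cont zp).
have Hc x : 0 <= x <= pi -> 0 + Int 0 x (fun x => F x * (F x / jump a x ^+ 2)) =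
    0 + Int 0 0 (fun x => F x * (F x / jump a x ^+ 2)).
  move=> xp; rewrite !add0r set_itv1 Rintegral_set1; apply/eqP; rewrite eq_le.
  rewrite Int_ge0 ?andbT// -[leRHS]IF2; exact: Int_ge0_subr.
have F2ae := prim_const_ae0 (prim_of_intg 0 F2i) Hc.
have Fae : {ae mu, forall x, 0 < x < pi -> F x = 0}.
  apply: aeW F2ae => x h xp; have := h xp; rewrite mulrA => /eqP.
  by rewrite -expr2 mulf_eq0 invr_eq0 !sqrf_eq0 (gt_eqF (jump_gt0 a0 x)) orbF => /eqP.
have FF0 x : 0 <= x <= pi -> F x = 0.
  have P : prim 0 pi (fun x => F x * F x) (fun=> 0).
    apply: (prim_aer (intg_cst 0 pi 0) _ (prim_mul pi0 Fp Fp)).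
    by apply: aeW Fae => t h tp; rewrite h// mulr0 mul0r addr0.
  move=> xp; have := primE P xp; rewrite F0 mul0r Int_cst; last by case/andP: xp.
  by rewrite mul0r addr0 => /eqP; rewrite mulf_eq0 orbb => /eqP.
by apply: prim_const_ae0 Fp _ => x xp; rewrite F0 FF0.
Qed.

End quadratic_form.

(** * Absence of negative eigenvalues *)

Section spectrum.
Variables (R : realType) (N : nat) (alpha a : R).
Hypotheses (alpha0 : 0 < alpha) (a0 : 0 < a).
Local Notation mu := (@lebesgue_measure R).
Implicit Types (Z V : 'I_N -> R -> R) (lam : R).

Lemma cut_interval_itv (x : R) : cut_interval x -> 0 <= x <= pi.
Proof.
by move=> /cut_intervalP[] /andP[h1 h2]; apply/andP; split; have := pi_gt0 R; lra.
Qed.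

(** For lam < 0 the product Z_j V_j is nondecreasing and vanishes at both ends, hence is zero. So
    Z_j^2 is constant, and the positive lower bound [om] of the weight forces the constant to be
    0. *)
Lemma wsol_free_neg lam Z V : lam < 0 -> wsol alpha a (fun _ _ _ => 0) lam Z V ->
  (forall j, V j 0 = 0 /\ V j pi = 0) -> forall j x, 0 <= x <= pi -> Z j x = 0.
Proof.
move=> lam0 ws V0 j; have [Zp Vp0] := ws j; have pi0 := pi_ge0 R.
have Vp : prim 0 pi (V j) (fun x => - lam * (jump a x ^+ 2 * rho alpha x) * Z j x).
  by apply: prim_eqr Vp0 => x _; rewrite big1 ?sub0r ?mulNr// => k _; rewrite mul0r.
pose om := Num.min 1 (a ^+ 2 * alpha ^+ 2).
have om0 : 0 < om by rewrite lt_min ltr01/= mulr_gt0 ?exprn_gt0.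
have omw x : om <= jump a x ^+ 2 * rho alpha x.
  rewrite /om ge_min; have [x2|x2] := ltP x (pi / 2).
    by rewrite jumpl// rhol// expr1n !mul1r lexx.
  by rewrite jumpr// rhor// lexx orbT.
have P := prim_mul pi0 Zp Vp.
have h0 x : - lam * om * Z j x ^+ 2 <= V j x / jump a x ^+ 2 * V j x +
    Z j x * (- lam * (jump a x ^+ 2 * rho alpha x) * Z j x).
  have -> : V j x / jump a x ^+ 2 * V j x = V j x ^+ 2 / jump a x ^+ 2 by ring.
  have -> : Z j x * (- lam * (jump a x ^+ 2 * rho alpha x) * Z j x) =
    - lam * (jump a x ^+ 2 * rho alpha x) * Z j x ^+ 2 by ring.
  rewrite -[leLHS]add0r; apply: lerD; first by rewrite divr_ge0 ?sqr_ge0.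
  by rewrite ler_wpM2r ?sqr_ge0// ler_wpM2l// oppr_ge0 ltW.
have c0 x : 0 <= - lam * om * Z j x ^+ 2.
  by rewrite mulr_ge0 ?sqr_ge0// mulr_ge0 ?oppr_ge0 ?ltW.
have ZV0 x : 0 <= x <= pi -> Z j x * V j x = 0.
  move=> /andP[x0 xp]; apply/eqP; rewrite eq_le; apply/andP; split.
    have := prim_nondecreasing P (fun x _ => le_trans (c0 x) (h0 x)) x0 xp (lexx pi).
    by rewrite (V0 j).2 mulr0.
  have := prim_nondecreasing P (fun x _ => le_trans (c0 x) (h0 x)) (lexx 0) x0 xp.
  by rewrite (V0 j).1 mulr0.
have Z2 : prim 0 pi (fun x => Z j x * Z j x) (fun=> 0).
  apply: prim_eqr (prim_mul pi0 Zp Zp) => x xp.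
  have -> : V j x / jump a x ^+ 2 * Z j x + Z j x * (V j x / jump a x ^+ 2) =
    2 * (Z j x * V j x) / jump a x ^+ 2 by ring.
  by rewrite ZV0// mulr0 mul0r.
have Zc x : 0 <= x <= pi -> Z j x ^+ 2 = Z j 0 ^+ 2.
  move=> xp; rewrite !expr2 (primE Z2 xp) Int_cst ?mul0r ?addr0//.
  by case/andP: xp.
have IP := primB P (lexx 0) pi0 (lexx pi).
have : Int 0 pi (fun x => - lam * om * Z j 0 ^+ 2) <= Z j pi * V j pi - Z j 0 * V j 0.
  rewrite IP; apply: le_Int; [exact: intg_cst|exact: prim_intg P|].
  by move=> x xp; rewrite -(Zc x xp).
rewrite (V0 j).1 (V0 j).2 !mulr0 subrr.
rewrite Int_cst// subr0 pmulr_lle0 ?pi_gt0// pmulr_rle0; last by rewrite mulr_gt0// oppr_gt0.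
move=> Z0 x xp; apply/eqP; rewrite -sqrf_eq0 eq_le sqr_ge0 andbT.
by rewrite Zc.
Qed.

Lemma free_eigenvalues_ge0 (lam0 : nat -> R) n :
  SL_eigenvalues alpha a (fun _ : R => 0 : 'M[R]_N) lam0 -> 0 <= lam0 n.
Proof.
case=> _ _ /(_ (lam0 n)%:C%C)[k [b [bs bfree _]] kE]; rewrite leNgt; apply/negP => neg.
(* The index n itself carries the value lam0 n, so the multiplicity is positive and a nonzero
   solution exists. *)
have k0 : (0 < k)%N.
  rewrite lt0n; apply/eqP => k0; move: kE; rewrite k0 II0 card_eq0 => /eqP e0.
  by have : [set m | (lam0 m)%:C%C = (lam0 n)%:C%C] n by []; rewrite e0.
pose i0 := Ordinal k0.
have [sR sI] := SL_solution_rsol (bs i0).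
have qi (j l : 'I_N) : intg 0 pi (fun _ : R => 0 : R) by exact: intg_cst.
have qQ : {ae mu, forall x, 0 < x < pi -> forall j l : 'I_N,
    0 = jump a x ^+ 2 * (fun=> 0 : 'M[R]_N) x j l}.
  by apply: (aeW _ (ae_neq 0)) => x _ _ j l; rewrite mxE mulr0.
have [Z1 [V1 [w1 v1 e1]]] := rsol_wsol (q := fun _ _ _ => 0) a0 qi qQ sR.
have [Z2 [V2 [w2 v2 e2]]] := rsol_wsol (q := fun _ _ _ => 0) a0 qi qQ sI.
have := bfree (fun i => (i == i0)%:R) _ i0; rewrite eqxx => /(_ _)/wrap[x xc|].
  rewrite (bigD1 i0)//= big1 ?addr0 => [|i /negbTE ->]; last by rewrite scale0r.
  rewrite scale1r; apply/matrixP => j l; rewrite ord1 mxE.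
  have xp := cut_interval_itv xc.
  apply: complex_eq => /=.
    by rewrite e1// (wsol_free_neg neg w1 v1)// mulr0.
  by rewrite e2// (wsol_free_neg neg w2 v2)// mulr0.
by move/eqP; rewrite oner_eq0.
Qed.

(** A negative number does not occur in the sequence, so its solution space has dimension 0. The
    initial value Z(0) is reached as a limit from the left half, where Z vanishes. *)
Lemma neg_Neumann_injective (Q : R -> 'M[R]_N) q (lamQ : nat -> R) lam :
  (forall j k, intg 0 pi (q j k)) ->
  {ae mu, forall x, 0 < x < pi -> forall j k, q j k x = jump a x ^+ 2 * Q x j k} ->
  SL_eigenvalues alpha a Q lamQ -> (forall n, 0 <= lamQ n) -> lam < 0 ->
  Neumann_injective alpha a q lam.
Proof.
move=> qi qQ [_ _ /(_ lam%:C%C)[k [b [_ _ bspan]] kE]] lam_ge0 lam0 Z V ws V0 i.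
have {kE} k0 : k = 0%N.
  apply/card_eq_II; apply: card_eq_trans (_ : [set n | (lamQ n)%:C%C = lam%:C%C] #= `I_0)%card.
    by rewrite card_eq_sym.
  rewrite II0 card_eq0; apply/eqP/seteqP; split=> // n [] /= e.
  by have := lam_ge0 n; rewrite e leNgt lam0.
have [c cE] := bspan _ (wsol_SL_solution a0 qi qQ ws V0).
have p2 : (0 : R) < pi / 2 by rewrite divr_gt0// pi_gt0.
have Zc : cont_on 0 (pi / 2) (Z i).
  by apply: cont_on_sub (lexx 0) _ (prim_cont (ws i).1); have := pi_gt0 R; lra.
apply: (cont_const_open (k := 0) p2 Zc); last by rewrite lexx ltW.
move=> x xp; have xc : cut_interval x by apply/cut_intervalP; left.
have := cE x xc; rewrite big1 => [/matrixP/(_ i 0)|[l lk]]; last by exfalso; rewrite k0 in lk.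
rewrite !mxE => -[/eqP]; rewrite mulf_eq0 => /orP[|/eqP//].
by rewrite gt_eqF// jump_gt0.
Qed.
End spectrum.

(** * From equal spectra to zero potential *)

Theorem theorem1p1 (R : realType) (N : nat) (alpha a : R) (Q : R -> 'M[R]_N)
    (lamQ lam0 : nat -> R) :
  (0 < N)%N -> 0 < alpha -> alpha < 1 -> 0 < a ->
  (forall i j : 'I_N, L2_0pi (fun x => Q x i j)) ->
  {ae @lebesgue_measure R, forall x, 0 < x < pi -> (Q x)^T = Q x} ->
  SL_eigenvalues alpha a Q lamQ ->
  SL_eigenvalues alpha a (fun _ : R => 0 : 'M[R]_N) lam0 ->
  (forall n : nat, lamQ n = lam0 n) ->
  {ae @lebesgue_measure R, forall x, 0 < x < pi -> Q x = 0}.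
Proof.
move=> _ alpha0 _ a0 QL2 Qsym HQ H0 lamE.
have /choice[g gP] (ij : 'I_N * 'I_N) : exists g, [/\ intg 0 pi g, intg 0 pi (fun x => g x ^+ 2) &
    {ae @lebesgue_measure R, forall x, 0 < x < pi -> Q x ij.1 ij.2 = g x}].
  exact: L2_0piE (QL2 ij.1 ij.2).
(* Both triangles are read off from one: Q is symmetric only almost everywhere, whereas the form is
   treated with the exact equality of q i j and q j i. *)
pose gs (i j : 'I_N) := if (i <= j)%N then g (i, j) else g (j, i).
have gsym i j : gs i j = gs j i.
  rewrite /gs; case: (ltngtP i j) => // e.
  by rewrite (val_inj e).
pose q i j x := gs i j x * jump a x ^+ 2.
have qi i j : intg 0 pi (q i j).
  by apply: intg_jump2; rewrite /gs; case: ifP => _; [have [] := gP (i, j)|have [] := gP (j, i)].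
have q2i i j : intg 0 pi (fun x => q i j x ^+ 2).
  have h : intg 0 pi (fun x => gs i j x ^+ 2).
    by rewrite /gs; case: ifP => _; [have [] := gP (i, j)|have [] := gP (j, i)].
  by apply: intg_eq (intg_jump2 a (intg_jump2 a h)) => x _; rewrite /q; ring.
have gQ : {ae @lebesgue_measure R, forall x, forall ij : 'I_N * 'I_N, 0 < x < pi -> Q x ij.1 ij.2 = g ij x}.
  by apply: ae_forall_fin => ij; have [] := gP ij.
have qQ : {ae @lebesgue_measure R, forall x, 0 < x < pi -> forall i j, q i j x = jump a x ^+ 2 * Q x i j}.
  apply: aeW2 Qsym gQ => x sx gx xp i j; rewrite /q mulrC; congr (_ * _); rewrite /gs.
  case: ifP => _; first by rewrite -(gx (i, j) xp).
  by rewrite -(gx (j, i) xp)/= -{1}(sx xp) mxE.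
have qs i j : q i j = q j i by apply/funext => x; rewrite /q gsym.
have q0 : forall i j, Int 0 pi (q i j) = 0.
  apply: (Int_q_eq0 alpha0 a0 qi q2i) => lam phi psi [pp sp p0 s0 spi].
  exact: (eigen_data a0 qi qQ HQ H0 lamE pp sp p0 s0 spi).
have lam_ge0 n : 0 <= lamQ n by rewrite lamE; exact: (free_eigenvalues_ge0 alpha0 a0 n H0).
have pos := form_ge0 alpha0 a0 qi qs q0
  (fun lam lam0 => neg_Neumann_injective a0 qi qQ HQ lam_ge0 lam0).
have qae : {ae @lebesgue_measure R, forall x, forall ij : 'I_N * 'I_N, 0 < x < pi -> q ij.1 ij.2 x = 0}.
  by apply: ae_forall_fin => ij; exact: (potential_ae0 a0 qi qs q0 pos).
apply: aeW2 qQ qae => x qx h xp; apply/matrixP => i j; rewrite mxE.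
have := qx xp i j; rewrite (h (i, j) xp) => /esym/eqP; rewrite mulf_eq0 sqrf_eq0.
by rewrite (gt_eqF (jump_gt0 a0 x)) => /eqP.
Qed.
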